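(* Let $X\neq L^\infty$ be a rearrangement invariant (r.i.) space on $[0,1]$. (a) If the integration operator $I_{m_X}\colon L^1(m_X)\to X$ is weakly compact, then $[\mathcal{C},X]$ is weakly sequentially complete. If, in addition, $\overline{\alpha}_X<1$, then $\mathcal{C}\colon X\to X$ is also weakly compact. (b) If the integration operator $I_{m_X}\colon L^1(m_X)\to X$ is completely continuous, then $[\mathcal{C},X]$ is weakly sequentially complete. If, in addition, $\overline{\alpha}_X<1$, then $\mathcal{C}\colon X\to X$ is also completely continuous.
   Context: $\lambda$ is Lebesgue measure on $[0,1]$, $\mathcal{M}$ the $\sigma$-algebra of Lebesgue measurable subsets of $[0,1]$, $f^*$ the decreasing rearrangement of a measurable function $f$ on $[0,1]$ (right-continuous inverse of $\tau\mapsto\lambda(\{|f|>\tau\})$). Functions are real-valued. A Banach function space (B.f.s.) $X$ on $[0,1]$ is a Banach space of ($\lambda$-a.e. classes of) measurable functions on $[0,1]$ such that $g\in X$ and $\|g\|_X\le\|f\|_X$ whenever $f\in X$ and $|g|\le|f|$ a.e. A r.i. space is a B.f.s. on $[0,1]$ such that if $g^*\le f^*$ and $f\in X$ then $g\in X$ and $\|g\|_X\le\|f\|_X$. Every r.i. space satisfies $L^\infty\subseteq X\subseteq L^1$. The Fatou property is not assumed. The Cesàro operator is $\mathcal{C}(f)(x):=\frac1x\int_0^x f(t)\,dt$. The Cesàro space is the B.f.s. $[\mathcal{C},X]:=\{f:\mathcal{C}(|f|)\in X\}$ with norm $\|f\|_{[\mathcal{C},X]}:=\|\mathcal{C}(|f|)\|_X$.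 The set function $m_X\colon\mathcal{M}\to X$, $m_X(A):=\mathcal{C}(\chi_A)$, is a $\sigma$-additive vector measure with the same null sets as $\lambda$. For a vector measure $m\colon\mathcal{M}\to X$ and $x^*\in X^*$ let $x^*m(A)=\langle m(A),x^*\rangle$, with variation $|x^*m|$. A measurable $f$ is $m$-integrable if $f\in L^1(|x^*m|)$ for all $x^*\in X^*$ and for each $A\in\mathcal{M}$ there is $\int_A f\,dm\in X$ with $\langle\int_A f\,dm,x^*\rangle=\int_A f\,d(x^*m)$ for all $x^*\in X^*$. $L^1(m)$ is the Banach space of (classes modulo $m$-null sets of) $m$-integrable functions with norm $\|f\|_{L^1(m)}=\sup_{\|x^*\|\le1}\int|f|\,d|x^*m|$. The integration operator $I_m\colon L^1(m)\to X$ is $I_m(f):=\int_{[0,1]}f\,dm$. The upper Boyd index is $\overline{\alpha}_X:=\lim_{t\to\infty}\frac{\log\|\sigma_t\|_{X\to X}}{\log t}$, where $(\sigma_tf)(s):=f(s/t)$ if $s/t\in[0,1]$ and $0$ otherwise, $s\in[0,1]$. It is known that $\mathcal{C}$ maps $X$ (boundedly) into $X$ if and only if $\overline{\alpha}_X<1$. An operator is completely continuous if it maps weakly convergent sequences to norm convergent sequences. *)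

(* Defs.v *)
From HB Require Import structures.
From mathcomp Require Import all_boot all_order all_algebra.
From mathcomp Require Import all_classical all_reals all_analysis.

Set Implicit Arguments.
Unset Strict Implicit.
Unset Printing Implicit Defensive.

Import Order.TTheory GRing.Theory Num.Theory.
Import numFieldNormedType.Exports.

Local Open Scope classical_set_scope.
Local Open Scope ring_scope.

(* The real line with the sigma-algebra of Lebesgue measurable sets (not only
   the Borel sets): the measurable type underlying
   [completed_lebesgue_measure]. *)
Definition lebT (R : realType) : measurableType _ :=
  caratheodory_type (R := R) (T := ocitv_type R) (mu_ext (wlength (@idfun R))).

Local Notation leb := completed_lebesgue_measure.

Local Notation I01 := (`[0, 1]%classic).

(* Functions on [0,1] are represented by functions R -> R of which only the
   values on [0,1] matter; a.e. classes are not quotiented out.  A normed space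
   of a.e. classes is thus a linear space of functions with a seminorm whose
   kernel is, for Banach function spaces, exactly the a.e. null functions
   ([banach_function_space] below).  The dual, norm convergence and the weak
   topology only see the classes. *)
Record fspace (R : realType) := FSpace {
  fcarrier :> (R -> R) -> Prop ;
  fnorm : (R -> R) -> R }.

Section functional_analysis.
Context {R : realType}.
Implicit Types E F : fspace R.

(* Only the restriction of phi to E matters. *)
Definition dual_space E : set ((R -> R) -> R) :=
  [set phi | (forall (a : R) f g, E f -> E g ->
               phi (a \*o f \+ g) = a * phi f + phi g) /\
             exists M, forall f, E f -> `|phi f| <= M * fnorm E f].

Definition dual_ball E : set ((R -> R) -> R) :=
  [set phi | dual_space E phi /\ forall f, E f -> `|phi f| <= fnorm E f].

Definition norm_cvg E (u : nat -> R -> R) (f : R -> R) :=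
  (fun n => fnorm E (u n \- f)) @ \oo --> (0 : R).

Definition norm_cauchy E (u : nat -> R -> R) :=
  forall e : R, 0 < e -> exists N : nat, forall m n : nat,
    (N <= m)%N -> (N <= n)%N -> fnorm E (u m \- u n) < e.

Definition weak_cvg E (u : nat -> R -> R) (f : R -> R) :=
  forall phi, dual_space E phi -> (fun n => phi (u n)) @ \oo --> phi f.

Definition weak_cauchy E (u : nat -> R -> R) :=
  forall phi, dual_space E phi -> cvg ((fun n => phi (u n)) @ \oo).

Definition weakly_sequentially_complete E :=
  forall u : nat -> R -> R, (forall n, E (u n)) -> weak_cauchy E u ->
    exists2 f, E f & weak_cvg E u f.

Definition dual_eval E (f : set_type (fcarrier E)) :
    {ptws set_type (dual_space E) -> R} :=
  fun phi => set_val phi (set_val f).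

Definition weak_space E : topologicalType := initial_topology (@dual_eval E).

Definition maps_into E F (T : (R -> R) -> R -> R) := forall f, E f -> F (T f).

Definition unit_ball E : set (R -> R) := [set f | E f /\ fnorm E f <= 1].

Definition weakly_compact E F (T : (R -> R) -> R -> R) :=
  maps_into E F T /\
  precompact [set g : weak_space F | (T @` unit_ball E) (set_val g)].

Definition completely_continuous E F (T : (R -> R) -> R -> R) :=
  maps_into E F T /\
  forall (u : nat -> R -> R) f, (forall n, E (u n)) -> E f -> weak_cvg E u f ->
    exists2 g, F g & norm_cvg F (fun n => T (u n)) g.

Definition op_norm E F (T : (R -> R) -> R -> R) : R :=
  sup [set fnorm F (T f) | f in unit_ball E].

End functional_analysis.

Section function_spaces.
Context {R : realType}.
Implicit Types (X : fspace R) (f g : R -> R).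

Definition Lmeasurable f :=
  measurable_fun (I01 : set (lebT R)) (f : lebT R -> R).

Definition Linfty : set (R -> R) :=
  [set f | Lmeasurable f /\
     exists M : R, {ae leb, forall x : lebT R, I01 x -> `|f x| <= M}].

Record banach_function_space X : Prop := BanachFunctionSpace {
  bfs_measurable : forall f, X f -> Lmeasurable f ;
  bfs_zero : X (cst 0) ;
  bfs_linear : forall (a : R) f g, X f -> X g -> X (a \*o f \+ g) ;
  bfs_norm_ge0 : forall f, X f -> 0 <= fnorm X f ;
  bfs_normZ : forall (a : R) f, X f -> fnorm X (a \*o f) = `|a| * fnorm X f ;
  bfs_normD : forall f g, X f -> X g ->
    fnorm X (f \+ g) <= fnorm X f + fnorm X g ;
  bfs_norm0 : forall f, X f ->
    (fnorm X f = 0 <-> {ae leb, forall x : lebT R, I01 x -> f x = 0}) ;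
  bfs_complete : forall u : nat -> R -> R, (forall n, X (u n)) ->
    norm_cauchy X u -> exists2 f, X f & norm_cvg X u f ;
  bfs_ideal : forall f g, X f -> Lmeasurable g ->
    {ae leb, forall x : lebT R, I01 x -> `|g x| <= `|f x|} ->
    X g /\ fnorm X g <= fnorm X f }.

Definition distribution_fun f (tau : R) : \bar R :=
  leb ([set x | I01 x /\ tau < `|f x|] : set (lebT R)).

(* f^*, the right-continuous inverse of the distribution function; it may be
   +oo at t = 0. *)
Definition rearrangement f (t : R) : \bar R :=
  ereal_inf [set tau%:E | tau in
    [set tau : R | 0 <= tau /\ (distribution_fun f tau <= t%:E)%E]].

(* The zero space, which satisfies the other clauses but does not contain
   L^oo, is excluded; L^oo `<=` X `<=` L^1 then follows. *)
Record ri_space X : Prop := RISpace {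
  ri_bfs : banach_function_space X ;
  ri_nontrivial : exists2 f, X f & fnorm X f != 0 ;
  ri_rearrangement : forall f g, X f -> Lmeasurable g ->
    (forall t : R, I01 t -> (rearrangement g t <= rearrangement f t)%E) ->
    X g /\ fnorm X g <= fnorm X f }.

Definition cesaro_op f : R -> R :=
  fun x => x^-1 * \int[leb]_(t in (`[0, x]%classic : set (lebT R))) f t.

(* As [cesaro_op] is real-valued, the finiteness of C(|f|) a.e. (part of
   "C(|f|) belongs to X") has to be required separately. *)
Definition cesaro_space X : fspace R := FSpace
  [set f | [/\ Lmeasurable f,
     {ae leb, forall x : lebT R, I01 x ->
        (\int[leb]_(t in (`[0%R, x]%classic : set (lebT R))) `|f t|%:E
           < +oo)%E}
     & X (cesaro_op (Num.norm \o f))]]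
  (fun f => fnorm X (cesaro_op (Num.norm \o f))).

Definition dilation (t : R) f : R -> R :=
  fun s => if 0 <= s / t <= 1 then f (s / t) else 0.

(* [lim] is total; the limit exists by submultiplicativity of the norms. *)
Definition upper_boyd_index X : R :=
  lim (ln (op_norm X X (dilation t)) / ln t @[t --> +oo]).

End function_spaces.

Section vector_measures.
Context {R : realType}.
Implicit Types (X : fspace R) (m : set (lebT R) -> R -> R) (f : R -> R)
  (mu : set (lebT R) -> R) (A : set (lebT R)).

(* |mu|(A), as a supremum over finite measurable partitions of A *)
Definition set_variation mu A : \bar R :=
  ereal_sup [set s : \bar R | exists (n : nat) (B : 'I_n -> set (lebT R)),
    [/\ forall i, measurable (B i), trivIset setT B, \bigcup_i B i = A
      & s = (\sum_(i < n) `|mu (B i)|)%:E]].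

(* Jordan decomposition: mu^+ = (|mu| + mu)/2, mu^- = (|mu| - mu)/2 *)
Definition pos_part mu A : \bar R :=
  ((2^-1 : R)%:E * (set_variation mu A + (mu A)%:E))%E.
Definition neg_part mu A : \bar R :=
  ((2^-1 : R)%:E * (set_variation mu A - (mu A)%:E))%E.

Definition signed_integral mu A f : R :=
  fine (integral (pos_part mu) A (fun t => (f t)%:E)) -
  fine (integral (neg_part mu) A (fun t => (f t)%:E)).

Definition scalar_measure (phi : (R -> R) -> R) m : set (lebT R) -> R :=
  fun A => phi (m A).

Definition abs_integral mu f : \bar R :=
  integral (set_variation mu) (I01 : set (lebT R)) (fun t => `|f t|%:E).

Definition is_vm_integral X m A f (g : R -> R) :=
  X g /\ forall phi, dual_space X phi ->
    phi g = signed_integral (scalar_measure phi m) A f.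

Definition vm_integrable X m f :=
  [/\ Lmeasurable f,
      forall phi, dual_space X phi ->
        (abs_integral (scalar_measure phi m) f < +oo)%E
    & forall A, measurable A -> A `<=` I01 ->
        exists g, is_vm_integral X m A f g].

(* The supremum is finite on integrable functions, so [fine] loses nothing. *)
Definition vm_L1 X m : fspace R := FSpace
  [set f | vm_integrable X m f]
  (fun f => fine (ereal_sup
     [set abs_integral (scalar_measure phi m) f | phi in dual_ball X])).

(* The integral is unique up to a.e. equality; a representative is chosen. *)
Definition integration_operator X m f : R -> R :=
  get (is_vm_integral X m (I01 : set (lebT R)) f).

Definition cesaro_measure A : R -> R := cesaro_op (\1_A : R -> R).

End vector_measures.

(* Main.v *)
(* Write [E = [C, X]], [m = m_X].  Since [X <> L^oo], the fundamental function of [X] vanishes at 0; hence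
   every functional on [E] has on [L^oo] a density [w] in [L^1], the scalar measures of [m] have densities, and
   [L^oo] embeds in [L^1(m)] with [I_m = C].
   Either hypothesis implies that [(C f_n)] is norm Cauchy whenever [0 <= f_n] is an increasing sequence in
   [L^oo] bounded in [E]: in (a) a weak cluster point of [C f_n] is a norm limit, by positive functionals
   obtained from Hahn-Banach; in (b) the successive differences of a subsequence, interleaved with 0, are weakly
   null.  So [E] has a Levi property, its norm is order continuous, and [E] embeds in [L^1(m)] with [I_m = C].
   For a weak Cauchy sequence [u_n] of [E] and a strictly positive functional with density [w0], the sequence
   [u_n w0] converges weakly in [L^1], to [f w0] say; a sum [\sum_k 2^-k phi_k] of positive norming functionals
   shows that the truncations of [f] are bounded in [E], and the Levi property gives that [f] is in [E].
   If the upper Boyd index is less than 1, some dilation satisfies [||sigma_t|| < t], which bounds the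
   embedding of [X] in [E]; then [C : X -> X] factors through [I_m]. *)

From HB Require Import structures.
From mathcomp Require Import all_boot all_order all_algebra.
From mathcomp Require Import all_classical all_reals all_analysis.
From mathcomp Require Import measurable_realfun ring lra.
Require Import Defs.

Set Implicit Arguments.
Unset Strict Implicit.
Unset Printing Implicit Defensive.

Import Order.TTheory GRing.Theory Num.Theory.
Import numFieldNormedType.Exports.

Local Open Scope classical_set_scope.
Local Open Scope ring_scope.

(** * Weak convergence in L^1 *)

(** The obstacle is that neither order continuity nor the Fatou property is available for [X]: a
    functional on [[C, X]] need not be an integral, and bounded increasing sequences need not
    converge. Hence functionals are first represented on [L^oo] only, where smallness of [||C 1_A||]
    for small [A] suffices, and their representation on all of [[C, X]] has to wait for the
    convergence that the hypothesis on [I_m] produces. The weight [w0] is there because each density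
    [w] yields its own weak limit of [u_n w] in [L^1]; comparison with one strictly positive weight
    shows that all these limits come from a single function [f]. That [f] lies in [[C, X]] does not
    follow from separate bounds for separate functionals: the failure of a norm bound has to be
    condensed into one functional. Since spaces consist of functions and not of classes, [I_m f] and
    [C f] agree only up to a function of norm zero, and the weak topology does not separate such
    functions. *)

Section VHS.
Context d (T : measurableType d) (R : realType).
Variables (mu : {measure set T -> \bar R}).

Local Notation L1 D f := (mu.-integrable D (EFin \o f)).

Lemma L1_meas (D : set T) (f : T -> R) : L1 D f -> measurable_fun D f.
Proof. by move=> /measurable_int /measurable_EFinP. Qed.

Lemma L1S (D A : set T) (f : T -> R) : measurable D -> measurable A -> A `<=` D ->
  L1 D f -> L1 A f.
Proof. by move=> mD mA AD; apply: integrableS. Qed.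

Lemma L1_small (D : set T) (f : T -> R) (e : R) : measurable D -> L1 D f -> 0 < e ->
  exists2 r : R, 0 < r & forall A, measurable A -> A `<=` D -> (mu A < r%:E)%E ->
     \int[mu]_(x in A) `|f x| < e.
Proof.
move=> mD fD e0.
have fT : mu.-integrable setT (EFin \o (f \_ D)).
  by rewrite -restrict_EFin; apply/(integrable_mkcond _ mD).
have [r [r0 H]] := integral_normr_continuous fT e0.
exists r => // A mA AD mAr; have := H A mA mAr.
suff -> : \int[mu]_(x in A) `|(f \_ D) x| = \int[mu]_(x in A) `|f x| by [].
apply: eq_Rintegral => x; rewrite inE => Ax; rewrite patchE ifT// inE; exact: AD.
Qed.

(* On one of the sets [f >= 0], [f < 0] the integral of f is at least half of that of |f|. *)
Lemma half_sign (A : set T) (f : T -> R) : measurable A -> L1 A f ->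
  exists P, [/\ measurable P, P `<=` A &
     \int[mu]_(x in A) `|f x| <= 2 * `|\int[mu]_(x in P) f x|].
Proof.
move=> mA fA; have mf := L1_meas fA.
pose P := A `&` [set x | 0 <= f x]; pose N := A `\` P.
have mP : measurable P by apply: measurable_fun_le => //; exact: measurable_cst.
have mN : measurable N by exact: measurableD.
have PA : P `<=` A by move=> x [].
have NA : N `<=` A by move=> x [].
have APN : A = P `|` N by rewrite /N setUDr // setDv setD0 setUC; apply/esym/setUidl.
have PN : [disjoint P & N] by apply/eqP; rewrite /N; apply/seteqP; split => x // [? []].
have := @Rintegral_setU _ _ _ mu P N (fun x => `|f x|) mP mN.
rewrite -APN => /(_ _ PN) -> ; last exact: integrable_norm.
have -> : \int[mu]_(x in P) `|f x| = \int[mu]_(x in P) f x.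
  by apply: eq_Rintegral => x; rewrite inE => -[_ /= f0]; rewrite ger0_norm.
have -> : \int[mu]_(x in N) `|f x| = - \int[mu]_(x in N) f x.
  rewrite -mulN1r -RintegralZl//; last exact: L1S NA fA.
  apply: eq_Rintegral => x; rewrite inE => -[Ax Px]; rewrite mulN1r ler0_norm//.
  by rewrite leNgt; apply/negP => f0; apply: Px; split => //=; exact: ltW.
set a := \int[mu]_(x in P) f x; set b := \int[mu]_(x in N) f x.
have [le|/ltW le] := leP `|b| `|a|.
  exists P; split => //; rewrite -/a.
  have := ler_norm a; have := ler_norm (- b); rewrite normrN; lra.
exists N; split => //; rewrite -/b.
have := ler_norm a; have := ler_norm (- b); rewrite normrN; lra.
Qed.

Lemma norm_int_le (A : set T) (f : T -> R) : measurable A -> L1 A f ->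
  `|\int[mu]_(x in A) f x| <= \int[mu]_(x in A) `|f x|.
Proof. by move=> mA fA; apply: le_normr_Rintegral. Qed.

Lemma le_int_sub (A B : set T) (f : T -> R) : measurable A -> measurable B -> A `<=` B ->
  L1 B f -> \int[mu]_(x in A) `|f x| <= \int[mu]_(x in B) `|f x|.
Proof.
move=> mA mB AB fB; rewrite /Rintegral fine_le//.
- by apply: integrable_fin_num => //; apply: integrable_norm; exact: L1S AB fB.
- by apply: integrable_fin_num => //; exact: integrable_norm.
apply: ge0_subset_integral => //.
by have := integrable_norm fB => /measurable_int.
Qed.

Lemma int_split (A P : set T) (f : T -> R) : measurable A -> measurable P -> P `<=` A ->
  L1 A f -> \int[mu]_(x in A) f x = \int[mu]_(x in P) f x + \int[mu]_(x in A `\` P) f x.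
Proof.
move=> mA mP PA fA.
have mN : measurable (A `\` P) by exact: measurableD.
have APN : A = P `|` (A `\` P).
  by rewrite setUDr // setDv setD0 setUC; apply/esym/setUidl.
rewrite {1}APN Rintegral_setU// -?APN//.
by apply/eqP; apply/seteqP; split => x // [? []].
Qed.

Lemma meas_fine (D : set T) (g : T -> \bar R) : measurable_fun D g ->
  measurable_fun D (fun x => fine (g x)).
Proof. by move=> mg; exact: measurableT_comp. Qed.

Lemma meas_clamp (D : set T) (f : T -> R) (c k : R) : measurable_fun D f ->
  measurable_fun D (fun x => Num.max 0 (Num.min 1 ((f x + c) / k))).
Proof.
move=> mf; apply: measurable_maxr => //; apply: measurable_minr => //.
by apply: measurable_funM => //; apply: measurable_funD.
Qed.

Lemma L1_ae_le (D : set T) (f g : T -> R) : measurable D -> L1 D f -> measurable_fun D g ->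
  {ae mu, forall x, D x -> `|g x| <= `|f x|} -> L1 D g.
Proof.
move=> mD /integrableP[/measurable_EFinP mf fi] mg h.
apply/integrableP; split; first exact/measurable_EFinP.
apply: le_lt_trans fi; apply: ae_ge0_le_integral => //;
  try by do 2 apply: measurableT_comp => //.
Qed.

Lemma L1L (D : set T) (a : R) (f g : T -> R) : measurable D -> L1 D f -> L1 D g ->
  L1 D (fun x => a * f x + g x).
Proof.
move=> mD fD gD; have := @integrableD _ _ _ mu _ mD _ _ (@integrableZl _ _ _ mu _ mD a _ fD) gD.
exact: eq_integrable.
Qed.

Lemma L1Z (D : set T) (a : R) (f : T -> R) : measurable D -> L1 D f ->
  L1 D (fun x => a * f x).
Proof.
move=> mD fD; have := @integrableZl _ _ _ mu _ mD a _ fD.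
exact: eq_integrable.
Qed.

Lemma intL (D : set T) (a : R) (f g : T -> R) : measurable D -> L1 D f -> L1 D g ->
  \int[mu]_(x in D) (a * f x + g x) = a * \int[mu]_(x in D) f x + \int[mu]_(x in D) g x.
Proof.
by move=> mD fD gD; rewrite RintegralD// ?RintegralZl//; exact: L1Z.
Qed.

Lemma int_ae_ge0 (D : set T) (f : T -> R) : measurable D -> L1 D f ->
  {ae mu, forall x, D x -> 0 <= f x} -> 0 <= \int[mu]_(x in D) f x.
Proof.
move=> mD fD h; rewrite /Rintegral; apply: fine_ge0.
have -> : (\int[mu]_(x in D) (f x)%:E = \int[mu]_(x in D) `|(f x)%:E|)%E.
  have mf : measurable_fun D (fun x => (f x)%:E) by exact: measurable_int fD.
  apply: ae_eq_integral => //; first by apply: measurableT_comp.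
  by apply: filterS h => x h Dx /=; rewrite ger0_norm// h.
by apply: integral_ge0 => x _.
Qed.

Lemma int_ae_le (D : set T) (f g : T -> R) : measurable D -> L1 D f -> L1 D g ->
  {ae mu, forall x, D x -> f x <= g x} -> \int[mu]_(x in D) f x <= \int[mu]_(x in D) g x.
Proof.
move=> mD fD gD h; have := intL (-1) mD fD gD.
have : 0 <= \int[mu]_(x in D) ((-1) * f x + g x).
  apply: int_ae_ge0 => //; first exact: L1L.
  by apply: filterS h => x h Dx; have := h Dx; lra.
lra.
Qed.

Lemma L1_ae_bounded (D : set T) (f : T -> R) (M : R) : measurable D -> (mu D < +oo)%E ->
  measurable_fun D f -> {ae mu, forall x, D x -> `|f x| <= M} -> L1 D f.
Proof.
move=> mD finD mf h; apply: (@L1_ae_le D (cst M)) => //.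
  apply: measurable_bounded_integrable => //.
  by exists `|M|; split => // r hr t _; exact: (le_trans _ (ltW hr)).
by apply: filterS h => x h /h /le_trans; apply; exact: ler_norm.
Qed.

Lemma int_indic_mul (D A : set T) (h : T -> R) : measurable A -> A `<=` D ->
  \int[mu]_(x in D) (\1_A x * h x) = \int[mu]_(x in A) h x.
Proof.
move=> mA AD; rewrite -[in RHS](setIidl AD) setIC Rintegral_mkcondr; apply: eq_Rintegral => x _.
by rewrite patchE indicE; case: (x \in A); rewrite ?mul1r ?mul0r.
Qed.

Lemma le_set_meas (D : set T) (f g : T -> R) :
  measurable D -> measurable_fun D f -> measurable_fun D g ->
  measurable (D `&` [set x | f x <= g x]).
Proof. by move=> mD mf mg; exact: measurable_fun_le. Qed.

Section hump.
Variable D : set T.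
Hypotheses (mD : measurable D) (finD : (mu D < +oo)%E).

Lemma nonincr_cvg0 (C : nat -> set T) : (forall n, measurable (C n)) ->
  (forall n, C n `<=` D) ->
  (forall m n, (m <= n)%N -> C n `<=` C m) -> mu (\bigcap_n C n) = 0 ->
  forall r : R, 0 < r -> exists N, forall n, (N <= n)%N -> (mu (C n) < r%:E)%E.
Proof.
move=> mC CD dC C0 r r0.
have : mu \o C @ \oo --> mu (\bigcap_n C n).
  apply: nonincreasing_cvg_mu => //.
  - by apply: le_lt_trans finD; rewrite le_measure// ?inE.
  - exact: bigcap_measurable.
  - by move=> m n mn; apply/subsetPset; exact: dC.
rewrite C0 => /fine_cvgP[fC] /cvgrPdist_lt /(_ r r0) fr.
have [N _ H] := filterI fC fr.
exists N => n /H /= [fn]; rewrite sub0r normrN => h.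
rewrite -(fineK fn) lte_fin; apply: le_lt_trans h; exact: ler_norm.
Qed.

Lemma small_tail (C : nat -> set T) (f : T -> R) : (forall n, measurable (C n)) ->
  (forall n, C n `<=` D) ->
  (forall m n, (m <= n)%N -> C n `<=` C m) -> mu (\bigcap_n C n) = 0 ->
  L1 D f ->
  forall r : R, 0 < r -> exists N, forall n, (N <= n)%N -> \int[mu]_(x in C n) `|f x| < r.
Proof.
move=> mC CD dC C0 fD r r0; have [e e0 H] := L1_small mD fD r0.
have [N HN] := nonincr_cvg0 mC CD dC C0 e0.
by exists N => n Nn; apply: H => //; exact: HN.
Qed.

(** A Vitali-Hahn-Saks statement, proved by a gliding hump. If the conclusion fails, disjoint blocks
    [P i] inside [C (k i)] minus [C (M i)] are chosen, each carrying a fixed part of the integral of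
    [v (k i)]. In the integral of [v (k i)] over the union [A] of all blocks, the earlier blocks
    contribute little because [v n] tends to 0 on their fixed union, and the later ones because they
    lie in [C (M i)]. So the integrals over [A] cannot tend to 0. *)
Lemma VHS (C : nat -> set T) (v : nat -> T -> R) : (forall n, L1 D (v n)) ->
  (forall A, measurable A -> A `<=` D -> (fun n => \int[mu]_(x in A) v n x) @ \oo --> (0 : R)) ->
  (forall n, measurable (C n)) -> (forall n, C n `<=` D) ->
  (forall m n, (m <= n)%N -> C n `<=` C m) -> mu (\bigcap_n C n) = 0 ->
  forall e : R, 0 < e -> exists N, forall n, (N <= n)%N -> \int[mu]_(x in C n) `|v n x| < e.
Proof.
move=> vD v0 mC CD dC C0 e e0; apply: contrapT => /forallNP H.
have {}H N : exists2 n, (N <= n)%N & e <= \int[mu]_(x in C n) `|v n x|.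
  have /existsNP[n /not_implyP[Nn /negP]] := H N.
  by rewrite -leNgt => h; exists n.
have e8 : 0 < e / 8 by rewrite divr_gt0.
(* [a] holds a lower bound for the next index and the union of the blocks so far; [b] consists of
   [k], [m] and the new block. The constant [7 e / 16] is half of [e - e / 8], the mass of [v k]
   left on [C k] minus [C m]; [half_sign] costs the factor 2. *)
have step (a : nat * set T) : exists b : nat * nat * set T,
    measurable a.2 /\ a.2 `<=` D ->
    [/\ (a.1 <= b.1.1)%N, (b.1.1 < b.1.2)%N, measurable b.2,
       b.2 `<=` C b.1.1 `\` C b.1.2 &
     [/\ `|\int[mu]_(x in a.2) v b.1.1 x| < e / 8,
        7 * e / 16 <= `|\int[mu]_(x in b.2) v b.1.1 x| &
       \int[mu]_(x in C b.1.2) `|v b.1.1 x| < e / 8]].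
  have [[ma aD]|na] := pselect (measurable a.2 /\ a.2 `<=` D); last by exists (0%N, 0%N, set0).
  have /cvgrPdist_lt /(_ _ e8) [N1 _ HN1] := v0 _ ma aD.
  have [k] := H (maxn a.1 N1); rewrite geq_max => /andP[ak /HN1 /= vk] ek.
  have [M HM] := small_tail mC CD dC C0 (vD k) e8.
  pose m := maxn M k.+1.
  have mCC : measurable (C k `\` C m) by exact: measurableD.
  have CCD : C k `\` C m `<=` D by move=> x [] /CD.
  have km : (k < m)%N by rewrite /m leq_max leqnn orbT.
  have [P [mP PC hP]] := half_sign mCC (L1S mD mCC CCD (vD k)).
  exists (k, m, P) => _; split => //=; split.
  - by move: vk; rewrite sub0r normrN.
  - have := @int_split (C k) (C m) (fun x => `|v k x|) (mC _) (mC _) (dC _ _ (ltnW km)).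
    move=> /(_ (integrable_norm (L1S mD (mC k) (@CD k) (vD k)))).
    have := HM m (leq_maxl _ _); lra.
  - exact/HM/leq_maxl.
have [F HF] := choice step.
pose st := fix st n : nat * set T := if n is m.+1 then
   ((F (st m)).1.2, (st m).2 `|` (F (st m)).2) else (0%N, set0).
pose k n := (F (st n)).1.1; pose M n := (F (st n)).1.2; pose P n := (F (st n)).2.
have J n : [/\ measurable (st n).2, (st n).2 `<=` D & (st n).2 `&` C (st n).1 = set0].
  elim: n => [|n [mA AD AC]]; first by split => //=; rewrite set0I.
  have [le1 lt2 mP PC _] := HF (st n) (conj mA AD).
  split => /=.
  - exact: measurableU.
  - by rewrite subUset; split => // x /PC[/CD].
  rewrite setIUl; apply/seteqP; split => // x [[Ax Cx]|[/PC[_ nC] //]].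
  rewrite -AC; split => //; apply: dC Cx; apply: leq_trans (ltnW lt2); exact: le1.
have HF' n := HF (st n) (let: And3 a b _ := J n in conj a b).
have NN m n : (m <= n)%N -> ((st m).1 <= (st n).1)%N.
  elim: n => [|n IH]; first by rewrite leqn0 => /eqP ->.
  rewrite leq_eqVlt => /predU1P[-> //|]; rewrite ltnS => /IH h.
  have [le1 lt2 _ _ _] := HF' n; apply: (leq_trans h); apply: leq_trans (ltnW lt2); exact: le1.
have mPn n : measurable (P n) by have [] := HF' n.
have PC n : P n `<=` C (st n).1.
  by have [le1 _ _ PC _] := HF' n => x /PC[+ _]; apply: dC.
have PD n : P n `<=` D by move=> x /PC /CD.
have stP n : (st n).2 = \bigcup_(m in `I_n) P m.
  elim: n => [|n IH] /=; first by rewrite II0 bigcup_set0.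
  by rewrite IIS bigcup_setU bigcup_set1 -IH.
pose A := \bigcup_n P n.
have mA : measurable A by exact: bigcupT_measurable.
have AD : A `<=` D by apply: bigcup_sub => n _; exact: PD.
have kn n : (n <= k n)%N.
  have [le1 _ _ _ _] := HF' n; apply: leq_trans le1.
  elim: n => // n IH; have [le1 lt2 _ _ _] := HF' n.
  by rewrite /=; apply: leq_ltn_trans lt2; apply: leq_trans le1.
have /cvgrPdist_lt /(_ _ e8) [N _ HN] := v0 _ mA AD.
have := HN (k N) (kn N); rewrite sub0r normrN.
have [mAn AnD AnC] := J N.
have [le1 lt2 _ PCC [i1 i2 i3]] := HF' N.
have LA := L1S mD mA AD (vD (k N)).
have AnA : (st N).2 `<=` A by rewrite stP; apply: bigcup_subset.
have PA : P N `<=` A `\` (st N).2.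
  move=> x Px; split; first by exists N.
  by move=> Ax; have : ((st N).2 `&` C (st N).1) x := conj Ax (PC N x Px); rewrite AnC.
rewrite (@int_split A (st N).2)// (@int_split (A `\` (st N).2) (P N))//; last first.
- by apply: L1S LA => //; first exact: measurableD; exact: subDsetl.
- exact: measurableD.
set Rst := (_ `\` P N).
have mR : measurable Rst by apply: measurableD => //; exact: measurableD.
have RC : Rst `<=` C (M N).
  move=> x [[[m _ Pm] nst] nP].
  have [mN|] := leqP m N; last by move=> /NN h; apply: (dC _ _ h); exact: PC.
  move: mN; rewrite leq_eqVlt => /predU1P[mN|mN]; first by rewrite mN in Pm.
  by exfalso; apply: nst; rewrite stP; exists m.
have LR : L1 Rst (v (k N)) by apply: L1S (vD (k N)) => // x /RC /CD.
have LC : L1 (C (M N)) (v (k N)) by apply: L1S (vD (k N)) => //; exact: CD.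
have := norm_int_le mR LR.
have := le_int_sub mR (mC _) RC LC.
move: i1 i2 i3; rewrite -/(k N) -/(M N) -/(P N).
set a := \int[mu]_(x in (st N).2) _; set b := \int[mu]_(x in P N) _.
set c := \int[mu]_(x in Rst) v _ _.
move=> i1 i2 i3 i4 i5 i6.
(* The block contributes at least [7 e / 16], more than the three errors [e / 8] together. *)
have := ler_normB (a + (b + c)) (a + c).
rewrite (_ : a + (b + c) - (a + c) = b); last by lra.
have := ler_normD a c; lra.
Qed.

(** Otherwise there are pairs of arbitrarily late indices and sets [A k] of measure below [2^-(k+1)]
    on which the difference has mass above [e]. The differences tend to 0 on every set, and the
    tails [C k], the unions of the [A j] with [j >= k], have measure at most [2^-k] and decrease to
    a null set, so [VHS] applies. *)
Lemma UAC (g : nat -> T -> R) : (forall n, L1 D (g n)) ->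
  (forall A, measurable A -> A `<=` D -> cvg ((fun n => \int[mu]_(x in A) g n x) @ \oo)) ->
  forall e : R, 0 < e -> exists2 r : R, 0 < r & exists N, forall n m, (N <= n)%N -> (N <= m)%N ->
    forall A, measurable A -> A `<=` D -> (mu A < r%:E)%E ->
    \int[mu]_(x in A) `|g n x - g m x| <= e.
Proof.
move=> gD gc e e0; apply: contrapT => H.
have {}H k : exists x : nat * nat * set T, [/\ (k <= x.1.1)%N, (k <= x.1.2)%N &
   [/\ measurable x.2, x.2 `<=` D, (mu x.2 < ((1 / 2) ^+ k.+1)%:E)%E &
   e < \int[mu]_(y in x.2) `|g x.1.1 y - g x.1.2 y|]].
  apply: contrapT => /forallNP H'; apply: H; exists ((1 / 2) ^+ k.+1).
    by rewrite exprn_gt0.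
  exists k => n m kn km A mA AD Ar; rewrite leNgt; apply/negP => lt.
  by apply: (H' (n, m, A)); split.
have [F HF] := choice H.
pose A k := (F k).2; pose C k := \bigcup_(j in [set j | (k <= j)%N]) A j.
pose v k y := g (F k).1.1 y - g (F k).1.2 y.
have mA k : measurable (A k) by have [_ _ []] := HF k.
have AD k : A k `<=` D by have [_ _ []] := HF k.
have mC k : measurable (C k) by apply: bigcup_measurable => j _.
have CD k : C k `<=` D by apply: bigcup_sub => j _.
have vL k : L1 D (v k).
  have := @integrableB _ _ _ mu D mD _ _ (gD (F k).1.1) (gD (F k).1.2).
  by apply: eq_integrable.
have v0 B : measurable B -> B `<=` D -> (fun n => \int[mu]_(x in B) v n x) @ \oo --> (0 : R).
  move=> mB BD; have := gc B mB BD => /cvg_ex[l gl].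
  rewrite (_ : (fun n => _) = (fun n => \int[mu]_(x in B) g (F n).1.1 x) \-
     (fun n => \int[mu]_(x in B) g (F n).1.2 x)); last first.
    apply/funext => n /=; rewrite /v RintegralB//; exact: L1S BD (gD _).
  rewrite -[in X in _ --> X](subrr l); apply: cvgB.
    apply: (cvg_comp (fun n => (F n).1.1) _ _ gl); apply/cvgnyPge => K.
    by exists K => // n /= Kn; apply: leq_trans Kn _; have [] := HF n.
  apply: (cvg_comp (fun n => (F n).1.2) _ _ gl); apply/cvgnyPge => K.
  by exists K => // n /= Kn; apply: leq_trans Kn _; have [] := HF n.
have dC m n : (m <= n)%N -> C n `<=` C m.
  by move=> mn; apply: bigcup_subset => j /= ; apply: leq_trans.
have C2 k : (mu (C k) <= ((1 / 2) ^+ k)%:E)%E.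
  apply: (@le_trans _ _ (\sum_(0 <= j <oo) mu (A (k + j)%N))%E).
    apply: measure_sigma_subadditive => // x [j /= kj Ax].
    by exists (j - k)%N => //=; rewrite subnKC.
  apply: le_trans (@epsilon_trick0 R ((1 / 2) ^+ k) xpredT _); last by rewrite exprn_ge0.
  apply: lee_nneseries => // j _; have [_ _ [_ _ /ltW h _]] := HF (k + j)%N.
  apply: (le_trans h); rewrite lee_fin -addnS exprD ler_pM// ?exprn_ge0//.
  by rewrite div1r exprVn natrX.
have C0 : mu (\bigcap_n C n) = 0.
  apply/eqP; rewrite eq_le measure_ge0 andbT; apply/lee_addgt0Pr => r r0.
  have : (GRing.exp (1 / 2 : R)) @ \oo --> (0 : R) by apply: cvg_expr; rewrite ger0_norm; lra.
  move=> /cvgrPdist_lt /(_ _ r0)[n _ /(_ n (leqnn n))] /=; rewrite sub0r normrN => hr.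
  rewrite add0e; apply: (@le_trans _ _ (mu (C n))).
    by rewrite le_measure ?inE//; [exact: bigcap_measurable|exact: bigcap_inf].
  apply: (le_trans (C2 n)); rewrite lee_fin; apply: (le_trans (ler_norm _)); exact: ltW.
have [N HN] := @VHS C v vL v0 mC CD dC C0 e e0.
have := HN N (leqnn N); rewrite ltNge => /negP; apply.
have [_ _ [_ _ _ /ltW]] := HF N => /le_trans; apply.
apply: (le_int_sub (mA N) (mC N)); first by move=> x Ax; exists N => /=.
exact: L1S (vL N).
Qed.

(* Finite covers by sets of small measure are where the absence of atoms is used. *)
Hypothesis fine_cover : forall r : R, 0 < r -> exists (n : nat) (P : nat -> set T),
  [/\ forall i, measurable (P i), forall i, (mu (P i) < r%:E)%E &
      D `<=` \bigcup_(i in `I_n) P i].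

(** On each set of a sufficiently fine finite cover, [g n - g N] has mass at most 1, so the number
    of sets bounds its norm. *)
Lemma L1_bounded (g : nat -> T -> R) : (forall n, L1 D (g n)) ->
  (forall A, measurable A -> A `<=` D -> cvg ((fun n => \int[mu]_(x in A) g n x) @ \oo)) ->
  exists M N, forall n, (N <= n)%N -> \int[mu]_(x in D) `|g n x| <= M.
Proof.
move=> gD gc; have [r r0 [N HN]] := UAC gD gc ltr01.
have [k [P [mP Pr DP]]] := fine_cover r0.
exists (k%:R + \int[mu]_(x in D) `|g N x|), N => n Nn.
have gB : L1 D (fun x => g n x - g N x).
  by have := @integrableB _ _ _ mu D mD _ _ (gD n) (gD N); apply: eq_integrable.
have H : \int[mu]_(x in D) `|g n x - g N x| <= k%:R.
  have : forall j, (j <= k)%N -> \int[mu]_(x in D `&` \bigcup_(i in `I_j) P i) `|g n x - g N x| <= j%:R.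
    elim=> [|j IH] jk.
      by rewrite II0 bigcup_set0 setI0 Rintegral_set0.
    have mU i : measurable (D `&` \bigcup_(l in `I_i) P l).
      by apply: measurableI => //; apply: bigcup_measurable => ? _.
    have sub : D `&` \bigcup_(l in `I_j) P l `<=` D `&` \bigcup_(l in `I_j.+1) P l.
      by apply: setIS; apply: bigcup_subset => l /= /ltnW; rewrite ltnS.
    have DU : D `&` \bigcup_(l in `I_j.+1) P l `<=` D by exact: subIsetl.
    have LL := L1S mD (mU j.+1) DU gB.
    rewrite (int_split (mU _) (mU _) sub (integrable_norm LL)).
    rewrite -natr1 lerD ?IH ?(ltnW jk)//.
    set S := _ `\` _.
    have mS : measurable S by exact: measurableD.
    have SP : S `<=` D `&` P j.
      move=> x [[Dx [l /= lj Pl]] nS]; split => //.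
      move: lj; rewrite ltnS leq_eqVlt => /predU1P[<- //|lj].
      by exfalso; apply: nS; split => //; exists l.
    apply: HN => //; first by move=> x /SP[].
    apply: le_lt_trans (Pr j); rewrite le_measure ?inE//.
    by move=> x /SP[].
  by move=> /(_ k (leqnn k)); rewrite setIidl.
apply: (@le_trans _ _ (\int[mu]_(x in D) (`|g n x - g N x| + `|g N x|))).
  apply: le_Rintegral => //; first exact: integrable_norm.
    have := @integrableD _ _ _ mu D mD _ _ (integrable_norm gB) (integrable_norm (gD N)).
    exact: eq_integrable.
  by move=> x _; rewrite -{1}(subrK (g N x) (g n x)) ler_normD.
by rewrite RintegralD//; [exact: lerD|exact: integrable_norm|exact: integrable_norm].
Qed.

(* Binary expansion of a multiplier: reduces convergence against bounded
   functions to convergence against sets. *)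
Lemma L1_mult (v : nat -> T -> R) (M : R) : (forall n, L1 D (v n)) ->
  (exists N, forall n, (N <= n)%N -> \int[mu]_(x in D) `|v n x| <= M) ->
  (forall A, measurable A -> A `<=` D -> (fun n => \int[mu]_(x in A) v n x) @ \oo --> (0 : R)) ->
  forall s : T -> R, measurable_fun D s -> (forall x, D x -> 0 <= s x <= 1) ->
  (fun n => \int[mu]_(x in D) (s x * v n x)) @ \oo --> (0 : R).
Proof.
move=> vL [N0 HN0] v0.
have M0 : 0 <= M.
  by apply: le_trans (HN0 N0 (leqnn _)); apply: Rintegral_ge0.
have sL n (s : T -> R) : measurable_fun D s -> (forall x, D x -> 0 <= s x <= 1) ->
    L1 D (fun x => s x * v n x).
  move=> ms s1; apply: (le_integrable mD _ _ (vL n)).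
    by apply/measurable_EFinP; apply: measurable_funM => //; exact: L1_meas.
  move=> x /s1 /andP[s0 s1'] /=; rewrite lee_fin normrM -[leRHS]mul1r ler_wpM2r//.
  by rewrite ger0_norm.
suff H k : forall s : T -> R, measurable_fun D s -> (forall x, D x -> 0 <= s x <= 1) ->
    forall e : R, 0 < e -> exists N, forall n, (N <= n)%N ->
      `|\int[mu]_(x in D) (s x * v n x)| <= M * (1 / 2) ^+ k + e.
  move=> s ms s1; apply/cvgrPdist_le => e e0.
  have e2 : 0 < e / 2 by lra.
  have : (geometric M (1 / 2 : R)) @ \oo --> (0 : R).
    by apply: cvg_geometric; rewrite ger0_norm; lra.
  move=> /cvgrPdist_lt /(_ _ e2)[k _ /(_ k (leqnn k))] /=; rewrite sub0r normrN => hk.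
  have [N HN] := H k s ms s1 _ e2.
  exists N => // n /HN /= h; rewrite sub0r normrN (le_trans h)//.
  by have := ler_norm (M * (1 / 2) ^+ k); lra.
elim: k => [|k IH] s ms s1 e e0.
  exists N0 => n Nn; rewrite expr0 mulr1.
  apply: (le_trans (norm_int_le mD (sL _ _ ms s1))).
  apply: (@le_trans _ _ (\int[mu]_(x in D) `|v n x|)); last first.
    by have := HN0 n Nn; lra.
  apply: le_Rintegral => //; [exact: integrable_norm (sL _ _ ms s1)|exact: integrable_norm|].
  move=> x /s1 /andP[s0 s1'] /=; rewrite normrM -[leRHS]mul1r ler_wpM2r//.
  by rewrite ger0_norm.
(* [1_A] is the first binary digit of [s]: [s = (1_A + s') / 2] with [s'] again valued in [[0, 1]].
   The digit contributes an integral over a set, and the error of [s'] is halved. *)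
pose A := D `&` [set x | 1 / 2 <= s x].
have mA : measurable A by apply: measurable_fun_le => //; exact: measurable_cst.
pose s' x := 2 * s x - \1_A x.
have ms' : measurable_fun D s'.
  by apply: measurable_funB; [exact: measurable_funM|exact: measurable_indic].
have s'1 x : D x -> 0 <= s' x <= 1.
  move=> Dx; have /andP[s0 s1'] := s1 x Dx; rewrite /s' indicE.
  have [/set_mem[_ /= h]|/negP h] := boolP (x \in A); first by apply/andP; split; lra.
  have {}h : s x < 1 / 2 by rewrite ltNge; apply/negP => h2; apply: h; rewrite inE.
  by rewrite mulr0n subr0; apply/andP; split; lra.
have [N1 H1] := IH s' ms' s'1 _ e0.
have /cvgrPdist_le /(_ _ e0)[N2 _ H2] := v0 A mA (@subIsetl _ _ _).
exists (maxn N1 N2) => n; rewrite geq_max => /andP[/H1 h1 /H2 /= h2].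
have ind1 x : D x -> 0 <= (\1_A x : R) <= 1.
  by move=> _; rewrite indicE; case: (x \in A); rewrite /= lexx ler01.
have mind : measurable_fun D (\1_A : T -> R) by exact: measurable_indic.
have -> : \int[mu]_(x in D) (s x * v n x) =
    1 / 2 * \int[mu]_(x in D) (\1_A x * v n x) + 1 / 2 * \int[mu]_(x in D) (s' x * v n x).
  rewrite -!RintegralZl//; try exact: sL.
  rewrite -RintegralD//.
  - by apply: eq_Rintegral => x _; rewrite /s'; lra.
  - exact: (integrableZl mD (1 / 2) (sL n _ mind ind1)).
  - exact: (integrableZl mD (1 / 2) (sL n _ ms' s'1)).
rewrite int_indic_mul//; last by move=> x [].
move: h2; rewrite sub0r normrN => h2.
apply: (le_trans (ler_normD _ _)); rewrite ![`|1 / 2 * _|]normrM (ger0_norm (_ : 0 <= 1 / 2)); last by lra.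
rewrite exprS; move: h1 h2.
set a := `|_|; set b := `|_|; set c := (1 / 2) ^+ k; nra.
Qed.

End hump.
End VHS.

(** * Weak sequential completeness of L^1 *)

Section wsc.
Context d (T : measurableType d) (R : realType).
Variables (mu : {sigma_finite_measure set T -> \bar R}) (D : set T).
Hypotheses (mD : measurable D) (finD : (mu D < +oo)%E).
Local Notation L1 D f := (mu.-integrable D (EFin \o f)).

(** Finite additivity and smallness on small sets give countable additivity, since the tails of a
    disjoint union decrease to the empty set and so have small measure. Smallness also makes null
    sets null for [l], and the Radon-Nikodym theorem provides [f]. *)
Lemma density_of_set_function (l : set T -> R) :
  (forall A B, measurable A -> measurable B -> A `<=` D -> B `<=` D -> A `&` B = set0 ->
     l (A `|` B) = l A + l B) ->
  (forall e : R, 0 < e -> exists2 r : R, 0 < r &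
     forall A, measurable A -> A `<=` D -> (mu A < r%:E)%E -> `|l A| <= e) ->
  exists2 f : T -> R, L1 D f &
    forall A, measurable A -> A `<=` D -> l A = \int[mu]_(x in A) f x.
Proof.
move=> lU lc.
pose nu A : \bar R := (l (A `&` D))%:E.
have l0 : l set0 = 0.
  by have := lU set0 set0; rewrite setU0 setI0 => /(_ measurable0 measurable0 (sub0set _) (sub0set _) erefl); lra.
have nu0 : nu set0 = 0%E by rewrite /nu set0I l0.
have nufin A : measurable A -> nu A \is a fin_num by [].
have nuadd : semi_sigma_additive nu.
  move=> F mF tF mU.
  pose G n := \bigcup_(i in `I_n) F i; pose C n := (\bigcup_i F i `\` G n) `&` D.
  have mG n : measurable (G n) by apply: bigcup_measurable => ? _.
  have mC n : measurable (C n) by apply: measurableI => //; exact: measurableD.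
  have sumE n : \sum_(0 <= i < n) l (F i `&` D) = l (G n `&` D).
    elim: n => [|n IH]; first by rewrite big_geq// /G II0 bigcup_set0 set0I l0.
    rewrite big_nat_recr//= IH /G IIS bigcup_setU bigcup_set1 setIUl lU//.
    - by apply: measurableI => //; exact: mG.
    - exact: measurableI.
    - apply/seteqP; split => // x [[[i /= im Fi] _] [Fn _]].
      have := tF i n I I; move=> /(_ (ex_intro _ x (conj Fi Fn))) ein.
      by rewrite ein ltnn in im.
  have splitE n : l (\bigcup_i F i `&` D) = l (G n `&` D) + l (C n).
    rewrite -lU//.
    - congr (l _); rewrite -setIUl; congr (_ `&` D); rewrite setDUK//.
      exact: bigcup_subset.
    - exact: measurableI.
    - exact: subIsetr.
    - by apply/seteqP; split => // x [[Gx _] [[_ nGx] _]].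
  have C0 : mu (\bigcap_n C n) = 0.
    rewrite (_ : \bigcap_n C n = set0) ?measure0//; apply/seteqP; split => // x Cx.
    have [[[i _ Fi] _] _] := Cx 0%N I.
    by have [[_ nG] _] := Cx i.+1 I; apply: nG; exists i => //=.
  have small := @nonincr_cvg0 _ T R mu D mD finD C mC (fun n => @subIsetr _ _ _) _ C0.
  have {}small : forall r : R, 0 < r ->
      exists N : nat, forall n : nat, (N <= n)%N -> (mu (C n) < r%:E)%E.
    apply: small => m n mn; apply: setSI; apply: setDS; apply: bigcup_subset => i /=.
    by move=> im; exact: leq_trans mn.
  rewrite (_ : (fun n => _) = EFin \o (fun n => l (G n `&` D))); last first.
    by apply/funext => n /=; rewrite sumEFin sumE.
  apply: cvg_EFin; first exact: nearW.
  apply/cvgrPdist_le => e e0; have [r r0 Hr] := lc e e0.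
  have [N HN] := small r r0; exists N => // n /HN /= h.
  by rewrite (splitE n) addrC addKr; apply: Hr => //; exact: subIsetr.
pose nuC : {charge set T -> \bar R} := HB.pack nu (isCharge.Build _ _ _ nu nu0 nufin nuadd).
have numu : nuC `<< mu.
  apply/null_content_dominatesP => A mA A0 /=; rewrite /nu; congr EFin.
  apply/eqP; rewrite -normr_eq0 eq_le normr_ge0 andbT; apply/ler_addgt0Pr => e e0.
  rewrite add0r; have [r r0 Hr] := lc e e0.
  apply: Hr; [exact: measurableI|exact: subIsetr|].
  apply: le_lt_trans (_ : mu A < _)%E; last by rewrite A0 lte_fin.
  by rewrite le_measure ?inE//; exact: measurableI.
have fint := Radon_Nikodym_integrable numu.
have fE A : measurable A -> _ := Radon_Nikodym_integral numu.
set f := (Radon_Nikodym nuC mu) in fint fE.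
have ffin x : f x = (fine (f x))%:E by rewrite fineK// Radon_Nikodym_fin_num.
exists (fine \o f).
  apply: (@integrableS _ _ _ mu setT) => //.
  by apply: eq_integrable fint => // x _ /=; exact: ffin.
move=> A mA AD; have := fE A mA; rewrite /= /nu (setIidl AD) /Rintegral.
have -> : (fun x => (fine (f x))%:E) = f by apply/funext => x; exact/esym/ffin.
by move=> <-.
Qed.

Hypothesis fine_cover : forall r : R, 0 < r -> exists (n : nat) (P : nat -> set T),
  [/\ forall i, measurable (P i), forall i, (mu (P i) < r%:E)%E &
      D `<=` \bigcup_(i in `I_n) P i].

(** The limits [l A] are finitely additive, and comparison with a fixed [g N] through [UAC] makes
    them small on small sets; [f] is their density. The bound on the norms then carries the
    convergence over from sets to bounded multipliers. *)
Lemma L1_wsc (g : nat -> T -> R) : (forall n, L1 D (g n)) ->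
  (forall A, measurable A -> A `<=` D -> cvg ((fun n => \int[mu]_(x in A) g n x) @ \oo)) ->
  exists2 f : T -> R, L1 D f & forall s : T -> R, measurable_fun D s ->
    (forall x, D x -> `|s x| <= 1) ->
    (fun n => \int[mu]_(x in D) (s x * g n x)) @ \oo --> \int[mu]_(x in D) (s x * f x).
Proof.
move=> gD gc.
pose l A := lim ((fun n => \int[mu]_(x in A) g n x) @ \oo).
have lE A : measurable A -> A `<=` D -> (fun n => \int[mu]_(x in A) g n x) @ \oo --> l A by exact: gc.
have [||f fD fE] := @density_of_set_function l.
- move=> A B mA mB AD BD AB.
  have mU : measurable (A `|` B) by exact: measurableU.
  have UD : A `|` B `<=` D by rewrite subUset.
  apply: cvg_lim => //.
  rewrite (_ : (fun n => _) = (fun n => \int[mu]_(x in A) g n x) \+ (fun n => \int[mu]_(x in B) g n x)).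
    by apply: cvgD; exact: lE.
  apply/funext => n /=; rewrite Rintegral_setU//; last by apply/eqP.
  exact: L1S UD (gD n).
- move=> e e0; have e2 : 0 < e / 2 by lra.
  have [r r0 [N HN]] := UAC mD finD gD gc e2.
  have [r' r'0 HN'] := L1_small mD (gD N) e2.
  exists (Num.min r r'); first by rewrite lt_min r0.
  move=> A mA AD; rewrite EFin_min lt_min => /andP[Ar Ar'].
  have := lE A mA AD; move=> /(@cvg_norm _ _ _ _ _ _ _) lA.
  rewrite -(cvg_lim _ lA)//; apply: limr_le; first by apply/cvg_ex; eexists; exact: lA.
  exists N => // n /= Nn.
  rewrite (_ : g n = (fun x => (g n x - g N x) + g N x)); last by apply/funext => x; rewrite subrK.
  have LB : L1 A (fun x => g n x - g N x).
    have := @integrableB _ _ _ mu A mA _ _ (L1S mD mA AD (gD n)) (L1S mD mA AD (gD N)).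
    exact: eq_integrable.
  have LA := L1S mD mA AD (gD N).
  rewrite RintegralD//; apply: (le_trans (ler_normD _ _)).
  have := HN n N Nn (leqnn N) A mA AD Ar; have := HN' A mA AD Ar'.
  have := norm_int_le mA LB; have := norm_int_le mA LA; lra.
have [M [N HM]] := L1_bounded mD finD fine_cover gD gc.
exists f => //.
pose v n x := g n x - f x.
have vL n : L1 D (v n).
  by have := @integrableB _ _ _ mu D mD _ _ (gD n) fD; exact: eq_integrable.
have v0 A : measurable A -> A `<=` D -> (fun n => \int[mu]_(x in A) v n x) @ \oo --> (0 : R).
  move=> mA AD; rewrite -[X in _ --> X](subrr (l A)) [in X in _ - X]fE//.
  rewrite (_ : (fun n => _) = (fun n => \int[mu]_(x in A) g n x) \- cst (\int[mu]_(x in A) f x)).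
    by apply: cvgB; [exact: lE|exact: cvg_cst].
  by apply/funext => n /=; rewrite RintegralB//; exact: L1S AD _.
have vM : exists N, forall n, (N <= n)%N -> \int[mu]_(x in D) `|v n x| <= M + \int[mu]_(x in D) `|f x|.
  exists N => n /HM h.
  apply: (@le_trans _ _ (\int[mu]_(x in D) (`|g n x| + `|f x|))).
    apply: le_Rintegral => //; first exact: integrable_norm.
      have := @integrableD _ _ _ mu D mD _ _ (integrable_norm (gD n)) (integrable_norm fD).
      exact: eq_integrable.
    by move=> x _; rewrite ler_normB.
  by rewrite RintegralD//; [exact: lerD|exact: integrable_norm|exact: integrable_norm].
move=> s ms s1.
have H0 := L1_mult mD vL vM v0.
(* An affine change of the multiplier from [[-1, 1]] to [[0, 1]], the range required by
   [L1_mult]. *)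
pose sp x := (1 / 2) * (s x + 1).
have msp : measurable_fun D sp.
  by apply: measurable_funM => //; apply: measurable_funD.
have sp1 x : D x -> 0 <= sp x <= 1.
  by move=> /s1; rewrite ler_norml /sp => /andP[? ?]; apply/andP; split; lra.
have Lb h (s0 : T -> R) : L1 D h -> measurable_fun D s0 -> (forall x, D x -> `|s0 x| <= 1) -> L1 D (fun x => s0 x * h x).
  move=> hL ms0 s01; apply: (le_integrable mD _ _ hL).
    by apply/measurable_EFinP; apply: measurable_funM => //; exact: L1_meas hL.
  by move=> x /s01 h1 /=; rewrite lee_fin normrM -[leRHS]mul1r ler_wpM2r.
have spn x : D x -> `|sp x| <= 1 by move=> /sp1/andP[? ?]; rewrite ger0_norm.
have E n : \int[mu]_(x in D) (s x * g n x) =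
   2 * \int[mu]_(x in D) (sp x * v n x) - \int[mu]_(x in D) v n x + \int[mu]_(x in D) (s x * f x).
  have L1_ : L1 D (fun x => 2 * (sp x * v n x)).
    by have := integrableZl mD 2 (Lb _ _ (vL n) msp spn); exact: eq_integrable.
  rewrite -RintegralZl//; last exact: Lb.
  rewrite -RintegralB// -RintegralD//; last 2 first.
  - by have := @integrableB _ _ _ mu D mD _ _ L1_ (vL n); exact: eq_integrable.
  - exact: Lb.
  by apply: eq_Rintegral => x _; rewrite /sp /v; lra.
rewrite (funext E : (fun n => \int[mu]_(x in D) (s x * g n x)) = _) -[X in _ --> X]add0r; apply: cvgD; last exact: cvg_cst.
rewrite -[X in _ --> X](subrr 0); apply: cvgB; last exact: v0.
by rewrite -[X in _ --> X](mulr0 2); apply: cvgM; [exact: cvg_cst|exact: H0].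
Qed.

End wsc.

(** * Hahn-Banach and Banach function spaces *)

Section hahn_banach.
Context (T : Type) (R : realType) (V : set (T -> R)).
Hypothesis V0 : V (cst 0).
Hypothesis VL : forall (a : R) f g, V f -> V g -> V (a \*o f \+ g).

Definition sublinear_on (p : (T -> R) -> R) :=
  (forall f g, V f -> V g -> p (f \+ g) <= p f + p g) /\
  (forall (a : R) f, 0 <= a -> V f -> p (a \*o f) <= a * p f).

Lemma VZ (a : R) f : V f -> V (a \*o f).
Proof.
move=> Vf; have := VL a Vf V0; congr V; apply/funext => x /=.
by rewrite addr0.
Qed.

Lemma VD f g : V f -> V g -> V (f \+ g).
Proof.
move=> Vf Vg; have := VL 1 Vf Vg; congr V; apply/funext => x /=.
by rewrite mul1r.
Qed.

Definition linear_on (phi : (T -> R) -> R) :=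
  forall (a : R) f g, V f -> V g -> phi (a \*o f \+ g) = a * phi f + phi g.

Lemma lin0 phi : linear_on phi -> phi (cst 0) = 0.
Proof.
move=> /(_ 1 _ _ V0 V0); rewrite (_ : 1 \*o cst 0 \+ cst 0 = cst 0).
  by rewrite mul1r => /eqP; rewrite -subr_eq subrr => /eqP/esym.
by apply/funext => x /=; rewrite mulr0 addr0.
Qed.

Lemma linZ phi : linear_on phi -> forall (a : R) f, V f -> phi (a \*o f) = a * phi f.
Proof.
move=> lphi a f Vf; have := lphi a _ _ Vf V0; rewrite lin0// addr0 => <-; congr phi.
by apply/funext => x /=; rewrite addr0.
Qed.

Lemma sublin0 p : sublinear_on p -> p (cst 0) = 0.
Proof.
move=> [pD pZ]; apply/eqP; rewrite eq_le; apply/andP; split.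
  have := pZ 0 _ (lexx _) V0; rewrite mul0r; congr (p _ <= _).
  by apply/funext => x /=; rewrite mul0r.
have := pD _ _ V0 V0; rewrite (_ : cst 0 \+ cst 0 = cst 0); first lra.
by apply/funext => x /=; rewrite addr0.
Qed.

Lemma sublin_opp p f : sublinear_on p -> V f -> - p ((-1) \*o f) <= p f.
Proof.
move=> sp Vf; have := sublin0 sp; have := sp.1 _ _ (VZ (-1) Vf) Vf.
rewrite (_ : ((-1) \*o f) \+ f = cst 0); first lra.
by apply/funext => x /=; rewrite mulN1r addNr.
Qed.

Lemma inf_add_le (A B C : set R) : A !=set0 -> B !=set0 -> has_lbound A -> has_lbound B ->
  has_lbound C -> (forall a b, A a -> B b -> exists2 c, C c & c <= a + b) ->
  inf C <= inf A + inf B.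
Proof.
move=> A0 B0 lA lB lC H; apply/ler_addgt0Pr => e e0.
have e2 : 0 < e / 2 by lra.
have [a Aa ha] := inf_adherent e2 (conj A0 lA).
have [b Bb hb] := inf_adherent e2 (conj B0 lB).
have [c Cc hc] := H a b Aa Bb; have := ge_inf lC Cc; lra.
Qed.

Lemma inf_scale_le (A C : set R) (k : R) : 0 <= k -> A !=set0 -> has_lbound A ->
  has_lbound C -> (forall a, A a -> exists2 c, C c & c <= k * a) ->
  inf C <= k * inf A.
Proof.
move=> k0 A0 lA lC H; apply/ler_addgt0Pr => e e0.
have k1 : 0 < k + 1 by lra.
have e2 : 0 < e / (k + 1) by rewrite divr_gt0.
have [a Aa ha] := inf_adherent e2 (conj A0 lA).
have [c Cc hc] := H a Aa; have := ge_inf lC Cc => h.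
apply: (le_trans h); apply: (le_trans hc).
have : k * a <= k * (inf A + e / (k + 1)) by rewrite ler_wpM2l// ltW.
suff : k * (e / (k + 1)) <= e by rewrite mulrDr; lra.
rewrite mulrA ler_pdivrMr// mulrC ler_wpM2l ?(ltW e0)//; lra.
Qed.

(* A sublinear functional minimal among those below [p] is linear. *)
Lemma minimal_sublinear (p : (T -> R) -> R) : sublinear_on p ->
  exists q, [/\ sublinear_on q, forall f, V f -> q f <= p f &
    forall q', sublinear_on q' -> (forall f, V f -> q' f <= q f) -> forall f, V f -> q f <= q' f].
Proof.
move=> sp.
pose S := {q | sublinear_on q /\ forall f, V f -> q f <= p f}.
(* The order is reversed, so a maximal element is a minimal functional. A chain is bounded by its
   pointwise infimum, which is subadditive because any two members of the chain are comparable. *)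
pose le (q q' : S) := `[< forall f, V f -> sval q' f <= sval q f >].
have [||A totA|[q [sq qp]] qmax] := @ZL_preorder S (exist _ p (conj sp (fun f _ => lexx _))) le.
- by move=> q; apply/asboolP.
- move=> q1 q2 q3 /asboolP h1 /asboolP h2; apply/asboolP => f Vf.
  exact: le_trans (h2 f Vf) (h1 f Vf).
- have [[q0 Aq0]|A0] := pselect (A !=set0); last first.
    exists (exist _ p (conj sp (fun f _ => lexx _))) => s As.
    by exfalso; apply: A0; exists s.
  pose Q f := [set sval s f | s in A].
  have Q0 f : Q f !=set0 by exists (sval q0 f); exists q0.
  have lQ f : V f -> has_lbound (Q f).
    move=> Vf; exists (- p ((-1) \*o f)) => _ [s As <-].
    have [ss hs] := svalP s; apply: le_trans (sublin_opp ss Vf).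
    by rewrite lerN2 hs//; exact: VZ.
  have sQ : sublinear_on (fun f => inf (Q f)).
    split=> [f g Vf Vg|a f a0 Vf].
      apply: inf_add_le; [exact: Q0|exact: Q0|exact: lQ|exact: lQ|exact/lQ/VD|].
      move=> _ _ [s As <-] [s' As' <-].
      have [/asboolP h|/asboolP h] := totA _ _ As As'.
        exists (sval s' (f \+ g)); first by exists s'.
        by have [[+ _] _] := svalP s' => /(_ _ _ Vf Vg) /le_trans; apply; rewrite lerD2r h.
      exists (sval s (f \+ g)); first by exists s.
      by have [[+ _] _] := svalP s => /(_ _ _ Vf Vg) /le_trans; apply; rewrite lerD2l h.
    apply: inf_scale_le => //; [exact: lQ|exact/lQ/VZ|].
    move=> _ [s As <-]; exists (sval s (a \*o f)); first by exists s.
    by have [[_ +] _] := svalP s; apply.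
  have Qp f : V f -> inf (Q f) <= p f.
    move=> Vf; have [_ hs] := svalP q0; apply: le_trans (hs f Vf).
    by apply: ge_inf; [exact: lQ|exists q0].
  exists (exist (fun q => sublinear_on q /\ forall f, V f -> q f <= p f) _ (conj sQ Qp)) => s As; apply/asboolP => f Vf /=.
  by apply: ge_inf; [exact: lQ|exists s].
exists q; split => // q' sq' q'q f Vf.
have q'p g : V g -> q' g <= p g by move=> Vg; apply: le_trans (qp g Vg); exact: q'q.
have := qmax (exist (fun q => sublinear_on q /\ forall f, V f -> q f <= p f) q' (conj sq' q'p)).
by move=> /(_ _)/asboolP; apply => //; apply/asboolP.
Qed.

(** Let [q] be minimal below [p]. For fixed [y], the functional
    [k |-> inf_(t >= 0) q (k + t y) - t q y] is sublinear and below [q], hence not smaller than [q];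
    its term at [t = 1] gives [q h + q y <= q (h + y)]. So [q] is additive, and therefore linear. *)
Lemma hahn_banach (p : (T -> R) -> R) : sublinear_on p ->
  exists2 phi, linear_on phi & forall f, V f -> phi f <= p f.
Proof.
move=> sp; have [q [sq qp qmin]] := minimal_sublinear sp.
exists q => //.
have shift y h : V y -> V h -> q h + q y <= q (h \+ y).
  move=> Vy Vh.
  pose Q h := [set q (h \+ (t \*o y)) - t * q y | t in [set t : R | 0 <= t]].
  have Q0 k : Q k !=set0 by exists (q (k \+ (0 \*o y)) - 0 * q y); exists 0 => /=.
  have lQ k : V k -> has_lbound (Q k).
    move=> Vk; exists (- q ((-1) \*o k)) => _ [t /= t0 <-].
    have V1 : V (t \*o y) by exact: VZ.
    have h1 : t * q y <= q (t \*o y).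
      have [->|tn0] := eqVneq t 0.
        by rewrite mul0r (_ : 0 \*o y = cst 0) ?sublin0//; apply/funext => x /=; rewrite mul0r.
      have tp : 0 < t by rewrite lt_neqAle eq_sym tn0.
      have ti : 0 <= t^-1 by rewrite invr_ge0.
      have := sq.2 t^-1 (t \*o y) ti V1.
      rewrite (_ : t^-1 \*o (t \*o y) = y); last first.
        by apply/funext => x /=; rewrite mulrA mulVf// mul1r.
      by rewrite mulrC ler_pdivlMr// mulrC.
    have := sq.1 _ _ (VD Vk V1) (VZ (-1) Vk).
    rewrite (_ : (k \+ (t \*o y)) \+ ((-1) \*o k) = t \*o y); first lra.
    by apply/funext => x /=; rewrite mulN1r addrAC subrr add0r.
  have sQ : sublinear_on (fun k => inf (Q k)).
    split=> [f g Vf Vg|a f a0 Vf].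
      apply: inf_add_le; [exact: Q0|exact: Q0|exact: lQ|exact: lQ|exact/lQ/VD|].
      move=> _ _ [t /= t0 <-] [s /= s0 <-].
      exists (q ((f \+ g) \+ ((t + s) \*o y)) - (t + s) * q y).
        by exists (t + s) => //=; exact: addr_ge0.
      have := sq.1 _ _ (VD Vf (VZ t Vy)) (VD Vg (VZ s Vy)).
      rewrite (_ : (f \+ (t \*o y)) \+ (g \+ (s \*o y)) = (f \+ g) \+ ((t + s) \*o y)); first lra.
      by apply/funext => x /=; rewrite mulrDl addrACA.
    apply: inf_scale_le => //; [exact: lQ|exact/lQ/VZ|].
    move=> _ [t /= t0 <-]; exists (q ((a \*o f) \+ ((a * t) \*o y)) - (a * t) * q y).
      by exists (a * t) => //=; exact: mulr_ge0.
    have := sq.2 a _ a0 (VD Vf (VZ t Vy)).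
    rewrite (_ : a \*o (f \+ (t \*o y)) = (a \*o f) \+ ((a * t) \*o y)); first by rewrite mulrBr mulrA; lra.
    by apply/funext => x /=; rewrite mulrDr mulrA.
  have Qq k : V k -> inf (Q k) <= q k.
    move=> Vk; apply: ge_inf; first exact: lQ.
    exists 0 => //=; rewrite mul0r subr0; congr q.
    by apply/funext => x /=; rewrite mul0r addr0.
  have := qmin _ sQ Qq h Vh => /= h1.
  suff : inf (Q h) <= q (h \+ y) - q y by lra.
  apply: ge_inf; first exact: lQ.
  exists 1 => //=; rewrite mul1r; congr (q _ - _).
  by apply/funext => x /=; rewrite mul1r.
have qD f g : V f -> V g -> q (f \+ g) = q f + q g.
  by move=> Vf Vg; apply/eqP; rewrite eq_le sq.1// shift.
have qN f : V f -> q ((-1) \*o f) = - q f.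
  move=> Vf; have := qD _ _ Vf (VZ (-1) Vf).
  rewrite (_ : f \+ ((-1) \*o f) = cst 0) ?sublin0//; first lra.
  by apply/funext => x /=; rewrite mulN1r subrr.
have qZ a f : 0 <= a -> V f -> q (a \*o f) = a * q f.
  move=> a0 Vf; apply/eqP; rewrite eq_le sq.2//=.
  have := sq.2 a _ a0 (VZ (-1) Vf); rewrite qN// (_ : a \*o ((-1) \*o f) = (-1) \*o (a \*o f)).
    by rewrite qN; [lra|exact: VZ].
  by apply/funext => x /=; rewrite mulrCA.
move=> a f g Vf Vg; rewrite qD//; last exact: VZ.
congr (_ + _); have [a0|/ltW a0] := leP 0 a; first exact: qZ.
have := qZ (- a) f; rewrite oppr_ge0 => /(_ a0 Vf).
rewrite (_ : (- a) \*o f = (-1) \*o (a \*o f)); last first.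
  by apply/funext => x /=; rewrite mulrA mulN1r.
by rewrite qN; [lra|exact: VZ].
Qed.

End hahn_banach.

Lemma funrposE (T : Type) (R : realType) (f : T -> R) x : f^\+ x = Num.max (f x) 0.
Proof. by []. Qed.

(** * Banach function spaces and their positive functionals *)

Section bfs.
Context (R : realType) (X : fspace R).
Hypothesis hB : banach_function_space X.
Local Notation leb := completed_lebesgue_measure.
Local Notation I01 := (`[0, 1]%classic).
Local Notation N := (fnorm X).
Implicit Types f g h : R -> R.

Definition ae01 (P : R -> Prop) := {ae leb, forall x : lebT R, I01 x -> P x}.

Lemma ae01W (P : R -> Prop) : (forall x, I01 x -> P x) -> ae01 P.
Proof. by move=> h; apply: aeW. Qed.

Lemma ae01S (P Q : R -> Prop) : (forall x, I01 x -> P x -> Q x) -> ae01 P -> ae01 Q.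
Proof. by rewrite /ae01 => h; apply: (@filterS _ _ (ae_filter_ringOfSetsType _)) => x Px Ix; apply: h => //; exact: Px. Qed.

Lemma ae01S2 (P P' Q : R -> Prop) : (forall x, I01 x -> P x -> P' x -> Q x) ->
  ae01 P -> ae01 P' -> ae01 Q.
Proof. by rewrite /ae01 => h; apply: (@filterS2 _ _ (ae_filter_ringOfSetsType _)) => x Px Px' Ix; apply: h => //; [exact: Px|exact: Px']. Qed.

Lemma ae01_all (P : nat -> R -> Prop) : (forall n, ae01 (P n)) -> ae01 (fun x => forall n, P n x).
Proof.
move=> h; suff : {ae (@completed_lebesgue_measure R), forall x n, I01 x -> P n x}.
  by apply: (@filterS _ _ (ae_filter_ringOfSetsType _)) => x H Ix n; exact: H.
exact/ae_foralln.
Qed.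

Lemma XZ (a : R) f : X f -> X (a \*o f).
Proof. exact: (VZ (bfs_zero hB) (bfs_linear hB)). Qed.

Lemma XD f g : X f -> X g -> X (f \+ g).
Proof. exact: (VD (bfs_linear hB)). Qed.

Lemma XB f g : X f -> X g -> X (f \- g).
Proof.
move=> Xf Xg; have := XD Xf (XZ (-1) Xg); congr (fcarrier X).
by apply/funext => x /=; rewrite mulN1r.
Qed.

Lemma Xmeas f : X f -> Lmeasurable f. Proof. exact: (bfs_measurable hB). Qed.

Lemma X_ideal f g : X f -> Lmeasurable g -> ae01 (fun x => `|g x| <= `|f x|) ->
  X g /\ N g <= N f.
Proof. by move=> Xf mg h; apply: (bfs_ideal hB). Qed.

Lemma X_le f g : X f -> X g -> ae01 (fun x => `|g x| <= `|f x|) -> N g <= N f.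
Proof. by move=> Xf /Xmeas mg h; have [] := X_ideal Xf mg h. Qed.

Lemma X_ae_eq f g : X f -> X g -> ae01 (fun x => g x = f x) -> N g = N f.
Proof.
move=> Xf Xg h; apply/eqP; rewrite eq_le !X_le//; apply: ae01S h => x _ ->//.
Qed.

Lemma X_norm_sub f g : X f -> X g -> N (f \- g) = N (g \- f).
Proof.
move=> Xf Xg; apply/eqP; rewrite eq_le; apply/andP; split; apply: X_le;
  by [exact: XB|apply: ae01W => x _ /=; rewrite distrC].
Qed.

Lemma X_abs f : X f -> X (Num.norm \o f) /\ N (Num.norm \o f) <= N f.
Proof.
move=> Xf; apply: X_ideal => //; first by apply: measurableT_comp => //; exact: Xmeas.
by apply: ae01W => x _ /=; rewrite normr_id.
Qed.

Lemma X_pos f : X f -> X f^\+ /\ N f^\+ <= N f.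
Proof.
move=> Xf; apply: X_ideal => //; first by apply: measurable_funrpos; exact: Xmeas.
apply: ae01W => x _ /=; rewrite funrposE ger0_norm; last by rewrite le_max lexx orbT.
by rewrite ge_max normr_ge0 ler_norm.
Qed.

Lemma N0 : N (cst 0) = 0.
Proof. by apply/(bfs_norm0 hB); [exact: (bfs_zero hB)|exact: ae01W]. Qed.

Lemma Nge0 f : X f -> 0 <= N f. Proof. exact: (bfs_norm_ge0 hB). Qed.
Lemma NZ (a : R) f : X f -> N (a \*o f) = `|a| * N f. Proof. exact: (bfs_normZ hB). Qed.
Lemma ND f g : X f -> X g -> N (f \+ g) <= N f + N g. Proof. exact: (bfs_normD hB). Qed.

Lemma NB f g h : X f -> X g -> X h -> N (f \- h) <= N (f \- g) + N (g \- h).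
Proof.
move=> Xf Xg Xh; have := ND (XB Xf Xg) (XB Xg Xh).
congr (N _ <= _); apply/funext => x /=; lra.
Qed.

(* Uses the sublinear functional [h |-> inf_(n, t >= 0) N((h + t y_n)^+) - t d]. *)
Lemma positive_functional (y : nat -> R -> R) (d : R) :
  (forall n, X (y n)) -> (forall m n, (m <= n)%N -> ae01 (fun x => y n x <= y m x)) ->
  (forall n, d <= N (y n)^\+) ->
  exists phi, [/\ dual_ball X phi, forall f, X f -> ae01 (fun x => 0 <= f x) -> 0 <= phi f &
     forall n, d <= phi (y n)].
Proof.
move=> Xy dy hd.
pose A h := [set z | exists (n : nat) (t : R), 0 <= t /\ z = N (h \+ (t \*o y n))^\+ - t * d].
have Xt n (t : R) h : X h -> X (h \+ (t \*o y n)) by move=> Xh; apply: XD => //; exact: XZ.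
have A0 h : A h !=set0 by exists (N (h \+ (0 \*o y 0%N))^\+ - 0 * d), 0%N, 0.
have lA h : X h -> has_lbound (A h).
  move=> Xh; exists (- N h) => _ [n [t [t0 ->]]].
  (* The infimum is finite because [t y_n^+ <= (h + t y_n)^+ + |h|]. *)
  suff : t * d <= N (h \+ (t \*o y n))^\+ + N h by lra.
  have Xp := (X_pos (Xt n t h Xh)).1; have [Xa Na] := X_abs Xh.
  apply: (@le_trans _ _ (N (t \*o (y n)^\+))).
    by rewrite (NZ _ (X_pos (Xy n)).1) (ger0_norm t0) ler_wpM2l.
  apply: (@le_trans _ _ (N ((h \+ (t \*o y n))^\+ \+ (Num.norm \o h)))); last first.
    by apply: (le_trans (ND Xp Xa)); rewrite lerD2l.
  apply: X_le; [exact: XD|by apply: XZ; exact: (X_pos (Xy n)).1|].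
  apply: ae01W => x _ /=; rewrite !funrposE.
  have h0 := normr_ge0 (h x); have h1 := ler_norm (- h x); rewrite normrN in h1.
  have [a0|a0] := leP (y n x) 0.
    by rewrite mulr0 normr0.
  have ty : 0 <= t * y n x by rewrite mulr_ge0// ltW.
  rewrite ger0_norm// ger0_norm; last by rewrite addr_ge0// le_max lexx orbT.
  have : h x + t * y n x <= Num.max (h x + t * y n x) 0 by rewrite le_max lexx.
  lra.
have sA : sublinear_on (fcarrier X) (fun h => inf (A h)).
  split=> [f g Xf Xg|a f a0 Xf].
    apply: inf_add_le; [exact: A0|exact: A0|exact: lA|exact: lA|exact/lA/XD|].
    (* Since the sequence decreases, [y k] lies below both [y n] and [y m]; this is what makes an
       infimum over all [n] subadditive. *)
    move=> _ _ [n [t [t0 ->]]] [m [s [s0 ->]]]; pose k := maxn n m.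
    exists (N ((f \+ g) \+ ((t + s) \*o y k))^\+ - (t + s) * d).
      by exists k, (t + s); split => //; exact: addr_ge0.
    have X1 := (X_pos (Xt n t f Xf)).1; have X2 := (X_pos (Xt m s g Xg)).1.
    suff : N ((f \+ g) \+ ((t + s) \*o y k))^\+ <=
      N ((f \+ (t \*o y n))^\+ \+ (g \+ (s \*o y m))^\+).
      by have := ND X1 X2; lra.
    apply: X_le; [exact: XD|exact: (X_pos (Xt k (t + s) _ (XD Xf Xg))).1|].
    apply: ae01S2 (dy _ _ (leq_maxl n m)) (dy _ _ (leq_maxr n m)) => x _ h1 h2 /=.
    rewrite !funrposE !ger0_norm; last 2 first.
    - by rewrite addr_ge0// le_max lexx orbT.
    - by rewrite le_max lexx orbT.
    rewrite ge_max; apply/andP; split; last by rewrite addr_ge0// le_max lexx orbT.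
    have a1 : f x + t * y n x <= Num.max (f x + t * y n x) 0 by rewrite le_max lexx.
    have a2 : g x + s * y m x <= Num.max (g x + s * y m x) 0 by rewrite le_max lexx.
    have a3 : t * y k x <= t * y n x by rewrite ler_wpM2l.
    have a4 : s * y k x <= s * y m x by rewrite ler_wpM2l.
    rewrite /= mulrDl; lra.
  apply: inf_scale_le => //; [exact: lA|exact/lA/XZ|].
  move=> _ [n [t [t0 ->]]]; exists (N ((a \*o f) \+ ((a * t) \*o y n))^\+ - (a * t) * d).
    by exists n, (a * t); split => //; exact: mulr_ge0.
  rewrite (_ : ((a \*o f) \+ ((a * t) \*o y n))^\+ = a \*o (f \+ (t \*o y n))^\+).
    by rewrite (NZ _ (X_pos (Xt n t f Xf)).1) (ger0_norm a0) mulrBr mulrA.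
  by apply/funext => x /=; rewrite !funrposE /= -mulrA -mulrDr maxr_pMr// mulr0.
have [phi lphi phiA] := hahn_banach (bfs_zero hB) (bfs_linear hB) sA.
(* The term [t = 0]. A bound by the norm of the positive part yields at once that [phi] is positive
   and has norm at most 1. *)
have phiP h : X h -> phi h <= N h^\+.
  move=> Xh; apply: (le_trans (phiA h Xh)); apply: ge_inf; first exact: lA.
  exists 0%N, 0; split => //; rewrite mul0r subr0; congr (N _^\+).
  by apply/funext => x /=; rewrite mul0r addr0.
have phiN h : X h -> phi ((-1) \*o h) = - phi h.
  by move=> Xh; rewrite (linZ (bfs_zero hB) lphi)// mulN1r.
have phi1 h : X h -> phi h <= N h.
  by move=> Xh; apply: (le_trans (phiP h Xh)); exact: (X_pos Xh).2.
have phib h : X h -> `|phi h| <= N h.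
  move=> Xh; rewrite ler_norml phi1// andbT.
  have := phi1 _ (XZ (-1) Xh); rewrite phiN// NZ// normrN1 mul1r; lra.
exists phi; split.
- split => //; split => //; exists 1 => f Xf; rewrite mul1r; exact: phib.
- move=> f Xf f0; have := phiP _ (XZ (-1) Xf); rewrite phiN//.
  rewrite (X_ae_eq (bfs_zero hB)) ?N0; first lra.
    exact: (X_pos (XZ _ Xf)).1.
  apply: ae01S f0 => x _ f0 /=; rewrite funrposE /= mulN1r; apply/max_idPr; lra.
(* At [h = - y n] the term [t = 1] has the value [- d]. *)
move=> n; have := phiA _ (XZ (-1) (Xy n)); rewrite phiN//.
suff : inf (A (-1 \*o y n)) <= - d by lra.
apply: ge_inf; first by apply: lA; exact: XZ.
exists n, 1; split => //; rewrite mul1r (_ : (_ \+ _)^\+ = cst 0) ?N0 ?sub0r//.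
by apply/funext => x /=; rewrite funrposE /= mul1r mulN1r addNr maxxx.
Qed.

Lemma norming_functional f : X f ->
  exists phi, [/\ dual_ball X phi, forall g, X g -> ae01 (fun x => 0 <= g x) -> 0 <= phi g &
     N f^\+ <= phi f].
Proof.
move=> Xf; have [||phi [h1 h2 h3]] := @positive_functional (fun=> f) (N f^\+) (fun=> Xf).
- by move=> m n _; apply: ae01W.
- by [].
by exists phi; split => //; exact: h3 0%N.
Qed.

(** Positive norming functionals show that the positive parts of [f] and of [- f] both have norm
    zero. A vector integral is characterised only through functionals, and this turns equality under
    all of them into equality in norm. *)
Lemma dual_separates f : X f -> (forall phi, dual_space X phi -> phi f = 0) -> N f = 0.
Proof.
move=> Xf h.
have p0 g : X g -> (forall phi, dual_space X phi -> phi g = 0) -> N g^\+ = 0.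
  move=> Xg hg; have [phi [[hphi _] _]] := norming_functional Xg.
  rewrite hg// => le0; apply/eqP; rewrite eq_le le0 Nge0//; exact: (X_pos Xg).1.
have h1 := p0 f Xf h.
have h2 : N ((-1) \*o f)^\+ = 0.
  by apply: p0 (XZ _ Xf) _ => phi hphi; rewrite (linZ (bfs_zero hB) hphi.1)// h// mulr0.
apply/eqP; rewrite eq_le Nge0// andbT.
have Xp := (X_pos Xf).1; have Xn := (X_pos (XZ (-1) Xf)).1.
have := ND Xp Xn; rewrite h1 h2 addr0 => /(le_trans _); apply.
apply: X_le => //; first exact: XD.
apply: ae01W => x _ /=; rewrite !funrposE /= !mulN1r; have [a|a] := leP (f x) 0.
  rewrite add0r; have [b|] := leP (- f x) 0; last by rewrite normrN.
  by rewrite normr0 normr_le0; apply/eqP; lra.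
by rewrite (_ : Num.max (- f x) 0 = 0) ?addr0//; apply/max_idPr; lra.
Qed.

(** For [M >= n] one has [(u n - g)^+ <= |u M - g|] almost everywhere, and the right-hand side tends
    to 0 in norm. *)
Lemma incr_cvg_le (u : nat -> R -> R) g : (forall n, X (u n)) -> X g ->
  (forall m n, (m <= n)%N -> ae01 (fun x => u m x <= u n x)) ->
  norm_cvg X u g -> forall n, ae01 (fun x => u n x <= g x).
Proof.
move=> Xu Xg du ug n.
have Xp := (X_pos (XB (Xu n) Xg)).1.
have : N (u n \- g)^\+ = 0.
  apply/eqP; rewrite eq_le Nge0// andbT; apply/ler_addgt0Pr => e e0; rewrite add0r.
  have /cvgrPdist_le /(_ e e0)[M _ HM] := ug.
  have := HM (maxn M n) (leq_maxl _ _); rewrite sub0r normrN ger0_norm; last by apply: Nge0; exact: XB.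
  move=> /(le_trans _); apply; apply: X_le => //; first exact: XB.
  apply: ae01S (du n (maxn M n) (leq_maxr _ _)) => x _ h /=.
  rewrite funrposE ger0_norm; last by rewrite le_max lexx orbT.
  rewrite ge_max normr_ge0 andbT; apply: le_trans (ler_norm _) => /=; lra.
move=> /(bfs_norm0 hB Xp); apply: ae01S => x _; rewrite funrposE => h.
have : u n x - g x <= Num.max (u n x - g x) 0 by rewrite le_max lexx.
by rewrite h; lra.
Qed.

End bfs.

(** * The Cesaro operator *)

Section lebesgue.
Context (R : realType).
Local Notation leb := (@completed_lebesgue_measure R).
Local Notation I01 := (`[0, 1]%classic : set (lebT R)).

Lemma borel_leb (A : set R) : measurable (A : set (measurableTypeR R)) -> measurable (A : set (lebT R)).
Proof. exact: sub_caratheodory. Qed.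

Lemma itv_leb (i : interval R) : measurable ([set` i] : set (lebT R)).
Proof. exact: borel_leb. Qed.

Lemma leb_itv (a b : R) (x y : bool) : a <= b ->
  leb ([set` Interval (BSide x a) (BSide y b)] : set (lebT R)) = (b - a)%:E.
Proof.
move=> ab; have := @lebesgue_measure_itv R (Interval (BSide x a) (BSide y b)).
rewrite /= lte_fin => h.
transitivity (@lebesgue_measure R [set` Interval (BSide x a) (BSide y b)]); first by [].
by rewrite h; have [//|] := ltP a b => ba; congr EFin; lra.
Qed.

Lemma mI01 : measurable I01. Proof. exact: itv_leb. Qed.

Lemma leb_I01 : leb I01 = 1%:E.
Proof. by rewrite leb_itv// subr0. Qed.

Lemma finI01 : (leb I01 < +oo)%E. Proof. by rewrite leb_I01 ltry. Qed.

Lemma fin_sub (A : set (lebT R)) : measurable A -> A `<=` I01 -> (leb A < +oo)%E.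
Proof. by move=> mA AI; apply: le_lt_trans finI01; rewrite le_measure ?inE//; exact: mI01. Qed.

Lemma leb_le1 (A : set (lebT R)) : measurable A -> A `<=` I01 -> (leb A <= 1%:E)%E.
Proof. by move=> mA AI; rewrite -leb_I01 le_measure ?inE//; exact: mI01. Qed.

Lemma fine_cover_I01 (r : R) : 0 < r -> exists (n : nat) (P : nat -> set (lebT R)),
  [/\ forall i, measurable (P i), forall i, (leb (P i) < r%:E)%E &
      I01 `<=` \bigcup_(i in `I_n) P i].
Proof.
move=> r0; pose k := (Num.trunc (r^-1)).+1.
have k0 : 0 < k%:R :> R by rewrite ltr0n.
have kr : k%:R^-1 < r.
  rewrite -[ltRHS]invrK ltf_pV2 ?posrE ?invr_gt0//.
  by rewrite /k truncnS_gt// .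
(* There are [k + 1] intervals of length [1 / k], the last one being there for the point 1. *)
exists k.+1, (fun i => `[i%:R / k%:R, i.+1%:R / k%:R]%classic); split.
- by move=> i; exact: itv_leb.
- move=> i; rewrite leb_itv; last by rewrite ler_pM2r ?invr_gt0// ler_nat.
  by rewrite lte_fin -mulrBl -natr1 addrAC subrr add0r mul1r.
move=> x; rewrite /= in_itv /= => /andP[x0 x1].
have xk : 0 <= x * k%:R by rewrite mulr_ge0// ltW.
exists (Num.trunc (x * k%:R)).
  rewrite /= -(ltr_nat R) (@le_lt_trans _ _ (x * k%:R))//; first by rewrite truncn_le.
  by rewrite -natr1; apply: (@le_lt_trans _ _ k%:R); [rewrite ler_piMl// ltW|lra].
rewrite /= in_itv /= ler_pdivrMr// ler_pdivlMr// truncn_le// xk/=.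
by apply: ltW; exact: truncnS_gt.
Qed.

Lemma ae01_lt1 (P : R -> Prop) : (forall x, 0 < x < 1 -> P x) -> @ae01 R P.
Proof.
move=> h; exists (`[0, 0] `|` `[1, 1])%classic; split.
- by apply: measurableU; exact: itv_leb.
- apply/eqP; rewrite eq_le measure_ge0 andbT.
  apply: (le_trans (@measureU2 _ _ _ leb _ _ (itv_leb `[0, 0]) (itv_leb `[1, 1]))).
  have n0 (a : R) : leb (`[a, a]%classic : set (lebT R)) = 0 by rewrite leb_itv// subrr.
  by rewrite [X in (X + _ <= _)%E](_ : _ = 0) ?[X in (_ + X <= _)%E](_ : _ = 0) ?adde0//; exact: n0.
move=> x /= /not_implyP[]; rewrite /= in_itv /= => /andP[x0 x1] nP.
have [->|xn0] := eqVneq x 0; first by left; rewrite /= in_itv /= lexx.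
have [->|xn1] := eqVneq x 1; first by right; rewrite /= in_itv /= lexx.
by exfalso; apply: nP; apply: h; rewrite !lt_neqAle eq_sym xn0 x0 xn1.
Qed.

Lemma ae01_exists (P : R -> Prop) (a b : R) : 0 <= a -> a < b -> b <= 1 -> @ae01 R P ->
  exists2 x, a < x < b & P x.
Proof.
move=> a0 ab b1 [N [mN N0 hN]]; apply: contrapT => nex.
have : (leb `]a, b[ <= leb N)%E.
  rewrite le_measure ?inE//; first exact: itv_leb.
  move=> x /=; rewrite in_itv /= => xab; apply: hN => /= h; apply: nex; exists x => //.
  by apply: h; rewrite /= in_itv /=; move: xab => /andP[? ?]; apply/andP; split; lra.
rewrite N0 => h; have : ((b - a)%:E <= (0 : R)%:E)%E by rewrite -(leb_itv false true (ltW ab)).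
by rewrite lee_fin; lra.
Qed.

(** Preimages of upper rays under a monotone function are intervals. Measurability of Cesaro means
    and of rearrangements rests on this. *)
Lemma nd_measurable (G : R -> \bar R) :
  (forall x y, 0 <= x -> x <= y -> y <= 1 -> (G x <= G y)%E) ->
  measurable_fun (I01 : set (lebT R)) (G : lebT R -> \bar R).
Proof.
move=> ndG mI; apply: (measurability _ (ErealGenOInfty.measurableE R)).
move=> /= _ [_ [a ->] <-]; apply: borel_leb; apply: is_interval_measurable.
move=> x y [/= Ix Gx] [/= Iy Gy] z /andP[xz zy].
move: Ix Iy Gx Gy; rewrite /= !in_itv /= !andbT => /andP[x0 x1] /andP[y0 y1] Gx Gy.
split; first by apply/andP; split; lra.
apply: (lt_le_trans Gx); apply: ndG => //; lra.
exact: mI.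
Qed.

Lemma inv_meas : measurable_fun I01 (fun x : lebT R => (x : R)^-1).
Proof.
(* The value [-oo] keeps [G] nondecreasing at 0, and [fine] sends it to 0, which agrees with the
   convention for the inverse of 0. *)
pose G (x : R) : \bar R := if x == 0 then -oo%E else (- x^-1)%:E.
have mG : measurable_fun I01 (G : lebT R -> \bar R).
  apply: nd_measurable => x y x0 xy y1; rewrite /G.
  have [//|xn0] := eqVneq x 0; first by rewrite leNye.
  have xp : 0 < x by rewrite lt_neqAle eq_sym xn0.
  have yp : 0 < y by exact: lt_le_trans xy.
  by rewrite gt_eqF// lee_fin lerN2 lef_pV2.
rewrite (_ : (fun _ => _) = (fun x => - fine (G x))); last first.
  apply/funext => x; rewrite /G; have [->|_] := eqVneq (x : R) 0; rewrite /= ?opprK//.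
  by rewrite invr0 oppr0.
apply: measurable_funN; exact: meas_fine.
Qed.

Lemma sub0x (x : R) : x <= 1 -> `[0, x]%classic `<=` I01.
Proof. by move=> x1 t /=; rewrite !in_itv /= => /andP[t0 tx]; apply/andP; split; lra. Qed.

Lemma Lmeas_sub (f : R -> R) (A : set (lebT R)) : Lmeasurable f -> measurable A -> A `<=` I01 ->
  measurable_fun A (f : lebT R -> R).
Proof. by move=> mf mA AI; apply: measurable_funS mf => //; exact: mI01. Qed.

(** The primitives of the positive and negative parts are nondecreasing with values in [[0, +oo]],
    hence measurable without any integrability of [f]; the integral is their difference by
    definition. *)
Lemma cesaro_meas (f : R -> R) : Lmeasurable f -> Lmeasurable (cesaro_op f).
Proof.
move=> mf.
have mE (g : lebT R -> \bar R) : measurable_fun I01 g -> (forall x, (0 <= g x)%E) ->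
    measurable_fun (I01 : set (lebT R)) (fun x : lebT R => \int[leb]_(t in (`[0%R, x]%classic : set (lebT R))) g t)%E.
  move=> mg g0; apply: (@nd_measurable (fun x => \int[leb]_(t in (`[0%R, x]%classic : set (lebT R))) g t)%E) => x y x0 xy y1.
  apply: ge0_subset_integral => //; [exact: itv_leb|exact: itv_leb| |].
    by apply: measurable_funS mg; [exact: mI01|exact: sub0x].
  by move=> t /=; rewrite !in_itv /= => /andP[t0 tx]; rewrite t0 (le_trans tx).
rewrite /Lmeasurable /cesaro_op; apply: measurable_funM.
  exact: inv_meas.
rewrite /Rintegral.
apply: meas_fine.
rewrite (_ : (fun x => _) = (fun x => \int[leb]_(t in (`[0%R, x]%classic : set (lebT R))) (EFin \o (f : lebT R -> R))^\+ t -
   \int[leb]_(t in (`[0%R, x]%classic : set (lebT R))) (EFin \o (f : lebT R -> R))^\- t)%E); last first.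
  by apply/funext => x; exact: integralE.
have mf' : measurable_fun I01 (EFin \o f : lebT R -> \bar R) by exact/measurable_EFinP.
by apply: emeasurable_funB; apply: mE => //; [exact: measurable_funepos|exact: measurable_funeneg].
Qed.

Local Notation J f x := (\int[leb]_(t in (`[0%R, x]%classic : set (lebT R))) `|f t|%:E)%E.
Local Notation L1 A f := (integrable leb (A : set (lebT R)) (EFin \o (f : lebT R -> R))).

(** The primitive of [|f|] is nondecreasing, and the null exceptional set leaves a point of
    finiteness in []x, 1[]. *)
Lemma ae_locint (f : R -> R) : Lmeasurable f ->
  @ae01 R (fun x => (J f x < +oo)%E) <-> (forall x, 0 <= x < 1 -> L1 `[0, x]%classic f).
Proof.
move=> mf; split => [h x /andP[x0 x1]|h]; last first.
  by apply: ae01_lt1 => x /andP[x0 x1]; have hx : 0 <= x < 1 by [rewrite ltW]; have /integrableP[_ +] := h x hx.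
have [y /andP[xy y1] hy] := ae01_exists x0 x1 (lexx 1) h.
apply/integrableP; split.
  by apply/measurable_EFinP; apply: Lmeas_sub => //; [exact: itv_leb|exact/sub0x/ltW].
apply: le_lt_trans hy; apply: ge0_subset_integral => //; [exact: itv_leb|exact: itv_leb| |].
  do 2 apply: measurableT_comp => //; apply: Lmeas_sub => //; [exact: itv_leb|exact/sub0x/ltW].
by move=> t /=; rewrite !in_itv /= => /andP[t0 tx]; rewrite t0 (le_trans tx (ltW xy)).
Qed.

(** Integrability up to the endpoint 1 cannot be demanded: [1 / (1 - x)] belongs to the Cesaro space
    of [L^1], because its Cesaro mean [- ln (1 - x) / x] is integrable. *)
Definition locint (f : R -> R) := Lmeasurable f /\ forall x, 0 <= x < 1 -> L1 `[0, x]%classic f.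

Lemma locintL (a : R) f g : locint f -> locint g -> locint (a \*o f \+ g).
Proof.
move=> [mf hf] [mg hg]; split.
  by apply: measurable_funD => //; exact: measurable_funM.
move=> x hx; have mx : measurable (`[0, x]%classic : set (lebT R)) by exact: itv_leb.
exact: (L1L a mx (hf x hx) (hg x hx)).
Qed.

Lemma locint_ideal f g : locint f -> Lmeasurable g -> @ae01 R (fun x => `|g x| <= `|f x|) -> locint g.
Proof.
move=> [mf hf] mg h; split => // x hx.
have mx : measurable (`[0, x]%classic : set (lebT R)) by exact: itv_leb.
have sx : `[0, x]%classic `<=` I01 by apply: sub0x; move: hx => /andP[_ /ltW].
apply: (L1_ae_le mx (hf x hx)); first exact: Lmeas_sub.
by move: h; apply: (@filterS _ _ (ae_filter_ringOfSetsType _)) => t ht tx; apply: ht; exact: sx.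
Qed.

Lemma locint_abs f : locint f -> locint (Num.norm \o f).
Proof.
move=> lf; apply: (locint_ideal lf); first by apply: measurableT_comp => //; exact: lf.1.
by apply: ae01W => x _ /=; rewrite normr_id.
Qed.

Lemma locint_bounded (f : R -> R) : @Linfty R f -> locint f.
Proof.
move=> [mf [M hM]]; apply: (@locint_ideal (cst M)) => //.
  split; first exact: measurable_cst.
  move=> x /andP[x0 x1]; have mx : measurable (`[0, x]%classic : set (lebT R)) by exact: itv_leb.
  apply: (@L1_ae_bounded _ _ _ leb _ _ `|M|) => //.
  - by apply: fin_sub => //; exact/sub0x/ltW.
  - by apply: aeW.
by move: hM; apply: ae01S => x _ h; apply: (le_trans h); exact: ler_norm.
Qed.

Lemma cesaroL (a : R) f g x : locint f -> locint g -> 0 < x < 1 ->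
  cesaro_op (a \*o f \+ g) x = a * cesaro_op f x + cesaro_op g x.
Proof.
move=> lf lg /andP[x0 x1]; have hx : 0 <= x < 1 by rewrite ltW.
have mx : measurable (`[0, x]%classic : set (lebT R)) by exact: itv_leb.
rewrite /cesaro_op /=.
by rewrite (intL a mx (lf.2 x hx) (lg.2 x hx)) mulrDr mulrCA.
Qed.

Lemma cesaro_le f g x : locint f -> locint g -> 0 < x < 1 ->
  @ae01 R (fun t => f t <= g t) -> cesaro_op f x <= cesaro_op g x.
Proof.
move=> lf lg /andP[x0 x1] h; have hx : 0 <= x < 1 by rewrite ltW.
have mx : measurable (`[0, x]%classic : set (lebT R)) by exact: itv_leb.
rewrite /cesaro_op ler_wpM2l ?invr_ge0 ?(ltW x0)//.
apply: (int_ae_le mx (lf.2 x hx) (lg.2 x hx)).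
by move: h; apply: (@filterS _ _ (ae_filter_ringOfSetsType _)) => t ht tx; apply: ht; exact: (sub0x (ltW x1)).
Qed.

Lemma cesaro0 x : cesaro_op (cst 0 : R -> R) x = 0.
Proof. by rewrite /cesaro_op /Rintegral integral0 mulr0. Qed.

Lemma cesaro_ge0 (f : R -> R) x : (forall t, 0 <= f t) -> 0 <= x -> 0 <= cesaro_op f x.
Proof. by move=> f0 x0; rewrite /cesaro_op mulr_ge0 ?invr_ge0//; apply: Rintegral_ge0. Qed.

Lemma cesaro_abs_ge0 (f : R -> R) x : 0 <= x -> 0 <= cesaro_op (Num.norm \o f) x.
Proof. by move=> x0; apply: cesaro_ge0 => // t /=. Qed.

Lemma cesaro_abs_norm (f : R -> R) x : 0 <= x ->
  `|cesaro_op (Num.norm \o f) x| = cesaro_op (Num.norm \o f) x.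
Proof. by move=> x0; rewrite ger0_norm// cesaro_abs_ge0. Qed.

Lemma cesaro_norm f x : locint f -> 0 < x < 1 ->
  `|cesaro_op f x| <= cesaro_op (Num.norm \o f) x.
Proof.
move=> lf /andP[x0 x1]; have hx : 0 <= x < 1 by rewrite ltW.
have mx : measurable (`[0, x]%classic : set (lebT R)) by exact: itv_leb.
rewrite /cesaro_op normrM ger0_norm ?invr_ge0 ?(ltW x0)// ler_wpM2l ?invr_ge0 ?(ltW x0)//.
exact: le_normr_Rintegral (lf.2 x hx).
Qed.

Lemma cesaro_cst (M x : R) : 0 < x -> cesaro_op (cst M) x = M.
Proof.
move=> x0; rewrite /cesaro_op Rintegral_cst; last exact: itv_leb.
rewrite (_ : fine _ = x); first by rewrite mulrCA mulVf ?mulr1// gt_eqF.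
by have /(congr1 fine) := leb_itv true false (ltW x0); rewrite subr0.
Qed.

Lemma cesaro_indic_le (A : set (lebT R)) x : measurable A -> A `<=` I01 -> 0 < x < 1 ->
  cesaro_op (\1_A : R -> R) x <= fine (leb A) / x.
Proof.
move=> mA AI /andP[x0 x1]; rewrite /cesaro_op mulrC ler_pM2r ?invr_gt0//.
have mx : measurable (`[0, x]%classic : set (lebT R)) by exact: itv_leb.
rewrite /Rintegral integral_indic// fine_le//.
- by rewrite ge0_fin_numE//; apply: fin_sub; [exact: measurableI|move=> t [/AI]].
- by rewrite ge0_fin_numE//; apply: fin_sub.
by rewrite le_measure ?inE//; exact: measurableI.
Qed.

End lebesgue.

(** * Rearrangement invariant spaces and the Cesaro space *)

Section ri.
Context (R : realType) (X : fspace R).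
Hypothesis hX : ri_space X.
Local Notation leb := (@completed_lebesgue_measure R).
Local Notation I01 := (`[0, 1]%classic : set (lebT R)).
Local Notation N := (fnorm X).
Implicit Types f g h : R -> R.
Let hB := ri_bfs hX.

(** A smaller distribution function enlarges the set whose infimum is the rearrangement. In this
    form rearrangement invariance is checked on level sets. *)
Lemma ri_dist f g : X f -> Lmeasurable g ->
  (forall tau : R, 0 <= tau -> (distribution_fun g tau <= distribution_fun f tau)%E) ->
  X g /\ N g <= N f.
Proof.
move=> Xf mg h; apply: (ri_rearrangement hX) => // t _.
apply: ereal_inf_le_tmp => _ [tau [tau0 ht] <-].
by exists tau => //; split => //; exact: le_trans (h tau tau0) ht.
Qed.

Lemma level_meas f (tau : R) : Lmeasurable f ->
  measurable ([set x | I01 x /\ tau < `|f x|] : set (lebT R)).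
Proof.
move=> mf; rewrite (_ : [set x | _] = I01 `\` (I01 `&` [set x | (Num.norm \o f) x <= cst tau x])).
  apply: measurableD; first exact: mI01.
  apply: measurable_fun_le => //; [exact: mI01|by apply: measurableT_comp].
apply/seteqP; split => x /=; first by move=> [Ix h]; split => // -[_]; rewrite leNgt h.
by move=> [Ix h]; split => //; rewrite ltNge; apply/negP => h'; apply: h.
Qed.

Lemma indic_meas (A : set (lebT R)) : measurable A -> Lmeasurable (\1_A : R -> R).
Proof. by move=> mA; exact: measurable_indic. Qed.

Lemma dist_indic (A : set (lebT R)) (tau : R) : A `<=` I01 -> 0 <= tau ->
  distribution_fun (\1_A : R -> R) tau = if tau < 1 then leb A else 0%E.
Proof.
move=> AI t0; rewrite /distribution_fun; case: ifPn => [t1|/negP t1].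
  congr leb; apply/seteqP; split => x /=; rewrite indicE.
    move=> [_]; have [/set_mem//|] := boolP (x \in A).
    by rewrite normr0 ltNge t0.
  by move=> Ax; split; [exact: AI|rewrite mem_set// normr1].
rewrite -(measure0 leb); congr leb; apply/seteqP; split => x //= [_].
rewrite indicE; case: (x \in A); rewrite ?normr0 ?normr1 => // h.
by rewrite ltNge t0 in h.
Qed.

Lemma dist_indic_le (A B : set (lebT R)) : A `<=` I01 -> B `<=` I01 -> (leb A <= leb B)%E ->
  measurable A -> X (\1_B : R -> R) -> X (\1_A : R -> R) /\ N (\1_A : R -> R) <= N (\1_B : R -> R).
Proof.
move=> AI BI AB mA XB; apply: ri_dist => //; first exact: indic_meas.
by move=> tau t0; rewrite !dist_indic//; case: ifP.
Qed.

Lemma X_level f (M : R) : X f -> 0 < M ->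
  let A := [set x | I01 x /\ M < `|f x|] : set (lebT R) in
  X (\1_A : R -> R) /\ M * N (\1_A : R -> R) <= N f.
Proof.
move=> Xf M0 A; have mA : measurable A by apply: level_meas; exact: Xmeas Xf.
have [XMA NMA] : X (M \*o (\1_A : R -> R)) /\ N (M \*o (\1_A : R -> R)) <= N f.
  apply: (X_ideal hB Xf); first by apply: measurable_funM => //; exact: indic_meas.
  apply: ae01W => x _ /=; rewrite indicE.
  have [/set_mem[_ h]|_] := boolP (x \in A); last by rewrite mulr0 normr0.
  by rewrite mulr1 gtr0_norm// ltW.
have XA : X (\1_A : R -> R).
  have := XZ hB M^-1 XMA; congr (fcarrier X); apply/funext => x /=.
  by rewrite mulrA mulVf ?mul1r// gt_eqF.
by split => //; rewrite -(gtr0_norm M0) -(NZ hB).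
Qed.

Lemma exists_indic : exists A : set (lebT R), [/\ measurable A, A `<=` I01, (0 < leb A)%E & X (\1_A : R -> R)].
Proof.
have [f Xf Nf] := ri_nontrivial hX.
apply: contrapT => /forallNP h.
have hn n : leb ([set x | I01 x /\ n.+1%:R^-1 < `|f x|] : set (lebT R)) = 0.
  have n0 : 0 < n.+1%:R^-1 :> R by rewrite invr_gt0.
  have [XA _] := X_level Xf n0.
  have mA := level_meas n.+1%:R^-1 (Xmeas hB Xf).
  apply/eqP; rewrite eq_le measure_ge0 andbT leNgt; apply/negP => lt.
  by apply: (h _); split; [exact: mA| |exact: lt|exact: XA] => x [].
move/eqP : Nf; apply; apply/(bfs_norm0 hB) => //.
have H n : @ae01 R (fun x => `|f x| <= n.+1%:R^-1).
  exists [set x | I01 x /\ n.+1%:R^-1 < `|f x|]; split; [exact/level_meas/(Xmeas hB)|exact: hn|].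
  by move=> x /= /not_implyP[Ix /negP]; rewrite -ltNge.
have := ae01_all H; apply: ae01S => x _ hx.
apply/eqP; rewrite -normr_eq0 eq_le normr_ge0 andbT.
apply/ler_addgt0Pr => e e0; rewrite add0r.
have [n _ /(_ n (leqnn n)) hn'] := near_infty_natSinv_lt (PosNum e0).
exact: le_trans (hx n) (ltW hn').
Qed.

(** Some level set [A] of a function of nonzero norm is not null. The unit interval is covered by
    finitely many sets of measure below that of [A]; each indicator belongs to [X] by comparison
    with [1_A], and their sum dominates 1. *)
Lemma one_in_X : X (cst 1).
Proof.
have [A [mA AI A0 XA]] := exists_indic.
have Af : leb A \is a fin_num by rewrite ge0_fin_numE//; exact: fin_sub.
have r0 : 0 < fine (leb A) by rewrite fine_gt0// A0 -ge0_fin_numE.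
have [n [P [mP hP IP]]] := fine_cover_I01 r0.
pose Q j := (\bigcup_(i in `I_j) P i) `&` I01.
have mQ j : measurable (Q j).
  by apply: measurableI; [apply: bigcup_measurable => ? _; exact: mP|exact: mI01].
have XQ j : X (\1_(Q j) : R -> R).
  elim: j => [|j IH].
    rewrite /Q II0 bigcup_set0 set0I; have := bfs_zero hB; congr (fcarrier X).
    by apply/funext => x; rewrite indicE in_set0.
  have mPI : measurable (P j `&` I01) by apply: measurableI; [exact: mP|exact: mI01].
  have XP : X (\1_(P j `&` I01) : R -> R).
    have [] // := @dist_indic_le (P j `&` I01) A (@subIsetr _ _ _) AI _ mPI XA.
    rewrite -(fineK Af) (le_trans _ (ltW (hP j)))// le_measure ?inE//; exact: mP.
  have [] // := X_ideal hB (XD hB IH XP) (indic_meas (mQ j.+1)).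
  apply: ae01W => x _ /=; rewrite !indicE.
  have -> : (x \in Q j.+1) = (x \in Q j) || (x \in P j `&` I01).
    by rewrite /Q IIS bigcup_setU bigcup_set1 setIUl in_setU.
  by case: (x \in Q j); case: (x \in _ `&` _); rewrite /= ?normr0 ?normr1// ?addr0 ?add0r ?normr1//
     ger0_norm// ler_wpDr.
have [] // := X_ideal hB (XQ n) (measurable_cst _ : Lmeasurable (cst 1)).
apply: ae01W => x Ix; rewrite indicE mem_set//; split => //; exact: IP.
Qed.

Lemma Linfty_X f (M : R) : Lmeasurable f -> @ae01 R (fun x => `|f x| <= M) -> X f /\ N f <= `|M| * N (cst 1).
Proof.
move=> mf h; rewrite -(NZ hB); last exact: one_in_X.
apply: (X_ideal hB) => //; first by apply: XZ => //; exact: one_in_X.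
by apply: ae01S h => x _ /= hx; rewrite mulr1; apply: (le_trans hx); exact: ler_norm.
Qed.

Lemma indic_X (A : set (lebT R)) : measurable A -> X (\1_A : R -> R).
Proof.
move=> mA; have [] // := @Linfty_X (\1_A : R -> R) 1; first exact: indic_meas.
by apply: ae01W => x _; rewrite indicE; case: (x \in A); rewrite ?normr0 ?normr1.
Qed.

Hypothesis hne : fcarrier X <> Linfty.

(** This is where [X <> L^oo] is used. An unbounded [f] in [X] has a level set [A] of positive
    measure at the height [M = N f / e + 1], and [M 1_A <= |f|] gives [N 1_A <= e]; sets of smaller
    measure have smaller norm by rearrangement invariance. *)
Lemma indic_small (e : R) : 0 < e -> exists2 r : R, 0 < r &
  forall A : set (lebT R), measurable A -> A `<=` I01 -> (leb A < r%:E)%E -> N (\1_A : R -> R) <= e.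
Proof.
move=> e0; apply: contrapT => H; apply: hne; apply/funext => f; apply/propext; split; last first.
  by move=> [mf [M hM]]; have [] := Linfty_X mf hM.
move=> Xf; split; first exact: Xmeas Xf.
apply: contrapT => /forallNP nb.
pose M := N f / e + 1.
have M0 : 0 < M by have := divr_ge0 (Nge0 hB Xf) (ltW e0); rewrite /M; lra.
have [XA NA] := X_level Xf M0.
set A := [set x | _] in XA NA.
have mA : measurable A by apply: level_meas; exact: Xmeas Xf.
have AI : A `<=` I01 by move=> x [].
have Af : leb A \is a fin_num by rewrite ge0_fin_numE//; exact: fin_sub.
have A0 : (0 < leb A)%E.
  rewrite lt0e measure_ge0 andbT; apply/negP => /eqP A0; apply: (nb M).
  exists A; split => // x /= /not_implyP[Ix /negP]; rewrite -ltNge.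
  by split.
apply: H; exists (fine (leb A)); first by rewrite fine_gt0// A0 -ge0_fin_numE.
move=> B mB BI; rewrite fineK// => BA.
have [_ NB] := dist_indic_le BI AI (ltW BA) mB XA.
apply: (le_trans NB).
rewrite -(ler_pM2l M0); apply: (le_trans NA).
by rewrite /M mulrDl divfK ?gt_eqF// mul1r lerDl ltW.
Qed.

(** [C 1_A] is at most 1 on [[0, d]] and at most [leb A / d] beyond [d], so it is dominated by
    [1_[0,d] + leb A / d]. First [d] is chosen by [indic_small], then the measure of [A] is made
    small relative to [d]. *)
Lemma cesaro_indic_small (e : R) : 0 < e -> exists2 r : R, 0 < r &
  forall A : set (lebT R), measurable A -> A `<=` I01 -> (leb A < r%:E)%E ->
    N (cesaro_op (\1_A : R -> R)) <= e.
Proof.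
move=> e0; have e2 : 0 < e / 2 by lra.
have [r r0 hr] := indic_small e2.
pose d := Num.min (r / 2) 1.
have d0 : 0 < d by rewrite lt_min; apply/andP; split; lra.
have d1 : d <= 1 by rewrite ge_min lexx orbT.
have dr : d < r by rewrite gt_min; apply/orP; left; lra.
pose D := (`[0, d]%classic : set (lebT R)).
have mD : measurable D by exact: itv_leb.
have DI : D `<=` I01 by exact: sub0x.
have ND_ : N (\1_D : R -> R) <= e / 2.
  by apply: hr => //; rewrite /D leb_itv ?ltW// subr0 lte_fin.
have N1 : 0 <= N (cst 1) by apply: (Nge0 hB); exact: one_in_X.
exists (d * (e / 2) / (N (cst 1) + 1)); first by rewrite divr_gt0 ?mulr_gt0//; lra.
move=> A mA AI hA.
have Af : leb A \is a fin_num by rewrite ge0_fin_numE//; exact: fin_sub.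
have XD_ := indic_X mD.
have X1 := XZ hB (fine (leb A) / d) one_in_X.
have h : N (cesaro_op (\1_A : R -> R)) <= N ((\1_D : R -> R) \+ ((fine (leb A) / d) \*o cst 1)).
  have [] // := X_ideal hB (XD hB XD_ X1) (cesaro_meas (indic_meas mA)).
  apply: ae01_lt1 => x hx.
  have x0 : 0 < x by move: hx => /andP[].
  have A0 : 0 <= fine (leb A) / d by rewrite divr_ge0 ?fine_ge0// ltW.
  have c0 : 0 <= cesaro_op (\1_A : R -> R) x by apply: cesaro_ge0 => //; exact: ltW.
  rewrite /= mulr1 !ger0_norm//; last by rewrite addr_ge0// indicE.
  have lA : locint (\1_A : R -> R).
    apply: locint_bounded; split; first exact: indic_meas.
    by exists 1; apply: ae01W => t _; rewrite indicE; case: (t \in A); rewrite ?normr0 ?normr1.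
  have l1 : locint (cst 1 : R -> R).
    by apply: locint_bounded; split; [exact: measurable_cst|exists 1; apply: ae01W => t _; rewrite normr1].
  have [xd|dx] := leP x d.
    apply: (@le_trans _ _ 1); last first.
      by rewrite indicE mem_set ?lerDl// /D /= in_itv /= xd ltW.
    rewrite -(cesaro_cst 1 x0); apply: cesaro_le => //.
    by apply: ae01W => t _; rewrite indicE; case: (t \in A).
  apply: (@le_trans _ _ (fine (leb A) / d)); last by rewrite lerDr indicE.
  apply: (le_trans (cesaro_indic_le mA AI hx)).
  by rewrite ler_wpM2l ?fine_ge0// lef_pV2// ltW.
apply: (le_trans h); apply: (le_trans (ND hB XD_ X1)).
rewrite (NZ hB _ one_in_X) ger0_norm ?divr_ge0 ?fine_ge0 ?(ltW d0)//.
suff : fine (leb A) / d * N (cst 1) <= e / 2 by lra.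
have : fine (leb A) <= d * (e / 2) / (N (cst 1) + 1) by rewrite -lee_fin fineK// ltW.
rewrite ler_pdivlMr; last by lra.
move=> h1; rewrite mulrAC ler_pdivrMr//.
have : 0 <= fine (leb A) by rewrite fine_ge0.
nra.
Qed.

End ri.

(** * The space [C, X] *)

Section cesaro_space.
Context (R : realType) (X : fspace R).
Hypothesis hX : ri_space X.
Local Notation leb := (@completed_lebesgue_measure R).
Local Notation I01 := (`[0, 1]%classic : set (lebT R)).
Local Notation N := (fnorm X).
Local Notation E := (cesaro_space X).
Local Notation C := (@cesaro_op R).
Implicit Types f g h : R -> R.
Let hB := ri_bfs hX.

Lemma EP f : E f <-> locint f /\ X (C (Num.norm \o f)).
Proof.
split=> [[mf h Xf]|[[mf h] Xf]]; last by split => //; apply/(ae_locint mf).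
by split => //; split => //; apply/(ae_locint mf).
Qed.

Lemma E_locint f : E f -> locint f. Proof. by move=> /EP[]. Qed.
Lemma E_X f : E f -> X (C (Num.norm \o f)). Proof. by move=> /EP[]. Qed.

Lemma E_C f : E f -> X (C f) /\ N (C f) <= fnorm E f.
Proof.
move=> /EP[lf Xf]; apply: (X_ideal hB Xf); first exact: cesaro_meas lf.1.
apply: ae01_lt1 => x hx; have x0 : 0 <= x by case/andP: hx => /ltW.
by rewrite cesaro_abs_norm//; exact: cesaro_norm.
Qed.

Lemma E_ideal f g : E f -> Lmeasurable g -> @ae01 R (fun x => `|g x| <= `|f x|) ->
  E g /\ fnorm E g <= fnorm E f.
Proof.
move=> /EP[lf Xf] mg h; have lg := locint_ideal lf mg h.
suff [Xg Ng] : X (C (Num.norm \o g)) /\ N (C (Num.norm \o g)) <= N (C (Num.norm \o f)).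
  by split => //; apply/EP.
apply: (X_ideal hB Xf); first by apply: cesaro_meas; exact: (locint_abs lg).1.
apply: ae01_lt1 => x hx; have x0 : 0 <= x by case/andP: hx => /ltW.
by rewrite !cesaro_abs_norm//; apply: cesaro_le => //; exact: locint_abs.
Qed.

Lemma E_linear (a : R) f g : E f -> E g -> E (a \*o f \+ g) /\
  fnorm E (a \*o f \+ g) <= `|a| * fnorm E f + fnorm E g.
Proof.
move=> /EP[lf Xf] /EP[lg Xg]; have l := locintL a lf lg.
have Xs : X ((`|a| \*o C (Num.norm \o f)) \+ C (Num.norm \o g)) by exact: bfs_linear.
suff [X1 N1] : X (C (Num.norm \o (a \*o f \+ g))) /\
   N (C (Num.norm \o (a \*o f \+ g))) <= N ((`|a| \*o C (Num.norm \o f)) \+ C (Num.norm \o g)).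
  split; first exact/EP.
  apply: (le_trans N1); apply: (le_trans (ND hB (XZ hB _ Xf) Xg)).
  by rewrite (NZ hB _ Xf) normr_id.
apply: (X_ideal hB Xs); first by apply: cesaro_meas; exact: (locint_abs l).1.
apply: ae01_lt1 => x hx; have x0 : 0 <= x by case/andP: hx => /ltW.
have la := locint_abs lf; have lb := locint_abs lg.
rewrite [leRHS]ger0_norm; last by apply: addr_ge0; [apply: mulr_ge0 => //; exact: cesaro_abs_ge0|exact: cesaro_abs_ge0].
rewrite cesaro_abs_norm//= -(cesaroL _ la lb hx).
apply: cesaro_le => //; [exact: locint_abs|exact: locintL|].
by apply: ae01W => t _ /=; rewrite -normrM ler_normD.
Qed.

Lemma E_zero : E (cst 0).
Proof.
apply/EP; split.
  by apply: locint_bounded; split; [exact: measurable_cst|exists 0; apply: ae01W => x _; rewrite normr0].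
have := bfs_zero hB; congr (fcarrier X); apply/funext => x.
by rewrite (_ : Num.norm \o _ = cst 0) ?cesaro0//; apply/funext => t /=; rewrite normr0.
Qed.

Lemma E_B f g : E f -> E g -> E (f \- g).
Proof.
move=> Ef Eg; have := (E_linear (-1) Eg Ef).1; congr (fcarrier E).
by apply/funext => x /=; rewrite mulN1r addrC.
Qed.

Lemma E_Z (a : R) f : E f -> E (a \*o f) /\ fnorm E (a \*o f) <= `|a| * fnorm E f.
Proof.
move=> Ef; have := E_linear a Ef E_zero.
rewrite (_ : (a \*o f) \+ cst 0 = a \*o f); last by apply/funext => x /=; rewrite addr0.
rewrite (_ : fnorm E (cst 0) = 0) ?addr0//=.
rewrite (_ : C _ = cst 0) ?(N0 hB)//; apply/funext => x.
by rewrite (_ : Num.norm \o _ = cst 0) ?cesaro0//; apply/funext => t /=; rewrite normr0.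
Qed.

Lemma nE_ge0 f : E f -> 0 <= fnorm E f.
Proof. by move=> /E_X; exact: Nge0. Qed.

Lemma Linfty_E f : @Linfty R f -> E f.
Proof.
move=> bf; have [mf [M hM]] := bf; apply/EP; have lf := locint_bounded bf; split => //.
have l1 : locint (cst M : R -> R).
  by apply: locint_bounded; split; [exact: measurable_cst|exists `|M|; apply: ae01W => t _].
have [] // := @Linfty_X _ _ hX (C (Num.norm \o f)) M; first by apply: cesaro_meas; exact: (locint_abs lf).1.
apply: ae01_lt1 => x hx; have x0 : 0 < x by case/andP: hx.
rewrite cesaro_abs_norm ?(ltW x0)//.
rewrite -(cesaro_cst M x0); apply: cesaro_le => //; exact: locint_abs.
Qed.

Lemma Linfty_L (a : R) f g : @Linfty R f -> @Linfty R g -> @Linfty R (a \*o f \+ g).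
Proof.
move=> [mf [M hM]] [mg [K hK]]; split; first by apply: measurable_funD => //; exact: measurable_funM.
exists (`|a| * M + K); move: hM hK; apply: (@ae01S2 R) => x _ h1 h2 /=.
by apply: (le_trans (ler_normD _ _)); rewrite normrM lerD// ler_wpM2l.
Qed.

Lemma Linfty_cst (c : R) : @Linfty R (cst c).
Proof. by split; [exact: measurable_cst|exists `|c|; apply: ae01W => x _]. Qed.

Lemma Linfty_ideal f g : @Linfty R f -> Lmeasurable g -> @ae01 R (fun x => `|g x| <= `|f x|) -> @Linfty R g.
Proof.
move=> [mf [M hM]] mg h; split => //; exists M.
by move: hM h; apply: (@ae01S2 R) => x _ h1 h2; exact: le_trans h1.
Qed.

Lemma indic_Linfty (A : set (lebT R)) : measurable A -> @Linfty R (\1_A : R -> R).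
Proof.
move=> mA; split; first exact: indic_meas.
by exists 1; apply: ae01W => t _; rewrite indicE; case: (t \in A); rewrite ?normr0 ?normr1.
Qed.

Lemma dual_ae (phi : (R -> R) -> R) f g : dual_space X phi -> X f -> X g ->
  @ae01 R (fun x => f x = g x) -> phi f = phi g.
Proof.
move=> [lphi [M hM]] Xf Xg h.
have Xd : X ((-1) \*o g \+ f) by exact: bfs_linear.
have : phi ((-1) \*o g \+ f) = 0.
  apply/eqP; rewrite -normr_eq0 eq_le normr_ge0 andbT; apply: (le_trans (hM _ Xd)).
  suff -> : N ((-1) \*o g \+ f) = 0 by rewrite mulr0.
  by apply/(bfs_norm0 hB) => //; move: h; apply: ae01S => x _ /= ->; rewrite mulN1r addNr.
by rewrite lphi//; lra.
Qed.

Lemma dual_cesaro (phi : (R -> R) -> R) (M : R) : dual_space X phi ->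
  (forall f, X f -> `|phi f| <= M * N f) -> 0 <= M ->
  (forall (a : R) f g, E f -> E g -> phi (C (a \*o f \+ g)) = a * phi (C f) + phi (C g)) /\
  (forall f, E f -> `|phi (C f)| <= M * fnorm E f).
Proof.
move=> dphi hM M0; split=> [a f g Ef Eg|f Ef].
  have [Xf _] := E_C Ef; have [Xg _] := E_C Eg.
  rewrite -dphi.1//; apply: dual_ae => //; first by have [] := E_C (E_linear a Ef Eg).1.
    exact: bfs_linear.
  by apply: ae01_lt1 => x hx; rewrite cesaroL//; exact: E_locint.
have [Xf Nf] := E_C Ef; apply: (le_trans (hM _ Xf)); exact: ler_wpM2l.
Qed.

End cesaro_space.

(** * Signed measures with a density *)

Section density.
Context d (T : measurableType d) (R : realType).
Variables (mu : {sigma_finite_measure set T -> \bar R}) (D : set T) (v : T -> R).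
Hypotheses (mD : measurable D) (vD : mu.-integrable D (EFin \o v)) (v0 : forall x, 0 <= v x).

Import HBNNSimple.

(** Integrals are suprema over measurable simple functions, so only the values on measurable sets
    count. Variations and Jordan parts are bare set functions, and this allows them to be replaced
    by genuine measures. *)
Lemma eq_set_integral (k1 k2 : set T -> \bar R) (A : set T) (f : T -> \bar R) :
  (forall B, measurable B -> k1 B = k2 B) -> integral k1 A f = integral k2 A f.
Proof.
move=> h.
have e (s : {nnsfun T >-> R}) : sintegral k1 s = sintegral k2 s.
  by apply: eq_fsbigr => x _; rewrite h//; exact: measurable_sfunP.
by rewrite /integral; congr (ereal_sup _ - ereal_sup _)%E; apply: eq_imagel => s _; exact: e.
Qed.

(** On measurable sets [k] agrees with the measure [km] of density [v 1_D], which is finite and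
    dominated by [mu]; its Radon-Nikodym derivative equals [v] almost everywhere on [D], and the
    change of variables for that derivative gives the formula. *)
Lemma integral_density (k : set T -> \bar R) :
  (forall A, measurable A -> k A = (\int[mu]_(x in A `&` D) (v x)%:E)%E) ->
  forall (A : set T) (f : T -> R), measurable A -> A `<=` D -> measurable_fun A f ->
  ((forall x, 0 <= f x) -> integral k A (EFin \o f) = (\int[mu]_(x in A) (f x * v x)%:E)%E) /\
  (mu.-integrable A (EFin \o (fun x => f x * v x)) ->
     integral k A (EFin \o f) = (\int[mu]_(x in A) (f x * v x)%:E)%E).
Proof.
move=> kE.
pose g x : \bar R := ((v \_ D) x)%:E.
have mg : measurable_fun setT g.
  apply/measurable_EFinP; apply/(measurable_restrict _ mD measurableT).
  by rewrite setTI; exact: L1_meas vD.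
have g0 x : (0 <= g x)%E by rewrite lee_fin patchE; case: ifP.
pose km A := (\int[mu]_(x in A) g x)%E.
have kmE A : measurable A -> k A = km A.
  move=> mA; rewrite kE// /km integral_mkcondr; apply: eq_integral => x _.
  by rewrite /g !patchE; case: ifP.
have k0 : km set0 = 0%E by rewrite /km integral_set0.
have kge0 A : (0 <= km A)%E by apply: integral_ge0 => x _.
have ksa := semi_sigma_additive_nng_induced mg g0 : semi_sigma_additive km.
have gint : mu.-integrable setT g.
  by have := (integrable_mkcond (EFin \o v) mD).1 vD; rewrite restrict_EFin.
have kfin : fin_num_fun km.
  by move=> A mA; apply: integrable_fin_num => //; exact: integrableS gint.
pose kM : {measure set T -> \bar R} := HB.pack km (isMeasure.Build _ _ _ km k0 kge0 ksa).
pose kF : {finite_measure set T -> \bar R} := HB.pack (Measure.sort kM) (Measure_isFinite.Build _ _ _ kM kfin).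
have kmu : kF `<< mu.
  apply/null_content_dominatesP => A mA A0 /=.
  by apply: null_set_integral => //; exact: measurable_funTS.
have H (A : set T) (f : T -> \bar R) : measurable A -> A `<=` D -> measurable_fun A f ->
    (forall x, 0 <= f x)%E -> integral k A f = (\int[mu]_(x in A) (f x * (v x)%:E))%E.
  move=> mA AD mf f0; rewrite (@eq_set_integral _ (km : set T -> \bar R))//.
  have := Radon_Nikodym_SigmaFinite.change_of_variables kmu f0 mA mf; rewrite /= => <-.
  set rn := Radon_Nikodym_SigmaFinite.f kF mu.
  have rnint : mu.-integrable setT rn by exact: Radon_Nikodym_SigmaFinite.f_integrable.
  have aeg : ae_eq mu D rn g.
    apply: integral_ae_eq => //.
    - exact: integrableS rnint.
    - exact: measurable_funTS.
    by move=> B BD mB; rewrite -Radon_Nikodym_SigmaFinite.f_integral.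
  apply: ae_eq_integral => //.
  - by apply: emeasurable_funM => //; apply: measurable_funTS; exact: measurable_int rnint.
  - apply: emeasurable_funM => //; apply/measurable_EFinP.
    by apply: measurable_funS (L1_meas vD).
  apply: filterS aeg => x h Ax; rewrite h; last exact: AD.
  by rewrite /g patchE mem_set//; exact: AD.
move=> A f mA AD mf; split=> [f0|fi].
  by rewrite H//; exact/measurable_EFinP.
rewrite (@eq_set_integral _ (kM : set T -> \bar R))// integralE.
have mfE : measurable_fun A (EFin \o f) by exact/measurable_EFinP.
rewrite -!(@eq_set_integral k (kM : set T -> \bar R))//.
rewrite !H//; [|exact: measurable_funeneg|exact: measurable_funepos].
rewrite [RHS]integralE; congr (_ - _)%E; apply: eq_integral => x _.
  by rewrite !funeposE /= -!EFin_max -EFinM maxr_pMl// mul0r.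
by rewrite !funenegE /= -!EFin_max -EFinM maxr_pMl// mul0r mulNr.
Qed.

End density.

Section variation.
Context (R : realType).
Local Notation leb := (@completed_lebesgue_measure R).
Local Notation I01 := (`[0, 1]%classic : set (lebT R)).
Local Notation L1 A f := (integrable leb (A : set (lebT R)) (EFin \o (f : lebT R -> R))).
Variables (nu : set (lebT R) -> R) (w : R -> R).
Hypothesis wI : L1 I01 w.
Hypothesis nuE : forall A, measurable A -> nu A = \int[leb]_(t in A `&` I01) w t.

Let mAI (A : set (lebT R)) : measurable A -> measurable (A `&` I01).
Proof. by move=> mA; apply: measurableI => //; exact: mI01. Qed.

Let wA (A : set (lebT R)) : measurable A -> L1 (A `&` I01) w.
Proof. by move=> mA; apply: L1S wI; [exact: mI01|exact: mAI|exact: subIsetr]. Qed.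

(** The triangle inequality bounds every partition sum by the integral of [|w|], and the partition
    of [A] into two pieces by the sign of [w] attains it. *)
Lemma variation_density (A : set (lebT R)) : measurable A ->
  set_variation nu A = (\int[leb]_(t in A `&` I01) `|w t|)%:E.
Proof.
move=> mA; apply/eqP; rewrite eq_le; apply/andP; split.
  apply: ge_ereal_sup => _ [n [B [mB tB AB ->]]]; rewrite lee_fin.
  have -> : \int[leb]_(t in A `&` I01) `|w t| = \sum_(i < n) \int[leb]_(t in B i `&` I01) `|w t|.
    have AE : A `&` I01 = \big[setU/set0]_(i <- index_enum 'I_n) (B i `&` I01).
      rewrite -AB setI_bigcupl; apply/seteqP; split => x /=.
        move=> [i _ Bi]; rewrite (bigD1_seq i) ?index_enum_uniq ?mem_index_enum//=; by left.
      by rewrite big_seq; elim/big_ind : _ => [//|P Q hP hQ [/hP//|/hQ//]|i _ Bi]; exists i.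
    have := @ge0_integral_bigsetU _ _ _ leb _ (fun i => B i `&` I01)
      (fun t => `|w t|%:E) (index_enum 'I_n) (fun i => mAI (mB i)) (index_enum_uniq _).
    move=> /(_ _ _ _)/(congr1 fine); rewrite -AE /Rintegral => ->.
    - rewrite (eq_bigr (fun i => (\int[leb]_(t in B i `&` I01) `|w t|)%:E)) ?sumEFin// => i _.
      rewrite /Rintegral fineK//; apply: integrable_fin_num; first exact: mAI.
      exact: (integrable_norm (wA (mB i))).
    - by move=> i j _ _ [x [[Bi _] [Bj _]]]; apply: tB => //; exists x.
    - by have := integrable_norm (wA mA); exact: measurable_int.
    - by move=> x _; rewrite lee_fin.
  apply: ler_sum => i _; rewrite nuE//; apply: norm_int_le; [exact: mAI|exact: wA].
pose P := I01 `&` [set t | cst 0 t <= w t].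
have mP : measurable P by apply: measurable_fun_le => //; [exact: mI01|exact: L1_meas wI].
pose B (i : 'I_2) := if i == ord0 then A `&` P else A `\` P.
have mB i : measurable (B i) by rewrite /B; case: ifP => _; [exact: measurableI|exact: measurableD].
apply: ereal_sup_ubound; exists 2%N, B; split.
- exact: mB.
- move=> i j _ _ [x []]; rewrite /B.
  case: ifPn => hi; case: ifPn => hj; rewrite ?(eqP hi) ?(eqP hj)//.
  + by move=> [_ Px] [_ /(_ Px)].
  + by move=> [_ nP] [_ /nP].
  + move=> _ _; apply/val_inj; case: i j hi hj => [[|[|i]] hi] [[|[|j]] hj]//=.
- apply/seteqP; split => x; first by move=> [i _]; rewrite /B; case: ifP => _ [].
  by move=> Ax; have [Px|Px] := pselect (P x); [exists ord0|exists (lift ord0 ord0)].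
congr EFin; rewrite big_ord_recl big_ord_recl big_ord0 addr0 {1 2}/B eqxx /=.
rewrite !nuE; [|exact: measurableD|exact: measurableI].
have E1 : \int[leb]_(t in A `&` P `&` I01) w t = \int[leb]_(t in A `&` P `&` I01) `|w t|.
  by apply: eq_Rintegral => t; rewrite inE => -[[_ [_ /= h]] _]; rewrite ger0_norm.
have E2 : \int[leb]_(t in (A `\` P) `&` I01) w t = - \int[leb]_(t in (A `\` P) `&` I01) `|w t|.
  rewrite -mulN1r -RintegralZl//; last first.
  - exact: (integrable_norm (wA (measurableD mA mP))).
  - by apply: mAI; exact: measurableD.
  apply: eq_Rintegral => t; rewrite inE => -[[_ nP] It]; rewrite mulN1r ler0_norm ?opprK//.
  by rewrite leNgt; apply/negP => h; apply: nP; split => //=; exact: ltW.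
rewrite E1 E2 normrN !ger0_norm; [|by apply: Rintegral_ge0..].
rewrite (@int_split _ _ _ leb (A `&` I01) (A `&` P `&` I01)).
- congr (_ + _); congr (Rintegral _ _ _); apply/seteqP; split => x /=.
    by move=> [[Ax Ix] h]; split => //; split => // Px; apply: h.
  by move=> [[Ax nP] Ix]; split => // -[[_ Px] _].
- exact: mAI.
- by apply: mAI; exact: measurableI.
- by move=> x [[]].
- by apply: integrable_norm; exact: wA.
Qed.

Let posE (A : set (lebT R)) : measurable A ->
  (\int[leb]_(t in A `&` I01) (w^\+ t)%:E)%E = (\int[leb]_(t in A `&` I01) w^\+ t)%:E /\
  (\int[leb]_(t in A `&` I01) (w^\- t)%:E)%E = (\int[leb]_(t in A `&` I01) w^\- t)%:E.
Proof.
move=> mA; rewrite /Rintegral; split; rewrite fineK//.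
- by apply: integrable_fin_num; [exact: mAI|exact: (integrable_funrpos (mAI mA) (wA mA))].
- by apply: integrable_fin_num; [exact: mAI|exact: (integrable_funrneg (mAI mA) (wA mA))].
Qed.

Lemma pos_part_density (A : set (lebT R)) : measurable A ->
  pos_part nu A = (\int[leb]_(t in A `&` I01) (w^\+ t)%:E)%E.
Proof.
move=> mA; rewrite (posE mA).1 /pos_part variation_density// nuE// -EFinD -EFinM; congr EFin.
have h := @intL _ _ _ leb _ 1 _ _ (mAI mA) (integrable_norm (wA mA)) (wA mA).
rewrite mul1r in h; rewrite -h -RintegralZl; last 2 first.
- exact: mAI.
- by apply: L1L; [exact: mAI|exact: integrable_norm (wA mA)|exact: wA].
apply: eq_Rintegral => t _; rewrite mul1r funrposE /=.
by have [a|a] := leP (w t) 0; [rewrite (ler0_norm a)|rewrite (gtr0_norm a)]; lra.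
Qed.

Lemma neg_part_density (A : set (lebT R)) : measurable A ->
  neg_part nu A = (\int[leb]_(t in A `&` I01) (w^\- t)%:E)%E.
Proof.
move=> mA; rewrite (posE mA).2 /neg_part variation_density// nuE// -EFinB -EFinM; congr EFin.
have h := @intL _ _ _ leb _ (-1) _ _ (mAI mA) (wA mA) (integrable_norm (wA mA)).
have -> : \int[leb]_(t in A `&` I01) `|w t| - \int[leb]_(t in A `&` I01) w t =
   \int[leb]_(t in A `&` I01) (-1 * w t + `|w t|) by rewrite h; lra.
rewrite -RintegralZl; last 2 first.
- exact: mAI.
- by apply: L1L; [exact: mAI|exact: wA|exact: integrable_norm (wA mA)].
apply: eq_Rintegral => t _; rewrite /funrneg /=.
by have [a|a] := leP (w t) 0; [rewrite (ler0_norm a)|rewrite (gtr0_norm a)]; have [b|b] := leP (- w t) 0; lra.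
Qed.

Lemma abs_integral_density (f : R -> R) : Lmeasurable f ->
  abs_integral nu f = (\int[leb]_(t in I01) (`|f t * w t|)%:E)%E.
Proof.
move=> mf; rewrite /abs_integral.
have := @integral_density _ _ _ leb I01 (fun t => `|w t|) (@mI01 R) (integrable_norm wI) (fun t => normr_ge0 _) (set_variation nu).
move=> /(_ _ I01 (fun t => `|f t|) (@mI01 R) (fun _ h => h) _)[].
- move=> A mA; rewrite variation_density// /Rintegral fineK//.
  by apply: integrable_fin_num; [exact: mAI|exact: (integrable_norm (wA mA))].
- by apply: measurableT_comp.
move=> /(_ (fun t => normr_ge0 _)) + _ => ->.
by apply: eq_integral => t _; rewrite normrM.
Qed.

Lemma signed_integral_density (A : set (lebT R)) (f : R -> R) : measurable A -> A `<=` I01 ->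
  Lmeasurable f -> L1 A (fun t => f t * w t) ->
  signed_integral nu A f = \int[leb]_(t in A) (f t * w t).
Proof.
move=> mA AI mf fw; rewrite /signed_integral.
have mfA := Lmeas_sub mf mA AI.
have mw : measurable_fun A w by apply: Lmeas_sub (L1_meas wI) mA AI.
have i1 : L1 A (fun t => f t * w^\+ t).
  apply: (L1_ae_le mA fw).
    by apply: measurable_funM => //; exact: measurable_funrpos.
  apply: aeW => t _; rewrite !normrM ler_wpM2l//.
  by rewrite funrposE; have [a|a] := leP (w t) 0; rewrite ?normr0.
have i2 : L1 A (fun t => f t * w^\- t).
  apply: (L1_ae_le mA fw).
    by apply: measurable_funM => //; exact: measurable_funrneg.
  apply: aeW => t _; rewrite !normrM ler_wpM2l//.
  by rewrite /funrneg; have [a|a] := leP (- w t) 0; rewrite ?normr0// normrN.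
have [_ ->//] := @integral_density _ _ _ leb I01 w^\+ (@mI01 R) (integrable_funrpos (@mI01 R) wI)
  (fun t => funrpos_ge0 _ _) (pos_part nu) pos_part_density A f mA AI mfA.
have [_ ->//] := @integral_density _ _ _ leb I01 w^\- (@mI01 R) (integrable_funrneg (@mI01 R) wI)
  (fun t => funrneg_ge0 _ _) (neg_part nu) neg_part_density A f mA AI mfA.
rewrite -/(Rintegral leb A (fun t => f t * w^\+ t)) -/(Rintegral leb A (fun t => f t * w^\- t)).
rewrite -RintegralB//; apply: eq_Rintegral => t _; rewrite -mulrBr; congr (_ * _).
by rewrite /funrpos /funrneg /=; have [a|a] := leP (w t) 0; have [b|b] := leP (- w t) 0; lra.
Qed.

End variation.

(** * Densities of functionals and the passage to L^1(m) *)

Section representation.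
Context (R : realType) (X : fspace R).
Hypothesis hX : ri_space X.
Hypothesis hne : fcarrier X <> Linfty.
Local Notation leb := (@completed_lebesgue_measure R).
Local Notation I01 := (`[0, 1]%classic : set (lebT R)).
Local Notation L1 A f := (integrable leb (A : set (lebT R)) (EFin \o (f : lebT R -> R))).
Local Notation N := (fnorm X).
Local Notation E := (cesaro_space X).
Local Notation C := (@cesaro_op R).
Local Notation m := (@cesaro_measure R).
Implicit Types f g h w : R -> R.
Let hB := ri_bfs hX.

Lemma bounded_mul_L1 h w (K : R) : L1 I01 w -> Lmeasurable h ->
  @ae01 R (fun x => `|h x| <= K) -> L1 I01 (fun t => h t * w t).
Proof.
move=> wI mh hK; apply: (L1_ae_le (@mI01 R) (L1Z K (@mI01 R) wI)).
  by apply: measurable_funM => //; exact: L1_meas wI.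
move: hK; apply: (@ae01S R) => x _ hx; rewrite !normrM ler_wpM2r//.
exact: le_trans (ler_norm _).
Qed.

(** The norm of [1_A] in [[C, X]] is [N (C 1_A)], small for small [A], so [A |-> psi 1_A] has a
    density [w]. The defect [D] between [psi] and the integral vanishes on indicators; splitting off
    binary digits bounds it by [K 2^-k] on [[0, 1]]-valued functions for every [k], so it vanishes
    on [L^oo]. *)
Lemma linear_density (psi : (R -> R) -> R) (M : R) : 0 <= M ->
  (forall (a : R) f g, E f -> E g -> psi (a \*o f \+ g) = a * psi f + psi g) ->
  (forall f, E f -> `|psi f| <= M * fnorm E f) ->
  exists w, [/\ L1 I01 w,
    forall h, @Linfty R h -> psi h = \int[leb]_(t in I01) (h t * w t) &
    forall h, @Linfty R h -> \int[leb]_(t in I01) `|h t * w t| <= M * fnorm E h].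
Proof.
move=> M0 lpsi bpsi.
have EI (A : set (lebT R)) : measurable A -> E (\1_A : R -> R) by move=> mA; apply: Linfty_E => //; exact: indic_Linfty.
have [||w wI wE] := @density_of_set_function _ _ _ leb I01 (@mI01 R) (@finI01 R) (fun A => psi (\1_A : R -> R)).
- move=> A B mA mB AI BI AB; rewrite -[psi \1_A]mul1r -lpsi; try exact: EI.
  congr psi; apply/funext => x /=; rewrite mul1r !indicE in_setU.
  have [xA|xA] := boolP (x \in A); have [xB|xB] := boolP (x \in B); rewrite /= ?addr0 ?add0r//.
  have : (A `&` B) x by split; exact: set_mem.
  by rewrite AB.
- move=> e e0; have eM : 0 < e / (M + 1) by rewrite divr_gt0//; lra.
  have [r r0 hr] := cesaro_indic_small hX hne eM.
  exists r => // A mA AI Ar; apply: (le_trans (bpsi _ (EI A mA))).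
  have := hr A mA AI Ar; rewrite /= (_ : Num.norm \o \1_A = (\1_A : R -> R)).
    set n := N _ => hn.
    have : M * n <= M * (e / (M + 1)) by rewrite ler_wpM2l.
    suff : M * (e / (M + 1)) <= e by lra.
    by rewrite mulrA ler_pdivrMr; [nra|lra].
  by apply/funext => x /=; rewrite ger0_norm// indicE.
have L := @bounded_mul_L1.
pose D h := psi h - \int[leb]_(t in I01) (h t * w t).
have D0 (A : set (lebT R)) : measurable A -> A `<=` I01 -> D (\1_A : R -> R) = 0.
  move=> mA AI; rewrite /D wE//; apply/eqP; rewrite subr_eq0; apply/eqP.
  by apply/esym; exact: int_indic_mul.
have DL (a : R) f g : @Linfty R f -> @Linfty R g -> D (a \*o f \+ g) = a * D f + D g.
  move=> bf bg; rewrite /D lpsi; [|exact: Linfty_E..].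
  have [mf [K hK]] := bf; have [mg [K' hK']] := bg.
  have e2 : \int[leb]_(t in I01) ((a \*o f \+ g) t * w t) = \int[leb]_(t in I01) (a * (f t * w t) + g t * w t).
    by apply: eq_Rintegral => x _ /=; rewrite mulrDl mulrA.
  have e3 : \int[leb]_(t in I01) ((a \*o f \+ g) t * w t) =
      a * \int[leb]_(t in I01) (f t * w t) + \int[leb]_(t in I01) (g t * w t).
    exact: etrans e2 (intL a (@mI01 R) (L _ _ _ wI mf hK) (L _ _ _ wI mg hK')).
  by rewrite e3 mulrBr opprD addrACA.
have DZ (a : R) h : @Linfty R h -> D (a \*o h) = a * D h by exact: (@linZ R R (@Linfty R) (Linfty_cst 0) D DL).
have B1 : @Linfty R (cst 1) by exact: Linfty_cst.
pose K := M * fnorm E (cst 1) + \int[leb]_(t in I01) `|w t|.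
have sub01 h : Lmeasurable h -> (forall x, I01 x -> 0 <= h x <= 1) -> @ae01 R (fun x => `|h x| <= 1).
  by move=> mh h01; apply: ae01W => x /h01 /andP[a b]; rewrite ger0_norm.
have bnd k : forall h, Lmeasurable h -> (forall x, I01 x -> 0 <= h x <= 1) -> `|D h| <= K * (1 / 2) ^+ k.
  elim: k => [|k IH] h mh h01; have hl := sub01 h mh h01.
    have bh : @Linfty R h by split => //; exists 1.
    rewrite expr0 mulr1 /D /K; apply: (le_trans (ler_normB _ _)); apply: lerD.
      apply: (le_trans (bpsi _ (Linfty_E hX bh))); rewrite ler_wpM2l//.
      apply: (E_ideal hX (Linfty_E hX B1) mh _).2; move: hl; apply: ae01S => x _ /=.
      by rewrite normr1.
    apply: (le_trans (norm_int_le (@mI01 R) (L _ _ _ wI mh hl))).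
    apply: (int_ae_le (@mI01 R) (integrable_norm (L _ _ _ wI mh hl)) (integrable_norm wI)).
    by apply: ae01S hl => x _ hx; rewrite /= normrM -[leRHS]mul1r ler_wpM2r.
  pose A := I01 `&` [set x | cst (1 / 2) x <= h x].
  have mA : measurable A by apply: measurable_fun_le => //; exact: mI01.
  pose h' := (2 \*o h) \+ ((-1) \*o (\1_A : R -> R)).
  have bA := indic_Linfty mA.
  have bh : @Linfty R h by split => //; exists 1.
  have mh' : Lmeasurable h' by apply: measurable_funD; apply: measurable_funM => //; exact: bA.1.
  have h'01 x : I01 x -> 0 <= h' x <= 1.
    move=> Ix; have /andP[a b] := h01 x Ix; rewrite /h' /= indicE.
    have [/set_mem[_ /= c]|/negP c] := boolP (x \in A); first by apply/andP; split; lra.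
    have {}c : h x < 1 / 2 by rewrite ltNge; apply/negP => c'; apply: c; rewrite inE.
    by rewrite mulr0n mulr0 addr0; apply/andP; split; lra.
  have bh' : @Linfty R h' by split => //; exists 1; exact: sub01.
  have -> : h = (1 / 2) \*o h' \+ (1 / 2) \*o (\1_A : R -> R).
    by apply/funext => x /=; rewrite /h' /=; lra.
  rewrite DL//; last first.
    split; first by apply: measurable_funM => //; exact: bA.1.
    exists 1; apply: ae01W => x _ /=; rewrite indicE.
    by case: (x \in A); rewrite ?mulr1 ?mulr0 ?normr0//= ger0_norm; lra.
  rewrite DZ// (D0 A mA); last by move=> x [].
  rewrite mulr0 addr0 normrM (ger0_norm (_ : 0 <= 1 / 2)); last lra.
  have := IH h' mh' h'01; rewrite exprS; lra.
have D01 h : Lmeasurable h -> (forall x, I01 x -> 0 <= h x <= 1) -> D h = 0.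
  move=> mh h01; apply/eqP; rewrite -normr_eq0 eq_le normr_ge0 andbT; apply/ler_addgt0Pr => e e0.
  have : (geometric K (1 / 2 : R)) @ \oo --> (0 : R) by apply: cvg_geometric; rewrite ger0_norm; lra.
  move=> /cvgrPdist_lt /(_ _ e0)[k _ /(_ k (leqnn k))] /=; rewrite sub0r normrN => hk.
  rewrite add0r; apply: (le_trans (bnd k h mh h01)); apply: ltW; apply: le_lt_trans hk; exact: ler_norm.
have Dall h : @Linfty R h -> D h = 0.
  move=> bh; have [mh [K0 hK0]] := bh.
  pose K1 := `|K0| + 1; have K10 : 0 < K1 by rewrite /K1; have := normr_ge0 K0; lra.
  (* The bound on [h] holds only almost everywhere. The clamp takes values in [[0, 1]] everywhere,
     and the affine image [h2] of [h1] equals [h] off a null set, which neither [psi] nor the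
     integral sees. *)
  pose h1 x := Num.max 0 (Num.min 1 ((h x + K1) / (2 * K1))).
  have mh1 : Lmeasurable h1 by exact: meas_clamp.
  have h101 x : I01 x -> 0 <= h1 x <= 1.
    by move=> _; rewrite /h1 le_max lexx /= ge_max ler01 ge_min lexx.
  have bh1 : @Linfty R h1 by split => //; exists 1; exact: sub01.
  have Z1 := Linfty_L (- K1) B1 bh1.
  pose h2 := (2 * K1) \*o h1 \+ (- K1) \*o cst 1.
  have bK : @Linfty R ((- K1) \*o cst 1).
    by split; [exact: measurable_funM|exists K1; apply: ae01W => x _ /=; rewrite mulr1 normrN gtr0_norm].
  have Dh2 : D h2 = 0.
    rewrite /h2 DL// DZ// (D01 h1)// (D01 _ B1.1); last by move=> x _ /=; rewrite ler01 lexx.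
    by rewrite !mulr0 addr0.
  have bh2 : @Linfty R h2 by exact: Linfty_L.
  have hh2 : @ae01 R (fun x => h2 x = h x).
    move: hK0; apply: (@ae01S R) => x _ hx; have := le_trans hx (ler_norm K0).
    rewrite ler_norml => /andP[a b]; rewrite /h2 /h1 /=.
    have a' : 0 <= (h x + K1) / (2 * K1) by apply: divr_ge0; rewrite /K1; lra.
    have b' : (h x + K1) / (2 * K1) <= 1 by rewrite ler_pdivrMr /K1; lra.
    rewrite (min_idPr b') (max_idPr a') mulrC divfK; first lra.
    by rewrite gt_eqF//; lra.
  have : D ((-1) \*o h2 \+ h) = 0.
    have bd := Linfty_L (-1) bh2 bh.
    have z : @ae01 R (fun x => ((-1) \*o h2 \+ h) x = 0).
      by move: hh2; apply: (@ae01S R) => x _ /= ->; rewrite mulN1r addNr.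
    rewrite /D.
    have -> : psi ((-1) \*o h2 \+ h) = 0.
      apply/eqP; rewrite -normr_eq0 eq_le normr_ge0 andbT.
      apply: (le_trans (bpsi _ (Linfty_E hX bd))).
      have [_ le] := E_ideal hX (E_zero hX) bd.1 (g := (-1) \*o h2 \+ h) (ae01S (fun x _ (e : _ = 0) => (eq_ind_r (fun y => `|y| <= `|cst 0 x|) (lexx _) e)) z).
      have [_ z0] := E_Z hX 0 (E_zero hX); rewrite normr0 mul0r in z0.
      rewrite (_ : 0 \*o cst 0 = cst 0) in z0; last by apply/funext => x /=; rewrite mul0r.
      have := ler_wpM2l M0 (le_trans le z0); by rewrite mulr0.
    rewrite sub0r; apply/eqP; rewrite oppr_eq0; apply/eqP.
    rewrite /Rintegral (ae_eq_integral (cst 0)) ?integral0//.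
    - exact: mI01.
    - by apply/measurable_EFinP; apply: measurable_funM; [exact: bd.1|exact: L1_meas wI].
    - by apply: ae01S z => x _ /= ->; rewrite mul0r.
  by rewrite DL// Dh2; lra.
exists w; split => // h bh; first by apply/eqP; rewrite -subr_eq0; apply/eqP; exact: (Dall h bh).
have [mh [K0 hK0]] := bh.
have hw := L _ _ _ wI mh hK0.
pose P := I01 `&` [set t | cst 0 t <= h t * w t].
have mP : measurable P := le_set_meas (f := cst 0) (@mI01 R) (measurable_cst _) (L1_meas hw).
(* The sign of [h w]: [h s] has the modulus of [h], and [psi] maps it to the integral of [|h w|]. *)
pose s : R -> R := 2 \*o (\1_P : R -> R) \+ cst (-1).
have ms : Lmeasurable s := (Linfty_L 2 (indic_Linfty mP) (Linfty_cst (-1))).1.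
have s1 x : `|s x| = 1.
  rewrite /s /= indicE; case: (x \in P); first by rewrite mulr1n (_ : 2 * 1 + -1 = 1) ?normr1//; lra.
  by rewrite mulr0n mulr0 add0r normrN1.
have mhs : Lmeasurable (fun x => h x * s x) by exact: measurable_funM.
have hhs : @ae01 R (fun x => `|h x * s x| <= `|h x|).
  by apply: ae01W => x _; rewrite normrM s1 mulr1.
have bhs : @Linfty R (fun x => h x * s x) by exact: Linfty_ideal bh mhs hhs.
have -> : \int[leb]_(t in I01) `|h t * w t| = psi (fun x => h x * s x).
  have /eqP := Dall _ bhs; rewrite subr_eq0 => /eqP ->.
  apply: eq_Rintegral => x Ix; rewrite /s /= indicE.
  have [/set_mem[_ /= c]|/negP c] := boolP (x \in P).
    by rewrite ger0_norm//; lra.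
  have {}c : h x * w x < 0.
    by rewrite ltNge; apply/negP => c'; apply: c; rewrite inE; split => //; exact: set_mem.
  by rewrite ltr0_norm// mulr0n; lra.
apply: (le_trans (ler_norm _)); apply: (le_trans (bpsi _ (Linfty_E hX bhs))).
rewrite ler_wpM2l//; exact: (E_ideal hX (Linfty_E hX bh) mhs hhs).2.
Qed.

Definition represents (phi : (R -> R) -> R) w := [/\ L1 I01 w,
  forall h, @Linfty R h -> phi (C h) = \int[leb]_(t in I01) (h t * w t) &
  forall A : set (lebT R), measurable A -> scalar_measure phi m A = \int[leb]_(t in A `&` I01) w t].

Lemma dual_density phi (M : R) : dual_space X phi -> 0 <= M -> (forall f, X f -> `|phi f| <= M * N f) ->
  exists2 w, represents phi w &
    forall h, @Linfty R h -> \int[leb]_(t in I01) `|h t * w t| <= M * fnorm E h.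
Proof.
move=> dphi M0 bphi; have [l b] := dual_cesaro hX dphi bphi M0.
have [w [wI wE wM]] := linear_density M0 l b.
exists w => //; split => // A mA; rewrite /scalar_measure /cesaro_measure wE; last exact: indic_Linfty.
rewrite setIC Rintegral_mkcondr; apply: eq_Rintegral => x _; rewrite patchE indicE.
by case: (x \in A); rewrite ?mul1r ?mul0r.
Qed.

(** What is needed to find [f] in [L^1(m)] with [C (f 1_A)] as its integral over [A]. Bounded
    functions have the property from the outset, all of [[C, X]] only once order continuity is
    known, and the consequences are drawn here for both cases. *)
Definition scalarly_integrable f := E f /\ forall phi (M : R), dual_space X phi -> 0 <= M ->
  (forall g, X g -> `|phi g| <= M * N g) ->
  exists w, [/\ represents phi w, L1 I01 (fun t => f t * w t),
    \int[leb]_(t in I01) `|f t * w t| <= M * fnorm E f &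
    forall A : set (lebT R), measurable A -> A `<=` I01 ->
      phi (C (f \* \1_A)) = \int[leb]_(t in A) (f t * w t)].

Lemma E_mul f (s : R -> R) : E f -> Lmeasurable s -> @ae01 R (fun x => `|s x| <= 1) ->
  E (f \* s) /\ fnorm E (f \* s) <= fnorm E f.
Proof.
move=> Ef ms s1; apply: E_ideal => //.
  by apply: measurable_funM => //; exact: (E_locint Ef).1.
by move: s1; apply: (@ae01S R) => x _ h /=; rewrite normrM -[leRHS]mulr1 ler_wpM2l.
Qed.

Lemma E_mul_indic f (A : set (lebT R)) : measurable A -> E f -> E (f \* \1_A).
Proof.
move=> mA Ef; apply: (E_mul Ef (indic_meas mA) _).1; apply: ae01W => x _; rewrite indicE.
by case: (x \in A); rewrite ?normr0 ?normr1.
Qed.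

Lemma dual_bound phi : dual_space X phi -> exists2 M : R, 0 <= M & forall g, X g -> `|phi g| <= M * N g.
Proof.
move=> [_ [M hM]]; exists `|M| => // g Xg; apply: (le_trans (hM g Xg)).
by rewrite ler_wpM2r ?ler_norm//; exact: Nge0.
Qed.

Lemma dual0 : dual_ball X (fun=> 0).
Proof.
split; first split.
- by move=> a f g _ _; rewrite mulr0 addr0.
- by exists 0 => f _; rewrite normr0 mul0r.
- by move=> f Xf; rewrite normr0; exact: Nge0.
Qed.

(** Every functional maps [C (f 1_A)] to the scalar integral over [A], so this function is a vector
    integral. The operator returns an arbitrary representative, whence its identification with [C f]
    up to norm zero, through [dual_separates], and under every functional. *)
Lemma scalarly_integrable_vm f : scalarly_integrable f ->
  [/\ vm_integrable X m f, fnorm (vm_L1 X m) f <= fnorm E f,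
    X (integration_operator X m f),
    N (integration_operator X m f \- C f) = 0 &
    forall phi, dual_space X phi -> phi (integration_operator X m f) = phi (C f)].
Proof.
move=> [Ef hf]; have mf := (E_locint Ef).1.
have absE phi : dual_space X phi -> forall M : R, 0 <= M -> (forall g, X g -> `|phi g| <= M * N g) ->
    (abs_integral (scalar_measure phi m) f <= (M * fnorm E f)%:E)%E.
  move=> dphi M M0 bphi; have [w [[wI wC wm] fw fM _]] := hf phi M dphi M0 bphi.
  rewrite (abs_integral_density wI wm mf) -(fineK (integrable_fin_num (@mI01 R) (integrable_norm fw))).
  by rewrite lee_fin.
have vmI (A : set (lebT R)) : measurable A -> A `<=` I01 -> is_vm_integral X m A f (C (f \* \1_A)).
  move=> mA AI; split; first exact: (E_C hX (E_mul_indic mA Ef)).1.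
  move=> phi dphi; have [M M0 bphi] := dual_bound dphi.
  have [w [[wI wC wm] fw fM fA]] := hf phi M dphi M0 bphi.
  rewrite (signed_integral_density wI wm mA AI mf) ?fA//.
  exact: L1S (@mI01 R) mA AI fw.
have vf : vm_integrable X m f.
  split => //.
  - move=> phi dphi; have [M M0 bphi] := dual_bound dphi.
    exact: le_lt_trans (absE phi dphi M M0 bphi) (ltry _).
  - by move=> A mA AI; exists (C (f \* \1_A)); exact: vmI.
have Iex : exists g, is_vm_integral X m I01 f g by exists (C (f \* \1_I01)); apply: vmI => //; exact: mI01.
have [XI phiI] : is_vm_integral X m I01 f (integration_operator X m f) := getPex Iex.
have phiC phi : dual_space X phi -> phi (integration_operator X m f) = phi (C f).
  move=> dphi; rewrite phiI//; have [XI' phiI'] := vmI I01 (@mI01 R) (fun _ k => k).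
  rewrite -phiI'//; apply: (dual_ae hX dphi XI' (E_C hX Ef).1).
  apply: ae01_lt1 => x hx; have x1 : x <= 1 by case/andP: hx => _ /ltW.
  congr (_ * _); apply: eq_Rintegral => t /set_mem tx; rewrite /= indicE mem_set ?mulr1//.
  exact: sub0x tx.
have XC := (E_C hX Ef).1.
split => //.
- have fE : 0 <= fnorm E f by exact: nE_ge0.
  suff : (ereal_sup [set abs_integral (scalar_measure phi m) f | phi in dual_ball X] <= (fnorm E f)%:E)%E.
    by rewrite /fnorm /=; case: (ereal_sup _) => //= r; rewrite lee_fin.
  apply: ge_ereal_sup => _ [phi [dphi bphi] <-]; rewrite -[fnorm E f]mul1r.
  by apply: absE => // g Xg; rewrite mul1r; exact: bphi.
- apply: (dual_separates hB); first exact: XB.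
  move=> phi dphi; have := dphi.1 (-1) _ _ XC XI; rewrite phiC// mulN1r addNr => h.
  rewrite -[RHS]h; congr phi; apply/funext => x /=; by rewrite mulN1r addrC.
Qed.

Lemma vm_norm_ge0 f : scalarly_integrable f -> 0 <= fnorm (vm_L1 X m) f.
Proof.
move=> [Ef hf]; have mf := (E_locint Ef).1; apply: fine_ge0.
have z := dual0; have [|w [[wI wC wm] _ _ _]] := hf _ 0 z.1 (lexx _).
  by move=> g _; rewrite normr0 mul0r.
apply: (@le_trans _ _ (abs_integral (scalar_measure (fun=> 0) m) f)).
  by rewrite (abs_integral_density wI wm mf); apply: integral_ge0 => x _; rewrite lee_fin.
by apply: ereal_sup_ubound; exists (fun=> 0).
Qed.

Lemma Linfty_scalarly_integrable f : @Linfty R f -> scalarly_integrable f.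
Proof.
move=> bf; split; first exact: Linfty_E.
move=> phi M dphi M0 bphi; have [w rw wM] := dual_density dphi M0 bphi.
have [wI wC wm] := rw; have [mf [K hK]] := bf.
exists w; split => //; [exact: bounded_mul_L1 wI mf hK|exact: wM|].
move=> A mA AI; rewrite wC; last first.
  apply: (Linfty_ideal bf); first by apply: measurable_funM => //; exact: indic_meas.
  apply: ae01W => x _ /=; rewrite normrM -[leRHS]mulr1 ler_wpM2l// indicE.
  by case: (x \in A); rewrite ?normr0 ?normr1.
have <- : \int[leb]_(t in I01) (\1_A t * (f t * w t)) = \int[leb]_(t in A) (f t * w t) by exact: int_indic_mul.
by apply: eq_Rintegral => t _ /=; rewrite mulrAC mulrC.
Qed.

End representation.

(** * Monotone sequences *)

Section monotone.
Context d (T : measurableType d) (R : realType) (mu : {measure set T -> \bar R}).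

Lemma monotone_int_le (D : set T) (g : nat -> T -> R) (f : T -> R) (M : \bar R) :
  measurable D -> (forall n, measurable_fun D (g n)) -> (forall n x, D x -> 0 <= g n x) ->
  (forall x, D x -> {homo (fun n => g n x) : m n / (m <= n)%N >-> m <= n}) ->
  (forall x, D x -> (fun n => g n x) @ \oo --> f x) ->
  (forall n, (\int[mu]_(x in D) (g n x)%:E <= M)%E) ->
  (\int[mu]_(x in D) (f x)%:E <= M)%E.
Proof.
move=> mD mg g0 ndg gf gM.
have mgE n : measurable_fun D (fun x => (g n x)%:E) by exact/measurable_EFinP.
have g0E n x : D x -> (0 <= (g n x)%:E)%E by move=> Dx; rewrite lee_fin g0.
have ndgE x : D x -> nondecreasing_seq (fun n => (g n x)%:E).
  by move=> Dx m n mn; rewrite lee_fin; exact: ndg.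
have H := @cvg_monotone_convergence _ _ _ mu D mD _ mgE g0E ndgE.
rewrite (eq_integral (fun x => limn (fun n => (g n x)%:E))); last first.
  move=> x /set_mem Dx; apply/esym/cvg_lim => //.
  by apply: cvg_EFin; [exact: nearW|exact: gf].
rewrite -(cvg_lim _ H)//; apply: lime_le; first by apply/cvg_ex; eexists; exact: H.
exact: nearW.
Qed.

End monotone.

(** * The weak topology *)

Section weak_topology.
Context (R : realType) (X : fspace R).

Lemma weak_eval_continuous (phi : set_type (dual_space X)) :
  continuous (fun x : weak_space X => set_val phi (set_val x)).
Proof.
move=> x; have c1 : {for x, continuous (@dual_eval R X : weak_space X -> _)} := @initial_continuous _ _ (@dual_eval R X) x.
have c2 := @proj_continuous _ (fun _ : set_type (dual_space X) => R) phi (dual_eval x).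
exact: (continuous_comp c1 c2).
Qed.

(** Compactness gives a cluster point, tested here against one functional at a time; no weakly
    convergent subsequence is extracted. *)
Lemma weak_cluster (P : set (weak_space X)) (u : nat -> weak_space X) : precompact P ->
  (forall n, P (u n)) -> exists g : weak_space X, forall phi, dual_space X phi ->
    forall (e : R) (k : nat), 0 < e -> exists2 n, (k <= n)%N & `|phi (set_val g) - phi (set_val (u n))| < e.
Proof.
move=> [K PK [cK _]] Pu.
have [|g [_ cg]] := cK (u @ \oo) _.
  by exists 0%N => // n _; apply: PK; exact: Pu.
exists g => phi dphi e k e0; pose phi' : set_type (dual_space X) := SigSub (mem_set dphi).
have /cvgrPdist_lt /(_ e e0) U := @weak_eval_continuous phi' g.
have [|y [[n /= kn <-] hy]] := cg (u @` [set n | (k <= n)%N]) _ _ U.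
  by exists k => // n /= kn; exists n.
by exists n.
Qed.

(** Open sets are preimages under [dual_eval], so they cannot distinguish functions on which all
    functionals agree. This compensates for the choice of representatives. *)
Lemma weak_closed_sat (K : set (weak_space X)) (p q : weak_space X) : closed K ->
  (forall phi, dual_space X phi -> phi (set_val p) = phi (set_val q)) -> K p -> K q.
Proof.
move=> cK pq Kp; apply: contrapT => nKq.
have [U oU UK] : open (~` K) by exact: closed_openC.
have e : dual_eval p = dual_eval q.
  by apply/funext => phi; apply: pq; exact: set_mem (valP phi).
have : (~` K) p; last by [].
by rewrite -UK /= e; have : (~` K) q by []; rewrite -UK.
Qed.

End weak_topology.

(** * Norm Cauchy sequences from either hypothesis *)

Section levi.
Context (R : realType) (X : fspace R).
Hypothesis hX : ri_space X.
Hypothesis hne : fcarrier X <> Linfty.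
Local Notation leb := (@completed_lebesgue_measure R).
Local Notation I01 := (`[0, 1]%classic : set (lebT R)).
Local Notation L1 A f := (integrable leb (A : set (lebT R)) (EFin \o (f : lebT R -> R))).
Local Notation N := (fnorm X).
Local Notation E := (cesaro_space X).
Local Notation nE := (fnorm (cesaro_space X)).
Local Notation C := (@cesaro_op R).
Local Notation m := (@cesaro_measure R).
Implicit Types f g h w : R -> R.
Let hB := ri_bfs hX.

Lemma dualZ phi (a : R) f : dual_space X phi -> X f -> phi (a \*o f) = a * phi f.
Proof. by move=> dphi; exact: (@linZ _ _ (fcarrier X) (bfs_zero hB) phi dphi.1). Qed.

Lemma dualB phi f g : dual_space X phi -> X f -> X g -> phi (f \- g) = phi f - phi g.
Proof.
move=> dphi Xf Xg; have := dphi.1 (-1) g f Xg Xf.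
rewrite (_ : (-1 \*o g) \+ f = f \- g); last by apply/funext => x /=; rewrite mulN1r addrC.
lra.
Qed.

(* An increasing sequence with a weak cluster point converges in norm to it: positive functionals
   bounded away from zero on [g - u n], or on [u k - g], would contradict clustering. *)
Lemma incr_weak_cluster (u : nat -> R -> R) g : (forall n, X (u n)) -> X g ->
  (forall k n, (k <= n)%N -> @ae01 R (fun x => u k x <= u n x)) ->
  (forall phi, dual_space X phi -> forall (e : R) (k : nat), 0 < e ->
     exists2 n, (k <= n)%N & `|phi g - phi (u n)| < e) ->
  norm_cvg X u g.
Proof.
move=> Xu Xg du cl.
have step1 k : N (u k \- g)^\+ = 0.
  have Xk := XB hB (Xu k) Xg; have Xp := (X_pos hB Xk).1.
  apply/eqP; rewrite eq_le (Nge0 hB Xp) andbT leNgt; apply/negP => d0.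
  have [||phi [[dphi _] pos hphi]] := @positive_functional _ _ hB (fun=> u k \- g) (N (u k \- g)^\+) (fun=> Xk).
  - by move=> *; apply: ae01W.
  - by [].
  have [n kn hn] := cl phi dphi _ k d0.
  have := hphi 0%N; rewrite (dualB dphi (Xu k) Xg) => h1.
  have := pos _ (XB hB (Xu n) (Xu k)); rewrite (dualB dphi (Xu n) (Xu k)) => h2.
  have {}h2 : 0 <= phi (u n) - phi (u k).
    by apply: h2; apply: ae01S (du k n kn) => x _ /=; rewrite subr_ge0.
  move: hn; rewrite ltNge => /negP; apply; apply: (le_trans h1).
  rewrite -normrN opprB; apply: le_trans (ler_norm _).
  by rewrite lerD2r -subr_ge0.
(* A single functional has to be at least [e] on all [g - u n] at once; this is the reason why
   [positive_functional] is stated for decreasing sequences. *)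
have step2 (e : R) : 0 < e -> exists n, N (g \- u n)^\+ < e.
  move=> e0; apply: contrapT => /forallNP H.
  have Xk n := XB hB Xg (Xu n).
  have [||phi [[dphi _] pos hphi]] := @positive_functional _ _ hB (fun n => g \- u n) e Xk.
  - by move=> k n kn; apply: ae01S (du k n kn) => x _ /=; lra.
  - by move=> n; rewrite leNgt; apply/negP; exact: H.
  have [n _ hn] := cl phi dphi e 0%N e0.
  have := hphi n; rewrite (dualB dphi Xg (Xu n)) => h1.
  have := ler_norm (phi g - phi (u n)); lra.
apply/cvgrPdist_lt => e e0; have [k hk] := step2 e e0.
exists k => // n /= kn; rewrite sub0r normrN ger0_norm; last exact/(Nge0 hB)/XB.
apply: le_lt_trans hk.
have X1 := (X_pos hB (XB hB Xg (Xu k))).1.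
have X2 := (X_pos hB (XB hB (Xu n) Xg)).1.
rewrite -[leRHS]addr0 -(step1 n).
apply: (le_trans _ (ND hB X1 X2)); apply: X_le => //; [exact: XD|exact: XB|].
apply: ae01S (du k n kn) => x _ h /=; rewrite !funrposE /=.
have h1 : g x - u k x <= Num.max (g x - u k x) 0 by rewrite le_max lexx.
have h2 : u n x - g x <= Num.max (u n x - g x) 0 by rewrite le_max lexx.
have h3 : 0 <= Num.max (g x - u k x) 0 by rewrite le_max lexx orbT.
have h4 : 0 <= Num.max (u n x - g x) 0 by rewrite le_max lexx orbT.
rewrite [leRHS]ger0_norm ?addr_ge0// ler_norml; apply/andP; split; lra.
Qed.

Lemma cvg_cauchy (u : nat -> R -> R) g : (forall n, X (u n)) -> X g -> norm_cvg X u g -> norm_cauchy X u.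
Proof.
move=> Xu Xg ug e e0; have e2 : 0 < e / 2 by lra.
have /cvgrPdist_lt /(_ _ e2)[k _ hk] := ug.
exists k => p n kp kn; have := hk p kp; have := hk n kn.
rewrite !sub0r !normrN !ger0_norm; try exact/(Nge0 hB)/XB.
have := NB hB (Xu p) Xg (Xu n); rewrite (X_norm_sub hB Xg (Xu n)); lra.
Qed.

(** The common consequence of the two compactness hypotheses. It concerns bounded functions because
    at this stage [I_m] is identified with [C] only for them. *)
Definition monotone_cauchy := forall f : nat -> R -> R, (forall n, @Linfty R (f n)) ->
  (forall n x, 0 <= f n x) -> (forall k n x, (k <= n)%N -> f k x <= f n x) ->
  (exists M, forall n, nE (f n) <= M) -> norm_cauchy X (fun n => C (f n)).

Lemma pos_norm f : (forall x, 0 <= f x) -> Num.norm \o f = f.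
Proof. by move=> f0; apply/funext => x /=; rewrite ger0_norm. Qed.

Lemma C_le f g : E f -> E g -> (forall x, f x <= g x) -> @ae01 R (fun x => C f x <= C g x).
Proof.
move=> Ef Eg h; apply: ae01_lt1 => x hx; apply: cesaro_le => //; [exact: E_locint Ef|exact: E_locint Eg|].
exact: ae01W.
Qed.

(** Division by a positive norm bound [M] moves the [f n] into the unit ball of [L^1(m)].
    Functionals do not distinguish their images under [I_m] from [C f_n / M], so a weak cluster
    point of the images, multiplied by [M], serves for [C f_n]. *)
Lemma weakly_compact_monotone_cauchy :
  weakly_compact (vm_L1 X m) X (integration_operator X m) -> monotone_cauchy.
Proof.
move=> [_ pc] f bf f0 ndf [M0 hM0].
pose M := `|M0| + 1; have M1 : 0 < M by have := normr_ge0 M0; rewrite /M; lra.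
have hM n : nE (f n) <= M by apply: (le_trans (hM0 n)); rewrite /M; have := ler_norm M0; lra.
have Ef n := Linfty_E hX (bf n).
have XC n := (E_C hX (Ef n)).1.
have bg n : @Linfty R (M^-1 \*o f n).
  have [mf [K hK]] := bf n; split; first exact: measurable_funM.
  by exists (M^-1 * K); move: hK; apply: (@ae01S R) => x _ /= h; rewrite normrM gtr0_norm ?invr_gt0// ler_pM2l ?invr_gt0.
have sg n := scalarly_integrable_vm hX (Linfty_scalarly_integrable hX hne (bg n)).
have XI n : X (integration_operator X m (M^-1 \*o f n)) by have [] := sg n.
pose u n : weak_space X := SigSub (mem_set (XI n)).
have [|g hg] := weak_cluster pc (u := u).
  move=> n; exists (M^-1 \*o f n) => //; have [vI nI _ _ _] := sg n; split => //.
  apply: (le_trans nI); have [_ le] := E_Z hX M^-1 (Ef n); apply: (le_trans le).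
  by rewrite gtr0_norm ?invr_gt0// mulrC ler_pdivrMr// mul1r.
have Xg : X (set_val g) by exact: set_mem (valP g).
apply: (@cvg_cauchy _ (M \*o set_val g)) => //; first exact: XZ.
apply: incr_weak_cluster => //; first exact: XZ.
  by move=> k n kn; apply: C_le => // x; exact: ndf.
move=> phi dphi e k e0; have eM : 0 < e / M by rewrite divr_gt0.
have [n kn h] := hg phi dphi _ k eM; exists n => //.
have [_ _ _ _ /(_ phi dphi) Iphi] := sg n.
rewrite dualZ//.
have -> : phi (C (f n)) = M * phi (set_val (u n)).
  rewrite /= [phi (set_val _)]Iphi.
  have [M' M'0 bM'] := dual_bound hX dphi.
  have [lC _] := dual_cesaro hX dphi bM' M'0.
  by rewrite (linZ (phi := fun h => phi (C h)) (E_zero hX) lC)// mulrA mulfV ?mul1r// gt_eqF.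
by rewrite -mulrBr normrM gtr0_norm// mulrC -ltr_pdivlMr.
Qed.

(** With [s j] the sign of [theta (dd j)], the hypothesis bounds the sums of [|theta (dd j)|], so
    the terms tend to 0: a weakly unconditionally Cauchy series has weakly null terms. *)
Lemma dual_sum_bound (V : set (R -> R)) (theta : (R -> R) -> R) (dd : nat -> R -> R) (M : R) :
  V (cst 0) -> (forall (a : R) f g, V f -> V g -> V (a \*o f \+ g)) -> theta (cst 0) = 0 ->
  (forall (a : R) f g, V f -> V g -> theta (a \*o f \+ g) = a * theta f + theta g) ->
  (forall j, V (dd j)) ->
  (forall (s : nat -> R) n, (forall j, `|s j| <= 1) ->
     `|theta (fun x => \sum_(j < n) s j * dd j x)| <= M) ->
  theta \o dd @ \oo --> (0 : R).
Proof.
move=> V0 VL t0 tL Vd hM.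
pose s j : R := if 0 <= theta (dd j) then 1 else -1.
have s1 j : `|s j| <= 1 by rewrite /s; case: ifP; rewrite ?normrN1 ?normr1.
have VS n : V (fun x => \sum_(j < n) s j * dd j x) /\
    theta (fun x => \sum_(j < n) s j * dd j x) = \sum_(j < n) `|theta (dd j)|.
  elim: n => [|n [IH1 IH2]].
    have e : (fun x => \sum_(j < 0) s j * dd j x) = cst 0 by apply/funext => x; rewrite big_ord0.
    by rewrite e big_ord0.
  have e : (fun x => \sum_(j < n.+1) s j * dd j x) = s n \*o dd n \+ (fun x => \sum_(j < n) s j * dd j x).
    by apply/funext => x /=; rewrite big_ord_recr /= addrC.
  rewrite e; split; first exact: VL.
  rewrite tL// IH2 big_ord_recr /= addrC; congr (_ + _).
  rewrite /s; case: ifPn => h; first by rewrite mul1r ger0_norm.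
  by rewrite mulN1r ltr0_norm// ltNge.
have cvgS : cvgn (series (fun j => `|theta (dd j)|)).
  apply: nondecreasing_is_cvgn; first exact: nondecreasing_series.
  exists M => _ [n _ <-]; rewrite /series /= big_mkord.
  by have [_ <-] := VS n; apply: (le_trans (ler_norm _)); exact: hM.
exact/(norm_cvg0P (theta \o dd))/(cvg_series_cvg_0 cvgS).
Qed.

Lemma Linfty_C_sub f g : @Linfty R f -> @Linfty R g -> @ae01 R (fun x => C (f \- g) x = C f x - C g x).
Proof.
move=> bf bg; apply: ae01_lt1 => x hx.
have := cesaroL (-1) (locint_bounded bg) (locint_bounded bf) hx.
rewrite (_ : -1 \*o g \+ f = f \- g); first by move=> ->; rewrite mulN1r addrC.
by apply/funext => y /=; rewrite mulN1r addrC.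
Qed.

Lemma Linfty_B f g : @Linfty R f -> @Linfty R g -> @Linfty R (f \- g).
Proof.
move=> bf bg; have := Linfty_L (-1) bg bf.
by rewrite (_ : -1 \*o g \+ f = f \- g)//; apply/funext => y /=; rewrite mulN1r addrC.
Qed.

Lemma completely_continuous_monotone_cauchy :
  completely_continuous (vm_L1 X m) X (integration_operator X m) -> monotone_cauchy.
Proof.
set I_ := integration_operator X m.
move=> [_ cc] f bf f0 ndf [M hM]; apply: contrapT => nc.
have Ef n := Linfty_E hX (bf n).
have XC n := (E_C hX (Ef n)).1.
have [e e0 H] : exists2 e : R, 0 < e & forall k, exists2 n, (k <= n)%N & e <= N (C (f n) \- C (f k)).
  apply: contrapT => H; apply: nc => e e0; have e2 : 0 < e / 2 by lra.
  apply: contrapT => /forallNP H'; apply: H; exists (e / 2) => // k.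
  apply: contrapT => H2; apply: (H' k) => p n kp kn.
  have A q : (k <= q)%N -> N (C (f q) \- C (f k)) < e / 2.
    by move=> kq; rewrite ltNge; apply/negP => h; apply: H2; exists q.
  have := A p kp; have := A n kn.
  by have := NB hB (XC p) (XC k) (XC n); rewrite (X_norm_sub hB (XC k) (XC n)); lra.
have /choice[nxt Hn] : forall k, exists n, (k <= n)%N /\ e <= N (C (f n) \- C (f k)).
  by move=> k; have [n kn hn] := H k; exists n.
pose b j := iter j nxt 0%N.
pose dd j := f (b j.+1) \- f (b j).
have bb j : (b j <= b j.+1)%N by rewrite /b iterS; have [] := Hn (iter j nxt 0%N).
have dd0 j x : 0 <= dd j x by rewrite /dd /= subr_ge0 ndf.
have bd j : @Linfty R (dd j) by exact: Linfty_B.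
have B0 : @Linfty R (cst 0) by exact: Linfty_cst.
(* Complete continuity provides some norm limit [G] of the images. The odd terms force [G] to have
   norm zero, so the images of the increments tend to 0, against [N (C (dd j)) >= e]. *)
pose z n := if odd n then cst 0 else dd n./2.
have bz n : @Linfty R (z n) by rewrite /z; case: ifP.
have vm h : @Linfty R h -> _ := fun bh => scalarly_integrable_vm hX (Linfty_scalarly_integrable hX hne bh).
have vmI h : @Linfty R h -> vm_L1 X m h by move=> /vm[].
have [|G XG cvG] := cc z (cst 0) (fun n => vmI _ (bz n)) (vmI _ B0).
  move=> theta [tL [K hK]].
  have t0 : theta (cst 0) = 0 := lin0 (vmI _ B0) tL.
  have td : theta \o dd @ \oo --> (0 : R).
    apply: (@dual_sum_bound (@Linfty R) theta dd (`|K| * M)) => //.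
    - by move=> a h k bh bk; exact: Linfty_L.
    - by move=> a h k bh bk; apply: tL; exact: vmI.
    move=> s n s1; pose S x := \sum_(j < n) s j * dd j x.
    (* The increments are nonnegative and telescope, so every signed sum is dominated by [f (b n)],
       whose norm is at most [M]. *)
    have SE x : `|S x| <= `|f (b n) x|.
      rewrite (ger0_norm (f0 _ _)); apply: (@le_trans _ _ (\sum_(j < n) dd j x)).
        apply: (le_trans (ler_norm_sum _ _ _)); apply: ler_sum => j _.
        by rewrite normrM (ger0_norm (dd0 _ _)) ler_piMl.
      suff -> : \sum_(j < n) dd j x = f (b n) x - f (b 0%N) x by have := f0 (b 0%N) x; lra.
      elim: n {S} => [|n IH]; first by rewrite big_ord0 subrr.
      by rewrite big_ord_recr /= IH /dd /=; lra.
    have mS : Lmeasurable S.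
      by apply: measurable_sum => j; apply: measurable_funM => //; exact: (bd j).1.
    have bS : @Linfty R S by apply: (Linfty_ideal (bf (b n)) mS); exact: ae01W.
    have [vS nS _ _ _] := vm _ bS.
    have [_ leS] := E_ideal hX (Ef (b n)) mS (ae01W (fun x _ => SE x)).
    apply: (le_trans (hK _ vS)); apply: (@le_trans _ _ (`|K| * nE S)).
      apply: (@le_trans _ _ (`|K| * fnorm (vm_L1 X m) S)); last by rewrite ler_wpM2l.
      by rewrite ler_wpM2r ?ler_norm//; exact/(vm_norm_ge0 hX)/Linfty_scalarly_integrable.
    by rewrite ler_wpM2l//; exact: le_trans leS (hM _).
  rewrite t0; apply/cvgrPdist_lt => r r0; have /cvgrPdist_lt /(_ r r0)[k _ hk] := td.
  exists k.*2 => // n /= kn; rewrite /z; case: ifP => _; first by rewrite t0 subr0 normr0.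
  by apply: hk => /=; rewrite -[k]doubleK; exact: half_leq.
have XI h : @Linfty R h -> X (I_ h) by move=> /vm[].
have NI h : @Linfty R h -> N (I_ h \- C h) = 0 by move=> /vm[].
have XC0 : C (cst 0) = cst 0 by apply/funext => x; exact: cesaro0.
have e3 : 0 < e / 3 by lra.
have /cvgrPdist_lt /(_ _ e3)[k _ hk] := cvG.
have := hk k.*2; have := hk k.*2.+1.
rewrite /z /= odd_double doubleK !sub0r !normrN.
rewrite (ger0_norm (Nge0 hB (XB hB (XI _ (bd k)) XG))) (ger0_norm (Nge0 hB (XB hB (XI _ B0) XG))).
rewrite -addnn leq_addr => /(_ (leq_trans (leq_addr _ _) (leqnSn _))) h1 /(_ isT) h2.
have [_ hek] := Hn (b k); move: hek; rewrite leNgt => /negP; apply.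
have XCd : X (C (dd k)) by exact: (E_C hX (Linfty_E hX (bd k))).1.
have X1 := XI _ (bd k); have X0 := XI _ B0.
have -> : N (C (f (nxt (b k))) \- C (f (b k))) = N (C (dd k)).
  apply: X_ae_eq => //; first by apply: XB.
  by have := Linfty_C_sub (bf (b k.+1)) (bf (b k)); apply: ae01S => x _ ->.
have a1 : N (C (dd k)) <= N (C (dd k) \- I_ (dd k)) + N (I_ (dd k)).
  apply: (le_trans _ (ND hB (XB hB XCd X1) X1)); rewrite (_ : (_ \- _) \+ _ = C (dd k))//.
  by apply/funext => x /=; rewrite subrK.
have a2 : N (I_ (dd k)) <= N (I_ (dd k) \- G) + N (G \- I_ (cst 0)) + N (I_ (cst 0)).
  apply: (@le_trans _ _ (N (I_ (dd k) \- I_ (cst 0)) + N (I_ (cst 0)))).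
    apply: (le_trans _ (ND hB (XB hB X1 X0) X0)); rewrite (_ : (_ \- _) \+ _ = I_ (dd k))//.
    by apply/funext => x /=; rewrite subrK.
  by rewrite lerD2r; exact: NB.
have a3 : N (I_ (cst 0)) = 0.
  have := NI _ B0; rewrite XC0 (_ : _ \- cst 0 = I_ (cst 0))//.
  by apply/funext => x /=; rewrite subr0.
move: a1; rewrite (X_norm_sub hB XCd X1) NI// add0r.
move: a2; rewrite (X_norm_sub hB XG X0) a3.
move: h1 h2; set p := N _; set q := N _; set r := N _; lra.
Qed.

End levi.

(** * Weak limits in L^1 relative to a weight *)

Section weighted.
Context d (T : measurableType d) (R : realType).
Variables (mu : {sigma_finite_measure set T -> \bar R}) (D : set T).
Local Notation L1 D f := (mu.-integrable D (EFin \o f)).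
Hypothesis mD : measurable D.
Hypothesis finD : (mu D < +oo)%E.
Hypothesis fine_cover : forall r : R, 0 < r -> exists (n : nat) (P : nat -> set T),
  [/\ forall i, measurable (P i), forall i, (mu (P i) < r%:E)%E &
      D `<=` \bigcup_(i in `I_n) P i].

Lemma meas_trunc (f : T -> R) (c : R) : measurable_fun D f ->
  measurable_fun D (fun x => Num.max (- c) (Num.min c (f x))).
Proof.
by move=> mf; apply: measurable_maxr => //; exact: measurable_minr.
Qed.

Lemma meas_min_abs (f : T -> R) (c : R) : measurable_fun D f ->
  measurable_fun D (fun x => Num.min c `|f x|).
Proof. by move=> mf; apply: measurable_minr => //; exact: measurableT_comp. Qed.

Lemma ae_eq_of_int (f g : T -> R) (A : set T) : measurable A -> L1 A f -> L1 A g ->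
  (forall B, measurable B -> B `<=` A -> \int[mu]_(x in B) f x = \int[mu]_(x in B) g x) ->
  {ae mu, forall x, A x -> f x = g x}.
Proof.
move=> mA fI gI h.
have := integral_ae_eq (g := EFin \o g) mA fI (measurable_int _ gI).
case.
- move=> B BA mB; have fB := L1S mA mB BA fI; have gB := L1S mA mB BA gI.
  have := h B mB BA; rewrite /Rintegral => e.
  by rewrite -(fineK (integrable_fin_num mB fB)) -(fineK (integrable_fin_num mB gB)) e.
- by move=> N [mN N0 h']; exists N; split => // x /= nx; apply: h' => /= k; apply: nx => Ax; have [] := k Ax.
Qed.

(* If [u n * w0] converges in the weak topology of [L1] for one weight [w0 > 0], the candidate limit
   of [u] is the quotient by [w0] of the limit, computed here as [g0 * expR (- ln w0)]. *)
Lemma L1_wsc_weighted (u : nat -> T -> R) (w0 : T -> R) :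
  measurable_fun D w0 -> {ae mu, forall x, D x -> 0 < w0 x} ->
  (forall n, L1 D (fun x => u n x * w0 x)) ->
  (forall A, measurable A -> A `<=` D -> cvg ((fun n => \int[mu]_(x in A) (u n x * w0 x)) @ \oo)) ->
  exists2 f : T -> R, measurable_fun D f & forall w, measurable_fun D w ->
    (forall n, L1 D (fun x => u n x * w x)) ->
    (forall A, measurable A -> A `<=` D -> cvg ((fun n => \int[mu]_(x in A) (u n x * w x)) @ \oo)) ->
    L1 D (fun x => f x * w x) /\
    (fun n => \int[mu]_(x in D) (u n x * w x)) @ \oo --> \int[mu]_(x in D) (f x * w x).
Proof.
move=> mw0 w0pos uI uc.
have [g0 g0I hg0] := L1_wsc mD finD fine_cover uI uc.
(* Equal to the inverse of [w0] wherever [w0 > 0], and measurable as a composition. *)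
pose rw x := expR (- ln (w0 x)).
have mrw : measurable_fun D rw.
  apply: measurableT_comp => //; apply: measurableT_comp => //.
  exact: (measurableT_comp (@measurable_ln R)).
have rwE x : 0 < w0 x -> rw x = (w0 x)^-1.
  by move=> w; rewrite /rw expRN lnK ?posrE.
exists (fun x => g0 x * rw x); first by apply: measurable_funM => //; exact: L1_meas g0I.
move=> w mw wI wc; have [gw gwI hgw] := L1_wsc mD finD fine_cover wI wc.
(* On [Dj j] the quotient [w / w0] is bounded by [j + 1], so it is an admissible multiplier for the
   weak convergence of [u n * w0]; this identifies the limit [gw] of [u n * w] with [g0 * w / w0]
   there. The sets exhaust [D] up to a null set. *)
pose Dj j := D `&` [set x | `|w x| <= j.+1%:R * w0 x].
have mDj j : measurable (Dj j).
  by apply: le_set_meas => //; [exact: measurableT_comp|exact: measurable_funM].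
have DjD j : Dj j `<=` D by move=> x [].
have Djw j x : Dj j x -> w x * rw x * w0 x = w x /\ `|j.+1%:R^-1 * (w x * rw x)| <= 1.
  move=> [_ /= le]; have : 0 <= j.+1%:R * w0 x by exact: le_trans le.
  rewrite pmulr_rge0// le_eqVlt => /orP[/eqP e|w0x].
    move: le; rewrite -e mulr0 normr_le0 => /eqP ->; by rewrite !mul0r mulr0 normr0.
  rewrite (rwE x w0x) mulfVK ?gt_eqF//; split => //.
  rewrite !normrM normfV (ger0_norm (_ : 0 <= j.+1%:R))// normfV (gtr0_norm w0x).
  by rewrite ler_pdivrMl// mulr1 ler_pdivrMr.
have aeDj j : {ae mu, forall x, Dj j x -> j.+1%:R^-1 * gw x = j.+1%:R^-1 * (w x * rw x) * g0 x}.
  have g0j := L1S mD (mDj j) (DjD j) g0I.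
  apply: ae_eq_of_int => //.
  - by apply: L1Z => //; exact: L1S gwI.
  - apply: (L1_ae_le (mDj j) g0j).
      have S h : measurable_fun D h -> measurable_fun (Dj j) h by apply: measurable_funS.
      apply: measurable_funM; last exact: L1_meas g0j.
      by apply: measurable_funM => //; apply: measurable_funM; exact: S.
    apply: aeW => x /Djw[_ le1]; rewrite normrM -[leRHS]mul1r.
    by apply: ler_wpM2r.
  move=> B mB BDj; have BD : B `<=` D := subset_trans BDj (@DjD j).
  pose s1 (x : T) : R := \1_B x * j.+1%:R^-1; pose s2 (x : T) : R := \1_B x * (j.+1%:R^-1 * (w x * rw x)).
  have m1 : measurable_fun D s1 by apply: measurable_funM => //; exact: measurable_indic.
  have m2 : measurable_fun D s2.
    apply: measurable_funM; first exact: measurable_indic.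
    by apply: measurable_funM => //; exact: measurable_funM.
  have b1 x : D x -> `|s1 x| <= 1.
    move=> _; rewrite /s1 indicE; case: (x \in B); rewrite ?mul0r ?normr0// mul1r ger0_norm//.
    by rewrite invf_le1// ler1n.
  have b2 x : D x -> `|s2 x| <= 1.
    move=> Dx; rewrite /s2 indicE; have [/set_mem xB|_] := boolP (x \in B); last by rewrite mul0r normr0.
    by rewrite mul1r; exact: (Djw j x (BDj _ xB)).2.
  have c1 := hgw s1 m1 b1; have c2 := hg0 s2 m2 b2.
  have e12 : (fun n => \int[mu]_(x in D) (s1 x * (u n x * w x))) = (fun n => \int[mu]_(x in D) (s2 x * (u n x * w0 x))).
    apply/funext => n; apply: eq_Rintegral => x /set_mem Dx; rewrite /s1 /s2 indicE.
    have [/set_mem xB|_] := boolP (x \in B); last by rewrite !mul0r.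
    have [e _] := Djw j x (BDj _ xB); rewrite -[in LHS]e !mul1r; ring.
  rewrite e12 in c1.
  have E : \int[mu]_(x in D) (s1 x * gw x) = \int[mu]_(x in D) (s2 x * g0 x).
    by rewrite -(cvg_lim _ c1)// -(cvg_lim _ c2).
  have -> : \int[mu]_(x in B) (j.+1%:R^-1 * gw x) = \int[mu]_(x in D) (s1 x * gw x).
    by rewrite -(int_indic_mul mu _ mB BD); apply: eq_Rintegral => x _; rewrite /s1 mulrA.
  rewrite E -(int_indic_mul mu _ mB BD); apply: eq_Rintegral => x _; rewrite /s2; ring.
have ae : {ae mu, forall x, D x -> gw x = g0 x * rw x * w x}.
  move: w0pos => /filterS2; apply; last exact: (ae_foralln aeDj).
  move=> x pos h Dx; have w0x := pos Dx.
  have [j hj] : exists j : nat, `|w x| / w0 x <= j.+1%:R.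
    exists (Num.truncn (`|w x| / w0 x)); apply: ltW; apply: truncnS_gt.
  have := h j; have : Dj j x by split => //=; rewrite -ler_pdivrMr.
  have j0 : j.+1%:R^-1 != 0 :> R by rewrite invr_neq0.
  by move=> Djx /(_ Djx); rewrite -mulrA => /(mulfI j0) ->; ring.
have fI : L1 D (fun x => g0 x * rw x * w x).
  apply: (L1_ae_le mD gwI).
    by apply: measurable_funM => //; apply: measurable_funM => //; exact: L1_meas g0I.
  by apply: filterS ae => x h Dx; rewrite h.
split => //.
have -> : \int[mu]_(x in D) (g0 x * rw x * w x) = \int[mu]_(x in D) (cst 1 x * gw x).
  rewrite /Rintegral; congr fine; apply: ae_eq_integral => //; first exact: measurable_int fI.
    by apply/measurable_EFinP; apply: measurable_funM => //; exact: L1_meas gwI.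
  by apply: filterS ae => x h Dx /=; rewrite mul1r h.
rewrite (_ : (fun n => \int[mu]_(x in D) (u n x * w x)) = (fun n => \int[mu]_(x in D) (cst 1 x * (u n x * w x)))).
  by apply: hgw => // x _; rewrite normr1.
by apply/funext => n; apply: eq_Rintegral => x _; rewrite mul1r.
Qed.

End weighted.

(** * Order continuity of the Cesaro space *)

Section order_continuity.
Context (R : realType) (X : fspace R).
Hypothesis hX : ri_space X.
Hypothesis hne : fcarrier X <> Linfty.
Hypothesis mc : monotone_cauchy X.
Local Notation leb := (@completed_lebesgue_measure R).
Local Notation I01 := (`[0, 1]%classic : set (lebT R)).
Local Notation L1 A f := (integrable leb (A : set (lebT R)) (EFin \o (f : lebT R -> R))).
Local Notation N := (fnorm X).
Local Notation E := (cesaro_space X).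
Local Notation nE := (fnorm (cesaro_space X)).
Local Notation C := (@cesaro_op R).
Local Notation m := (@cesaro_measure R).
Implicit Types f g h w : R -> R.
Let hB := ri_bfs hX.

(** Completeness of [X] supplies the norm limit [g] of [C f_n], and monotone convergence gives
    [C F <= g], so [F] belongs to the space by the ideal property. The inequalities
    [0 <= C F - C f_n <= g - C f_n] then give convergence in norm. *)
Lemma levi (f : nat -> R -> R) (F : R -> R) (M : R) : (forall n, @Linfty R (f n)) ->
  (forall n x, 0 <= f n x) -> (forall k n x, (k <= n)%N -> f k x <= f n x) ->
  (forall n, nE (f n) <= M) -> Lmeasurable F -> (forall x, (fun n => f n x) @ \oo --> F x) ->
  E F /\ forall e : R, 0 < e -> exists k, forall n, (k <= n)%N -> nE (F \- f n) < e.
Proof.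
move=> bf f0 ndf hM mF fF.
have Ef n := Linfty_E hX (bf n).
have XC n := (E_C hX (Ef n)).1.
have ncC : norm_cauchy X (fun n => C (f n)) by apply: mc => //; exists M.
have [g Xg cg] := bfs_complete hB XC ncC.
have leF n x : f n x <= F x.
  have <- : limn (fun n => f n x) = F x by exact/cvg_lim.
  by apply: nondecreasing_cvgn_le; [move=> p q pq; exact: ndf|apply/cvg_ex; exists (F x)].
have F0 x : 0 <= F x by exact: le_trans (f0 0%N x) (leF 0%N x).
have Cg : @ae01 R (fun x => forall n, C (f n) x <= g x).
  apply: ae01_all; apply: (incr_cvg_le hB XC Xg) => // k n kn.
  by apply: C_le => // x; exact: ndf.
have xx P : (forall x, 0 < x < 1 -> (forall n, C (f n) x <= g x) -> P x) -> @ae01 R P.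
  move=> h; have := @ae01_lt1 R (fun x => 0 < x < 1) (fun _ k => k).
  by move/(ae01S2 (fun x _ k1 k2 => h x k1 k2)); apply.
have intF x : 0 < x < 1 -> (forall n, C (f n) x <= g x) ->
    (\int[leb]_(t in (`[0%R, x]%classic : set (lebT R))) (F t)%:E <= (x * g x)%:E)%E.
  move=> /andP[x0 x1] hx.
  have sub := sub0x (ltW x1).
  apply: (monotone_int_le (g := fun n => (f n : lebT R -> R)) (@itv_leb R _)).
  - by move=> n; apply: Lmeas_sub; [exact: (bf n).1|exact: itv_leb|].
  - by move=> n t _; exact: f0.
  - by move=> t _ p q pq; exact: ndf.
  - by move=> t _; exact: fF.
  move=> n; have fI : L1 `[0, x]%classic (f n).
    by apply: (E_locint (Ef n)).2; rewrite ltW.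
  rewrite -(fineK (integrable_fin_num (@itv_leb R _) fI)) lee_fin.
  by have := hx n; rewrite /cesaro_op ler_pdivrMl.
have lF : locint F.
  split => //; apply/(ae_locint mF); apply: xx => x hx1 hx2.
  rewrite (eq_integral (fun t : lebT R => (F t)%:E)); last by move=> t _; rewrite ger0_norm.
  exact: le_lt_trans (intF x hx1 hx2) (ltry _).
have CF : @ae01 R (fun x => C F x <= g x).
  apply: xx => x hx1 hx2; have /andP[x0 x1] := hx1.
  have FI : L1 `[0, x]%classic F by apply: lF.2; rewrite ltW.
  have := intF x hx1 hx2; rewrite -(fineK (integrable_fin_num (@itv_leb R _) FI)) lee_fin => h.
  by rewrite /cesaro_op ler_pdivrMl.
have C0 x : I01 x -> 0 <= C F x by rewrite /= in_itv /= => /andP[x0 _]; exact: cesaro_ge0.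
have EF : E F.
  apply/EP; split => //; rewrite pos_norm//.
  apply: (X_ideal hB Xg (cesaro_meas mF) _).1.
  apply: ae01S CF => x Ix h; rewrite (ger0_norm (C0 x Ix)); exact: le_trans h (ler_norm _).
split => // e e0.
have /cvgrPdist_lt /(_ _ e0)[k _ hk] := cg; exists k => n kn.
have := hk n kn; rewrite /= sub0r normrN (ger0_norm (Nge0 hB (XB hB (XC n) Xg))); apply: le_lt_trans.
rewrite (X_norm_sub hB (XC n) Xg) /= pos_norm; last by move=> x /=; rewrite subr_ge0.
apply: X_le => //; [exact: XB|exact: (E_C hX (E_B hX EF (Ef n))).1|].
have := @ae01_lt1 R (fun x => 0 < x < 1) (fun _ k => k).
move: CF; apply: ae01S2 => x Ix hx1 h2; rewrite /=.
have -> : F \- f n = -1 \*o f n \+ F by apply/funext => t /=; rewrite mulN1r addrC.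
rewrite (cesaroL (-1) (E_locint (Ef n)) lF h2) mulN1r addrC.
have CfF : C (f n) x <= C F x.
  by apply: cesaro_le => //; [exact: E_locint|apply: ae01W].
rewrite !ger0_norm ?subr_ge0//; first by rewrite lerD2r.
exact: le_trans hx1.
Qed.

Definition trunc (n : nat) f : R -> R := fun x => Num.max (- n%:R) (Num.min n%:R (f x)).
Definition trunc_abs (n : nat) f : R -> R := fun x => Num.min n%:R `|f x|.

Lemma trunc_norm n f x : `|trunc n f x| = trunc_abs n f x /\ `|f x - trunc n f x| = `|f x| - trunc_abs n f x.
Proof.
rewrite /trunc /trunc_abs; have n0 : 0 <= n%:R :> R by [].
move: (f x) (n%:R : R) n0 => a c c0.
have [a0|a0] := leP 0 a.
  rewrite (ger0_norm a0); have [ca|ac] := leP c a.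
    by rewrite max_r ?ger0_norm ?subr_ge0//; lra.
  by rewrite max_r ?ger0_norm ?subrr ?normr0//; lra.
rewrite (ltr0_norm a0) (min_r (_ : a <= c)); last lra.
have [ca|ac] := leP c (- a).
  rewrite max_l; last lra.
  by rewrite normrN ger0_norm// opprK ler0_norm; lra.
rewrite max_r; last lra.
by rewrite ltr0_norm// !subrr normr0.
Qed.

Lemma trunc_abs_ge0 n f x : 0 <= trunc_abs n f x. Proof. by rewrite le_min normr_ge0 ler0n. Qed.

Lemma trunc_abs_le n f x : trunc_abs n f x <= `|f x|. Proof. by rewrite ge_min lexx orbT. Qed.

Lemma trunc_abs_incr k n f x : (k <= n)%N -> trunc_abs k f x <= trunc_abs n f x.
Proof. by move=> kn; rewrite /trunc_abs le_min !ge_min lexx orbT andbT ler_nat kn. Qed.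

Lemma trunc_abs_eq f x : exists k, forall n, (k <= n)%N -> trunc_abs n f x = `|f x|.
Proof.
exists (Num.truncn `|f x|).+1 => n kn; apply: min_r; apply: ltW.
by apply: lt_le_trans (truncnS_gt _) _; rewrite ler_nat.
Qed.

Lemma trunc_abs_cvg f x : (fun n => trunc_abs n f x) @ \oo --> `|f x|.
Proof.
have [k hk] := trunc_abs_eq f x; apply: cvg_near_cst; by exists k => // n /= kn; rewrite hk.
Qed.

Lemma trunc_meas n f : Lmeasurable f -> Lmeasurable (trunc n f).
Proof. exact: meas_trunc. Qed.

Lemma trunc_abs_Linfty n f : Lmeasurable f -> @Linfty R (trunc_abs n f).
Proof.
move=> mf; split; first exact: meas_min_abs.
by exists n%:R; apply: ae01W => x _; rewrite ger0_norm ?trunc_abs_ge0// ge_min lexx.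
Qed.

Lemma trunc_Linfty n f : Lmeasurable f -> @Linfty R (trunc n f).
Proof.
move=> mf; apply: (Linfty_ideal (trunc_abs_Linfty n mf)); first exact: trunc_meas.
by apply: ae01W => x _; rewrite (trunc_norm n f x).1 ger0_norm// trunc_abs_ge0.
Qed.

Lemma trunc_abs_nE n f : E f -> nE (trunc_abs n f) <= nE f.
Proof.
move=> Ef; apply: (E_ideal hX Ef (trunc_abs_Linfty n (E_locint Ef).1).1 _).2.
by apply: ae01W => x _; rewrite (ger0_norm (trunc_abs_ge0 _ _ _)) trunc_abs_le.
Qed.

(** [|f - trunc n f|] equals [|f| - min(n, |f|)], to which the Levi property applies. So [L^oo] is
    dense in the Cesaro space. *)
Lemma trunc_cvg f : E f -> forall e : R, 0 < e -> exists k, forall n, (k <= n)%N -> nE (f \- trunc n f) < e.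
Proof.
move=> Ef e e0; have mf := (E_locint Ef).1.
have [||||||_ /(_ e e0)[k hk]] := @levi (fun n => trunc_abs n f) (Num.norm \o f) (nE f).
- by move=> n; exact: trunc_abs_Linfty.
- by move=> n x; exact: trunc_abs_ge0.
- by move=> p q x; exact: trunc_abs_incr.
- by move=> n; exact: trunc_abs_nE.
- exact: measurableT_comp.
- by move=> x; exact: trunc_abs_cvg.
exists k => n kn; have := hk n kn; congr (N (C _) < e).
apply/funext => x /=; rewrite (trunc_norm n f x).2 ger0_norm// subr_ge0; exact: trunc_abs_le.
Qed.

(** A weak Fatou property of the Cesaro space, obtained from the Levi property and not assumed of
    [X]. It admits a function for which only norm bounds on truncations are known. *)
Lemma E_of_trunc_bounded f (M : R) : Lmeasurable f -> (forall n, nE (trunc_abs n f) <= M) -> E f.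
Proof.
move=> mf hM; have [||||||Ef _] := @levi (fun n => trunc_abs n f) (Num.norm \o f) M.
- by move=> n; exact: trunc_abs_Linfty.
- by move=> n x; exact: trunc_abs_ge0.
- by move=> p q x; exact: trunc_abs_incr.
- by [].
- exact: measurableT_comp.
- by move=> x; exact: trunc_abs_cvg.
by apply: (E_ideal hX Ef mf _).1; apply: ae01W => x _ /=; rewrite normr_id.
Qed.

(** The bound for [h w] passes from the truncations of [|h|] to [h] by monotone convergence, and the
    formula for [psi h] by density of [L^oo]. *)
Lemma dual_density_E (psi : (R -> R) -> R) (M : R) : 0 <= M ->
  (forall (a : R) f g, E f -> E g -> psi (a \*o f \+ g) = a * psi f + psi g) ->
  (forall f, E f -> `|psi f| <= M * nE f) ->
  exists2 w, L1 I01 w & forall h, E h -> [/\ L1 I01 (fun t => h t * w t),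
    psi h = \int[leb]_(t in I01) (h t * w t) &
    \int[leb]_(t in I01) `|h t * w t| <= M * nE h].
Proof.
move=> M0 lpsi bpsi; have [w [wI wE wM]] := linear_density hX hne M0 lpsi bpsi.
exists w => //.
have mw := L1_meas wI.
have bd h : E h -> L1 I01 (fun t => h t * w t) /\ \int[leb]_(t in I01) `|h t * w t| <= M * nE h.
  move=> Eh; have mh := (E_locint Eh).1.
  have mhw : Lmeasurable (fun t => h t * w t) by exact: measurable_funM.
  have mt n := trunc_abs_Linfty n mh.
  have le : (\int[leb]_(t in I01) `|h t * w t|%:E <= (M * nE h)%:E)%E.
    apply: (@monotone_int_le _ _ _ leb I01 (fun n (t : lebT R) => trunc_abs n h t * `|w t|) (fun t : lebT R => `|h t * w t|) _ (@mI01 R)).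
    - move=> n; apply: measurable_funM; first exact: (mt n).1.
      exact: measurableT_comp.
    - by move=> n t _; rewrite mulr_ge0 ?trunc_abs_ge0.
    - by move=> t _ p q pq; rewrite ler_wpM2r// trunc_abs_incr.
    - by move=> t _; rewrite normrM; apply: cvgMr_tmp; exact: trunc_abs_cvg.
    move=> n; have [K hK] := (mt n).2.
    have tI := bounded_mul_L1 wI (mt n).1 hK.
    have := wM _ (mt n); rewrite (_ : Rintegral _ _ _ = \int[leb]_(t in I01) (trunc_abs n h t * `|w t|)); last first.
      by apply: eq_Rintegral => t _; rewrite normrM ger0_norm// trunc_abs_ge0.
    have tI' : L1 I01 (fun t => trunc_abs n h t * `|w t|).
      exact: (bounded_mul_L1 (integrable_norm wI) (mt n).1 hK).
    move=> le1; rewrite -(fineK (integrable_fin_num (@mI01 R) tI')) lee_fin.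
    by apply: (le_trans le1); rewrite ler_wpM2l// trunc_abs_nE.
  have hI : L1 I01 (fun t => h t * w t).
    apply/integrableP; split; first exact/measurable_EFinP.
    exact: le_lt_trans le (ltry _).
  split => //; rewrite -lee_fin; apply: le_trans le.
  by rewrite -[leRHS](fineK (integrable_fin_num (@mI01 R) (integrable_norm hI))).
move=> h Eh; have [hI hM] := bd h Eh; split => //.
apply/eqP; rewrite -subr_eq0 -normr_eq0 eq_le normr_ge0 andbT; apply/ler_addgt0Pr => e e0.
rewrite add0r.
(* The approximation error enters twice, through [psi] and through the integral; [M + 1] allows
   [M = 0]. *)
have e1 : 0 < e / (2 * (M + 1)) by rewrite divr_gt0//; lra.
have [k hk] := trunc_cvg Eh e1; have := hk k (leqnn k).
have bt := trunc_Linfty k (E_locint Eh).1.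
have Et := Linfty_E hX bt; have Ed := E_B hX Eh Et.
have [dI dM] := bd _ Ed; have [tI _] := bd _ Et.
set d := nE _ => hd.
have p1 : psi h = psi (h \- trunc k h) + psi (trunc k h).
  rewrite -[psi (h \- _)]mul1r -lpsi//; congr psi; apply/funext => x /=.
  by rewrite mul1r subrK.
have p2 : \int[leb]_(t in I01) (h t * w t) =
    \int[leb]_(t in I01) ((h \- trunc k h) t * w t) + \int[leb]_(t in I01) (trunc k h t * w t).
  rewrite -[X in X + _]mul1r -(intL 1 (@mI01 R) dI tI); apply: eq_Rintegral => t _ /=.
  by rewrite mul1r mulrBl subrK.
have d0 : 0 <= d := nE_ge0 hX Ed.
rewrite p1 p2 (wE _ bt) opprD addrACA subrr addr0.
apply: (le_trans (ler_normB _ _)); apply: (@le_trans _ _ (M * d + M * d)).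
  apply: lerD; first exact: bpsi.
  exact: le_trans (norm_int_le (@mI01 R) dI) dM.
move: hd; rewrite ltr_pdivlMr; last lra.
clear -d0 M0; nra.
Qed.

Lemma E_scalarly_integrable f : E f -> scalarly_integrable X f.
Proof.
move=> Ef; split => // phi M dphi M0 bphi.
have [l b] := dual_cesaro hX dphi bphi M0.
have [w wI wE] := dual_density_E M0 l b.
exists w; split => //.
- split => //; first by move=> h bh; have [] := wE h (Linfty_E hX bh).
  move=> A mA; rewrite /scalar_measure /cesaro_measure.
  have [_ -> _] := wE _ (Linfty_E hX (indic_Linfty mA)).
  rewrite setIC Rintegral_mkcondr; apply: eq_Rintegral => x _; rewrite patchE indicE.
  by case: (x \in A); rewrite ?mul1r ?mul0r.
- by have [] := wE f Ef.
- by have [] := wE f Ef.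
move=> A mA AI; have [_ -> _] := wE _ (E_mul_indic hX mA Ef).
have <- : \int[leb]_(t in I01) (\1_A t * (f t * w t)) = \int[leb]_(t in A) (f t * w t) by exact: int_indic_mul.
by apply: eq_Rintegral => t _ /=; rewrite mulrAC mulrC.
Qed.

End order_continuity.

(** * Weak sequential completeness of the Cesaro space *)

(** The weights [2^-(k+1)] have sum 1, so the weighted sum of the [psi k] keeps the bound [p], and
    at an [f] where all terms are nonnegative it dominates each of them. *)
Lemma sum_functional (T : Type) (R : realType) (V : set (T -> R)) (p : (T -> R) -> R) (psi : nat -> (T -> R) -> R) :
  (forall k (a : R) f g, V f -> V g -> psi k (a \*o f \+ g) = a * psi k f + psi k g) ->
  (forall k f, V f -> `|psi k f| <= p f) ->
  exists Psi : (T -> R) -> R, [/\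
    forall (a : R) f g, V f -> V g -> Psi (a \*o f \+ g) = a * Psi f + Psi g,
    forall f, V f -> `|Psi f| <= p f &
    forall f, V f -> (forall k, 0 <= psi k f) -> forall k, (1 / 2) ^+ k.+1 * psi k f <= Psi f].
Proof.
move=> lpsi bpsi; pose c f k := (1 / 2) ^+ k.+1 * psi k f.
have h0 k : 0 <= (1 / 2) ^+ k :> R by apply: exprn_ge0; lra.
have geo n : \sum_(0 <= k < n) (1 / 2) ^+ k.+1 = 1 - (1 / 2) ^+ n :> R.
  elim: n => [|n IH]; first by rewrite big_nil expr0 subrr.
  by rewrite big_nat_recr//= IH exprS; lra.
have p0 f : V f -> 0 <= p f by move=> Vf; exact: le_trans (bpsi 0%N f Vf).
have bs f n : V f -> \sum_(0 <= k < n) `|c f k| <= p f.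
  move=> Vf; apply: (@le_trans _ _ (\sum_(0 <= k < n) (1 / 2) ^+ k.+1 * p f)).
    by apply: ler_sum => k _; rewrite normrM (ger0_norm (h0 _)) ler_wpM2l// bpsi.
  by rewrite -mulr_suml geo mulrBl [1 * p f]mul1r gerBl mulr_ge0// p0.
have cv f : V f -> cvgn (series (c f)).
  move=> Vf; apply: normed_cvg; apply: nondecreasing_is_cvgn.
    by apply: nondecreasing_series => i _ _; exact: normr_ge0.
  by exists (p f) => _ [n _ <-]; exact: bs.
exists (fun f => limn (series (c f))); split.
- move=> a f g Vf Vg; apply/cvg_lim => //.
  rewrite (_ : series _ = (fun n => a * series (c f) n + series (c g) n)); last first.
    apply/funext => n; rewrite /series /= mulr_sumr -big_split /=; apply: eq_bigr => k _.
    by rewrite /c lpsi// mulrDr mulrCA.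
  by apply: cvgD; [apply: cvgMl_tmp|]; exact: cv.
- move=> f Vf; rewrite ler_norml; apply/andP; split.
    apply: limr_ge; [exact: cv|apply: nearW => n].
    rewrite lerNl; apply: le_trans (bs f n Vf); apply: le_trans (ler_norm_sum _ _ _).
    by rewrite -normrN; exact: ler_norm.
  apply: limr_le; [exact: cv|apply: nearW => n].
  by apply: le_trans (bs f n Vf); apply: le_trans (ler_norm_sum _ _ _); exact: ler_norm.
move=> f Vf pos k; have c0 i : 0 <= c f i by rewrite mulr_ge0.
apply: (@le_trans _ _ (series (c f) k.+1)).
  by rewrite /series /= big_nat_recr//= lerDr sumr_ge0.
by apply: nondecreasing_cvgn_le; [exact: nondecreasing_series|exact: cv].
Qed.

Section weak_completeness.
Context (R : realType) (X : fspace R).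
Hypothesis hX : ri_space X.
Hypothesis hne : fcarrier X <> Linfty.
Local Notation leb := (@completed_lebesgue_measure R).
Local Notation I01 := (`[0, 1]%classic : set (lebT R)).
Local Notation L1 A f := (integrable leb (A : set (lebT R)) (EFin \o (f : lebT R -> R))).
Local Notation N := (fnorm X).
Local Notation E := (cesaro_space X).
Local Notation nE := (fnorm (cesaro_space X)).
Local Notation C := (@cesaro_op R).
Implicit Types f g h w : R -> R.
Let hB := ri_bfs hX.

Lemma indic_norm_le1 (A : set (lebT R)) : @ae01 R (fun x => `|\1_A x : R| <= 1).
Proof.
by apply: ae01W => x _; rewrite indicE; case: (x \in A); rewrite ?normr0 ?normr1.
Qed.

Lemma norm_indic_gt0 (A : set (lebT R)) : measurable A -> A `<=` I01 -> (0 < leb A)%E -> 0 < N (\1_A : R -> R).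
Proof.
move=> mA AI A0; have XA := indic_X hX mA.
rewrite lt_neqAle (Nge0 hB XA) andbT; apply/negP => /eqP/esym.
move/(bfs_norm0 hB XA) => [Z [mZ Z0 hZ]].
have : (leb A <= leb Z)%E.
  apply: le_measure; rewrite ?inE// => x Ax; apply: hZ => /= h.
  by have /eqP := h (AI x Ax); rewrite indicE mem_set// oner_eq0.
by rewrite Z0 leNgt A0.
Qed.

(* Since [(\int_0^x |h|) 1_[x,1] <= C|h|], the integral over [0, x] is bounded on [E]. *)
Lemma int_initial_bounded (x : R) h : 0 < x < 1 -> E h ->
  N (\1_(`[x, 1]%classic : set (lebT R)) : R -> R) *
    `|\int[leb]_(t in (`[0, x]%classic : set (lebT R))) h t| <= nE h.
Proof.
move=> /andP[x0 x1] Eh; set B := (`[x, 1]%classic : set (lebT R)).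
have mB : measurable B by exact: itv_leb.
have XB' := indic_X hX mB.
have hI : L1 `[0, x]%classic h by apply: (E_locint Eh).2; rewrite (ltW x0).
pose J := \int[leb]_(t in (`[0, x]%classic : set (lebT R))) `|h t|.
have J0 : 0 <= J by apply: Rintegral_ge0 => t _.
apply: (@le_trans _ _ (N (J \*o (\1_B : R -> R)))).
  rewrite (NZ hB J XB') mulrC (ger0_norm J0) ler_wpM2r ?(Nge0 hB XB')//.
  exact: (norm_int_le (@itv_leb R _) hI).
apply: X_le => //; [exact: E_X|exact: XZ|].
apply: ae01_lt1 => y /andP[y0 y1] /=; rewrite cesaro_abs_norm ?(ltW y0)// indicE.
have [/set_mem|_] := boolP (y \in B); last first.
  by rewrite mulr0 normr0; apply: cesaro_abs_ge0; exact: ltW.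
rewrite /B /= in_itv /= => /andP[xy _]; rewrite mulr1 (ger0_norm J0).
have hyI : L1 `[0, y]%classic h by apply: (E_locint Eh).2; rewrite (ltW y0).
have JJ : J <= \int[leb]_(t in (`[0, y]%classic : set (lebT R))) `|h t|.
  apply: le_int_sub => //; try exact: itv_leb.
  by apply: subset_itvl; rewrite bnd_simp.
apply: (le_trans JJ); rewrite /cesaro_op /= ler_peMl//; first exact: le_trans J0 JJ.
by rewrite invf_ge1// ltW.
Qed.

(** The integral over [[0, 1]] need not be finite on the Cesaro space, so the integrals over
    [[0, x k]] with [x k = 1 - 1/(k+2)] increasing to 1 are summed instead; the factor [N
    1_[x k, 1]], nonzero since the interval is not null, gives each norm at most 1. *)
Lemma strictly_positive_functional : exists Psi : (R -> R) -> R, [/\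
    forall (a : R) f g, E f -> E g -> Psi (a \*o f \+ g) = a * Psi f + Psi g,
    forall f, E f -> `|Psi f| <= nE f &
    forall A : set (lebT R), measurable A -> A `<=` I01 -> Psi (\1_A : R -> R) <= 0 -> @ae01 R (fun x => ~ A x)].
Proof.
pose x (k : nat) : R := 1 - k.+2%:R^-1.
have x01 k : 0 < x k < 1.
  by rewrite /x subr_gt0 invf_lt1// ltr1n /= gtrBl invr_gt0.
pose B k := (`[x k, 1]%classic : set (lebT R)).
pose J k := (`[0, x k]%classic : set (lebT R)).
pose psi k h := N (\1_(B k) : R -> R) * \int[leb]_(t in J k) h t.
have XBk k : X (\1_(B k) : R -> R) by apply: (indic_X hX); exact: itv_leb.
have [||Psi [l b p]] := @sum_functional _ _ (fcarrier E) nE psi.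
- move=> k a f g Ef Eg; rewrite /psi mulrCA -mulrDr; congr (_ * _).
  have /andP[x0 x1] := x01 k.
  have fI : L1 (J k) f by apply: (E_locint Ef).2; rewrite (ltW x0).
  have gI : L1 (J k) g by apply: (E_locint Eg).2; rewrite (ltW x0).
  exact: (intL a (@itv_leb R _) fI gI).
- move=> k f Ef; rewrite normrM (ger0_norm (Nge0 hB (XBk k))); exact: int_initial_bounded.
exists Psi; split => // A mA AI PA.
have EA := Linfty_E hX (indic_Linfty mA).
have intA k : \int[leb]_(t in J k) \1_A t = fine (leb (A `&` J k)).
  by rewrite /Rintegral integral_indic//; exact: itv_leb.
have psi0 k : 0 <= psi k (\1_A : R -> R).
  by apply: mulr_ge0; [exact: Nge0|rewrite intA fine_ge0].
have JI k : J k `<=` I01 by apply: sub0x; have /andP[_ /ltW] := x01 k.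
have mJA k : measurable (A `&` J k) by apply: measurableI => //; exact: itv_leb.
have nul k : leb (A `&` J k) = 0%E.
  have c0 : 0 < N (\1_(B k) : R -> R).
    have /andP[x0 x1] := x01 k.
    apply: norm_indic_gt0; first exact: itv_leb.
      by apply: subset_itvr; rewrite bnd_simp ltW.
    by rewrite leb_itv ?ltW// lte_fin subr_gt0.
  have := le_trans (p _ EA psi0 k) PA; rewrite /psi intA pmulr_rle0; last first.
    by apply: exprn_gt0; lra.
  rewrite pmulr_rle0// => le0.
  have fin : leb (A `&` J k) \is a fin_num.
    by rewrite ge0_fin_numE//; apply: fin_sub => //; apply: subset_trans (@JI k).
  rewrite -(fineK fin); congr EFin; apply/eqP; rewrite eq_le le0 fine_ge0//.
have ae k : @ae01 R (fun y => ~ (A `&` J k) y).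
  by exists (A `&` J k); split => // y /= /not_implyP[_ /contrapT].
have := @ae01_lt1 R (fun y => 0 < y < 1) (fun _ k => k).
move: (ae01_all ae); apply: ae01S2 => y Iy h /andP[y0 y1] Ay.
have y10 : 0 < 1 - y by rewrite subr_gt0.
pose k := Num.truncn (1 - y)^-1.
apply: (h k); split => //; rewrite /J /= in_itv /= (ltW y0) /= /x lerBrDr -lerBrDl.
rewrite -[leRHS]invrK lef_pV2 ?posrE ?invr_gt0//; apply: ltW; apply: lt_trans (truncnS_gt _) _.
by rewrite ltr_nat.
Qed.

Hypothesis mc : monotone_cauchy X.

Lemma cesaro_space_wsc : weakly_sequentially_complete E.
Proof.
move=> u Eu wu.
have [Psi [lPsi bPsi posPsi]] := strictly_positive_functional.
have bPsi1 f : E f -> `|Psi f| <= 1 * nE f by move=> Ef; rewrite mul1r bPsi.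
have [w0 w0I w0E] := dual_density_E hX hne mc ler01 lPsi bPsi1.
have mw0 := L1_meas w0I.
have iA h (A : set (lebT R)) : measurable A -> A `<=` I01 ->
    \int[leb]_(t in I01) (\1_A t * h t) = \int[leb]_(t in A) h t by move=> mA AI; exact: int_indic_mul.
have w0pos : @ae01 R (fun x => 0 < w0 x).
  pose P := I01 `&` [set x | w0 x <= cst 0 x].
  have mP : measurable P by exact: (le_set_meas (@mI01 R) mw0 (measurable_cst _)).
  have PI : P `<=` I01 by move=> x [].
  have : @ae01 R (fun x => ~ P x).
    apply: posPsi => //; have [_ -> _] := w0E _ (Linfty_E hX (indic_Linfty mP)).
    rewrite iA//; have w0P := L1S (@mI01 R) mP PI w0I.
    have := int_ae_ge0 mP (L1Z (-1) mP w0P); rewrite (RintegralZl _ mP w0P) mulN1r oppr_ge0; apply.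
    by apply: aeW => x [_ /= h]; rewrite mulN1r oppr_ge0.
  by apply: ae01S => x Ix nP; rewrite ltNge; apply/negP => h; apply: nP.
(* Multiplication by [1_A] turns a functional into another one, so weak Cauchyness yields
   convergence of the integrals over every measurable [A]. *)
have dualA psi (A : set (lebT R)) : measurable A -> dual_space E psi -> dual_space E (fun h => psi (h \* \1_A)).
  move=> mA [l [M b]]; split.
    move=> a f g Ef Eg; rewrite -l; try exact: E_mul_indic.
    by congr psi; apply/funext => x /=; rewrite mulrDl mulrA.
  exists `|M| => f Ef; have [Ef' le] := E_mul hX Ef (indic_meas mA) (indic_norm_le1 A).
  apply: (le_trans (b _ Ef')); apply: (@le_trans _ _ (`|M| * nE (f \* \1_A))).
    by rewrite ler_wpM2r ?ler_norm//; exact: nE_ge0.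
  by rewrite ler_wpM2l.
have conv psi w : dual_space E psi ->
    (forall h, E h -> L1 I01 (fun t => h t * w t) /\ psi h = \int[leb]_(t in I01) (h t * w t)) ->
    forall A, measurable A -> A `<=` I01 -> cvgn (fun n => \int[leb]_(t in A) (u n t * w t)).
  move=> dpsi wE A mA AI.
  have := wu _ (dualA psi A mA dpsi).
  rewrite (_ : (fun n => _) = (fun n => \int[leb]_(t in A) (u n t * w t)))//.
  apply/funext => n; have [_ ->] := wE _ (E_mul_indic hX mA (Eu n)).
  rewrite -(iA (fun t => u n t * w t) A mA AI).
  by apply: eq_Rintegral => t _ /=; rewrite mulrAC mulrC.
have dPsi : dual_space E Psi by split => //; exists 1.
have w0E' h : E h -> L1 I01 (fun t => h t * w0 t) /\ Psi h = \int[leb]_(t in I01) (h t * w0 t).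
  by move=> Eh; have [] := w0E h Eh.
have [f mf hf] := @L1_wsc_weighted _ _ _ leb I01 (@mI01 R) (@finI01 R) (@fine_cover_I01 R) u w0
  mw0 w0pos (fun n => (w0E' _ (Eu n)).1) (conv Psi w0 dPsi w0E').
have repr psi : dual_space E psi -> exists w, [/\ forall h, E h -> L1 I01 (fun t => h t * w t) /\
    psi h = \int[leb]_(t in I01) (h t * w t), L1 I01 (fun t => f t * w t) &
    (fun n => psi (u n)) @ \oo --> \int[leb]_(t in I01) (f t * w t)].
  move=> dpsi; have [l [M b]] := dpsi.
  have b' h : E h -> `|psi h| <= `|M| * nE h.
    by move=> Eh; apply: (le_trans (b _ Eh)); rewrite ler_wpM2r ?ler_norm//; exact: nE_ge0.
  have [w wI wE] := dual_density_E hX hne mc (normr_ge0 M) l b'.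
  have wE' h : E h -> L1 I01 (fun t => h t * w t) /\ psi h = \int[leb]_(t in I01) (h t * w t).
    by move=> Eh; have [] := wE h Eh.
  have [fI fc] := hf w (L1_meas wI) (fun n => (wE' _ (Eu n)).1) (conv psi w dpsi wE').
  exists w; split => //; rewrite (_ : (fun n => _) = (fun n => \int[leb]_(t in I01) (u n t * w t)))//.
  by apply/funext => n; have [] := wE' _ (Eu n).
have bt n := trunc_abs_Linfty n mf.
have Et n := Linfty_E hX (bt n).
have [M hM] : exists M, forall n, nE (trunc_abs n f) <= M.
  apply: contrapT => nM.
  (* The growth [4^(j+1)] outweighs the coefficients [2^-(j+1)] of the sum below, which therefore
     takes values of at least [2^(j+1)] on the truncations. *)
  have /choice[k hk] : forall j, exists k, 4 ^+ j.+1 <= nE (trunc_abs k f).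
    move=> j; apply: contrapT => nk; apply: nM; exists (4 ^+ j.+1) => n.
    by rewrite leNgt; apply/negP => h; apply: nk; exists n; exact: ltW.
  have Cpos n x : I01 x -> 0 <= C (trunc_abs n f) x.
    by rewrite /= in_itv /= => /andP[x0 _]; apply: cesaro_ge0 => // t; exact: trunc_abs_ge0.
  have XCt n := (E_C hX (Et n)).1.
  have /choice[phi hphi] : forall j, exists phi, [/\ dual_ball X phi,
      forall g, X g -> @ae01 R (fun x => 0 <= g x) -> 0 <= phi g &
      4 ^+ j.+1 <= phi (C (trunc_abs (k j) f))].
    move=> j; have [phi [h1 h2 h3]] := norming_functional hB (XCt (k j)).
    exists phi; split => //; apply: (le_trans (hk j)); apply: le_trans h3.
    rewrite /= pos_norm; last by move=> x; exact: trunc_abs_ge0.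
    apply: X_le => //; first exact: (X_pos hB (XCt _)).1.
    by apply: ae01W => x Ix; rewrite funrposE max_l// Cpos.
  pose psi j h := phi j (C h).
  have psid j : (forall (a : R) h g, E h -> E g -> psi j (a \*o h \+ g) = a * psi j h + psi j g) /\
      (forall h, E h -> `|psi j h| <= 1 * nE h).
    have [[h1 h2] _ _] := hphi j; apply: dual_cesaro => // h Xh; rewrite mul1r; exact: h2.
  have [||Phi [l b p]] := @sum_functional _ _ (fcarrier E) nE psi.
  - by move=> j; exact: (psid j).1.
  - by move=> j h Eh; rewrite -[leRHS]mul1r; exact: (psid j).2.
  (* Although [f] is not yet known to lie in the space, [repr] makes [f w] integrable for the
     density [w] of every functional; this bounds [Phi] on all truncations of [f]. *)
  have [w [wE fI _]] : exists w, [/\ forall h, E h -> L1 I01 (fun t => h t * w t) /\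
      Phi h = \int[leb]_(t in I01) (h t * w t), L1 I01 (fun t => f t * w t) &
      (fun n => Phi (u n)) @ \oo --> \int[leb]_(t in I01) (f t * w t)].
    by apply: repr; split => //; exists 1 => h Eh; rewrite mul1r; exact: b.
  pose B := \int[leb]_(t in I01) `|f t * w t|.
  have hB' n : Phi (trunc_abs n f) <= B.
    have [tI ->] := wE _ (Et n); apply: (le_trans (ler_norm _)).
    apply: (le_trans (norm_int_le (@mI01 R) tI)).
    apply: (int_ae_le (@mI01 R) (integrable_norm tI) (integrable_norm fI)).
    apply: ae01W => t _; rewrite /= !normrM ler_wpM2r// ger0_norm ?trunc_abs_ge0//.
    exact: trunc_abs_le.
  have h2 j : 2 ^+ j.+1 <= B.
    apply: le_trans (hB' (k j)); have [_ h2 h3] := hphi j.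
    apply: (le_trans _ (p _ (Et (k j)) _ j)); last first.
      by move=> i; have [_ pos _] := hphi i; apply: pos; [exact: XCt|apply: ae01W => x; exact: Cpos].
    apply: (@le_trans _ _ ((1 / 2) ^+ j.+1 * 4 ^+ j.+1)).
      by rewrite -exprMn (_ : 1 / 2 * 4 = 2)//; lra.
    by rewrite ler_wpM2l//; apply: exprn_ge0; lra.
  have := h2 (Num.truncn B); rewrite leNgt => /negP; apply.
  apply: lt_trans (truncnS_gt B) _; rewrite -natrX ltr_nat; exact: ltn_expl.
have Ef := E_of_trunc_bounded hX mc mf hM.
exists f => // psi dpsi; have [w [wE fI fc]] := repr psi dpsi.
by have [_ ->] := wE f Ef.
Qed.

End weak_completeness.

(** * Dilations and the upper Boyd index *)

Section scaling.
Context (R : realType).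
Local Notation leb := (@completed_lebesgue_measure R).
Local Notation I01 := (`[0, 1]%classic : set (lebT R)).
Local Notation outer := (mu_ext (wlength (@idfun R)) : set (ocitv_type R) -> \bar R).

(** A cover of [A] by half-open intervals is dilated into a cover of [t A]. The outer measure is
    used because the completed measure is its restriction, which reaches all Lebesgue measurable
    sets. *)
Lemma outer_scale (t : R) (A : set R) : 0 < t ->
  (outer [set x | A (x / t)%R] <= t%:E * outer A)%E.
Proof.
move=> t0; rewrite -lee_pdivrMl//; apply: le_ereal_inf_tmp => _ [F [mF AF] <-].
rewrite lee_pdivrMl// -nneseriesZl; last by move=> i _; exact: measure_ge0.
apply: ereal_inf_lbound; exists (fun k => [set x | F k (x / t)%R]); first split.
- move=> i; have [[a b] _ <-] := mF i; exists (a * t, b * t) => //=.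
  apply/seteqP; split => x /=; rewrite !in_itv /= ltr_pdivlMr// ler_pdivrMr//.
- by move=> x /= /AF[i _ Fi]; exists i.
apply: eq_eseriesr => k _; have [[a b] _ <-] := mF k => /=.
rewrite (_ : [set x | _] = `]a * t, b * t]%classic); last first.
  by apply/seteqP; split => x /=; rewrite !in_itv /= ltr_pdivlMr// ler_pdivrMr.
rewrite !wlength_itv /= !lte_fin ltr_pM2r//; case: ifP => _; last by rewrite mule0.
by rewrite -!EFinB -EFinM mulrBr ![t * _]mulrC.
Qed.

Lemma outer_scaleE (t : R) (A : set R) : 0 < t ->
  outer [set x | A (x / t)%R] = (t%:E * outer A)%E.
Proof.
move=> t0; apply/eqP; rewrite eq_le outer_scale//= -lee_pdivlMl//.
have ti : 0 < t^-1 by rewrite invr_gt0.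
have := outer_scale [set x | A (x / t)%R] ti.
rewrite (_ : [set x | [set y | A (y / t)%R] (x / t^-1)%R] = A)//.
by apply/seteqP; split => x /=; rewrite invrK mulfK// gt_eqF.
Qed.

(** Carathéodory's criterion for [t A] against a set [B] is [t] times the criterion for [A] against
    [B / t]. *)
Lemma leb_scale (t : R) (A : set (lebT R)) : 0 < t -> measurable A ->
  measurable ([set x : R | A (x / t)%R] : set (lebT R)) /\
  leb ([set x : R | A (x / t)%R] : set (lebT R)) = (t%:E * leb A)%E.
Proof.
move=> t0 mA; split; last exact: outer_scaleE.
move=> B; have ti : 0 < t^-1 by rewrite invr_gt0.
have e P : outer P = (t%:E * outer [set x | P (x / t^-1)%R])%E.
  rewrite -outer_scaleE//; congr (outer _); apply/seteqP; split => x /=; by rewrite invrK divfK// gt_eqF.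
rewrite [LHS]e [X in (X + _)%E]e [X in (_ + X)%E]e -ge0_muleDr ?outer_measure_ge0//.
rewrite (mA [set x | B (x / t^-1)%R]); congr (t%:E * (outer _ + outer _))%E;
 by apply/seteqP; split => x /=; rewrite invrK mulfK// gt_eqF.
Qed.

End scaling.

(** * Bounding an integral by slices *)

Section level_sets.
Context d (T : measurableType d) (R : realType) (mu : {measure set T -> \bar R}).

(** With [g n = min(f, c (n+1))], one has [g (n+1) <= g n + c (n+2) 1_(f > c (n+1))], and the last
    set has measure at most [r (n+1)]; the sum builds up by induction, starting from
    [mu D <= r 0]. *)
Lemma level_int_le (D : set T) (f : T -> R) (c r : nat -> R) (M : R) :
  measurable D -> measurable_fun D f -> (forall x, 0 <= f x) ->
  (forall n, 0 <= c n) -> (forall p q, (p <= q)%N -> c p <= c q) ->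
  (forall n, (mu (D `&` [set x | (c n < f x)%R]) <= (r n)%:E)%E) -> (mu D <= (r 0%N)%:E)%E ->
  r @ \oo --> (0 : R) -> (forall n, \sum_(j < n.+1) r j * c j.+1 <= M) ->
  (\int[mu]_(x in D) (f x)%:E <= M%:E)%E.
Proof.
move=> mD mf f0 c0 ndc hc hD r0 hM.
have mc n : measurable (D `&` [set x | c n < f x]).
  rewrite (_ : D `&` _ = D `\` (D `&` [set x | f x <= cst (c n) x])).
    by apply: measurableD => //; exact: le_set_meas.
  apply/seteqP; split => x /=; first by move=> [Dx h]; split => // -[_]; rewrite leNgt h.
  by move=> [Dx h]; split => //; rewrite ltNge; apply/negP => h'; apply: h.
pose g n x := Num.min (f x) (c n.+1).
have mg n : measurable_fun D (g n) by apply: measurable_minr.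
have g0 n x : 0 <= g n x by rewrite le_min f0 c0.
have P n : (\int[mu]_(x in D) (g n x)%:E <= (\sum_(j < n.+1) r j * c j.+1)%:E)%E.
  elim: n => [|n IH].
    rewrite big_ord1; apply: (@le_trans _ _ (\int[mu]_(x in D) (cst (c 1%N)%:E x))%E).
      apply: ge0_le_integral => //; try by move=> x _; rewrite lee_fin.
        exact/measurable_EFinP.
      by move=> x _; rewrite lee_fin ge_min lexx orbT.
    by rewrite integral_cst// mulrC EFinM; apply: lee_wpmul2l; rewrite ?lee_fin.
  set A := D `&` [set x | c n.+1 < f x].
  have mA : measurable A by exact: mc.
  have mI : measurable_fun D (\1_A : T -> R) by exact: measurable_indic.
  apply: (@le_trans _ _ (\int[mu]_(x in D) ((g n x)%:E + (c n.+2)%:E * (\1_A x)%:E))%E).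
    apply: ge0_le_integral => //.
    - by move=> x _; rewrite lee_fin.
    - exact/measurable_EFinP.
    - by apply/measurable_EFinP; apply: measurable_funD => //; exact: measurable_funM.
    move=> x Dx; rewrite -EFinM -EFinD lee_fin /g indicE.
    have [xA|/negP xA] := boolP (x \in A).
      by rewrite mulr1; apply: (le_trans (_ : _ <= c n.+2)); rewrite ?ge_min ?lexx ?orbT// lerDr; exact: g0.
    rewrite mulr0 addr0; have fc : f x <= c n.+1.
      by rewrite leNgt; apply/negP => h; apply: xA; rewrite inE.
    by rewrite (min_l fc) ge_min lexx.
  rewrite ge0_integralD//; last 4 first.
  - by move=> x _; rewrite lee_fin.
  - exact/measurable_EFinP.
  - by move=> x _; rewrite -EFinM lee_fin mulr_ge0.
  - by apply/measurable_EFinP; exact: measurable_funM.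
  rewrite ge0_integralZl_EFin//; last exact/measurable_EFinP.
  rewrite big_ord_recr /= EFinD; apply: leeD => //.
  rewrite integral_indic// (setIidl (_ : A `<=` D)); last by move=> x [].
  by rewrite mulrC EFinM; apply: lee_wpmul2l; [rewrite lee_fin|exact: hc].
(* Where [f] exceeds every level, [g n] need not converge to [f]; this set is null because [r] tends
   to 0. *)
pose Z := \bigcap_n (D `&` [set x | c n < f x]).
have mZ : measurable Z by exact: bigcap_measurable.
have Z0 : mu Z = 0%E.
  have ZA n : (mu Z <= (r n)%:E)%E.
    by apply: le_trans (hc n); apply: le_measure; rewrite ?inE//; apply: bigcap_inf.
  apply/eqP; rewrite eq_le measure_ge0 andbT; apply/lee_addgt0Pr => e e0.
  have /cvgrPdist_lt /(_ e e0)[k _ hk] := r0.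
  apply: (le_trans (ZA k)); rewrite add0e lee_fin; apply: ltW.
  by have := hk k (leqnn k); rewrite /= sub0r normrN; apply: le_lt_trans; exact: ler_norm.
rewrite (@ge0_negligible_integral _ _ _ mu D Z)//; last 2 first.
- exact/measurable_EFinP.
- by move=> x _; rewrite lee_fin.
have mDZ : measurable (D `\` Z) by exact: measurableD.
have sub : D `\` Z `<=` D by move=> x [].
apply: (monotone_int_le (g := g)) => //.
- by move=> n; apply: measurable_funS (mg n).
- move=> x _ p q pq; rewrite /g le_min !ge_min lexx /=; apply/orP; right; exact: ndc.
- move=> x [Dx nZ]; have [n hn] : exists n, f x <= c n.
    apply: contrapT => /forallNP h; apply: nZ => n _; split => //=.
    by rewrite ltNge; apply/negP => h'; exact: (h n).
  apply: cvg_near_cst; exists n => // k /= nk; rewrite /g min_l//.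
  by apply: (le_trans hn); apply: ndc; rewrite (leq_trans nk).
move=> n; apply: le_trans (le_trans (P n) _); last by rewrite lee_fin.
apply: ge0_subset_integral => //; first exact/measurable_EFinP.
by move=> x _; rewrite lee_fin.
Qed.

End level_sets.

(** * The decreasing rearrangement *)

Section rearrangement.
Context (R : realType).
Local Notation leb := (@completed_lebesgue_measure R).
Local Notation I01 := (`[0, 1]%classic : set (lebT R)).
Local Notation df := distribution_fun.
Implicit Types f g h : R -> R.

Lemma dist_le f (s t : R) : Lmeasurable f -> s <= t -> (df f t <= df f s)%E.
Proof.
move=> mf st; apply: le_measure; rewrite ?inE; try exact: level_meas.
by move=> x [Ix h]; split => //; exact: le_lt_trans h.
Qed.

Lemma dist_le1 f (t : R) : Lmeasurable f -> (df f t <= 1%:E)%E.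
Proof. by move=> mf; apply: leb_le1; [exact: level_meas|move=> x []]. Qed.

Lemma dist_fin f (t : R) : Lmeasurable f -> df f t = (fine (df f t))%:E.
Proof.
move=> mf; rewrite fineK// ge0_fin_numE; first exact: le_lt_trans (dist_le1 t mf) (ltry _).
exact: measure_ge0.
Qed.

(* The decreasing rearrangement on [0,1], with the junk value [0] at [0]. *)
Definition decr f (s : R) : R :=
  if 0 < s then inf [set tau : R | 0 <= tau /\ (df f tau <= s%:E)%E] else 0.

Lemma decr_ge0 f s : 0 <= decr f s.
Proof.
rewrite /decr; case: ifP => // _; set A := [set _ | _].
have [->|/set0P A0] := eqVneq A set0; first by rewrite inf0.
by apply: lb_le_inf => // t [].
Qed.

Lemma decr_exists f (s : R) : Lmeasurable f -> 0 < s -> exists2 tau : R, 0 <= tau & (df f tau <= s%:E)%E.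
Proof.
move=> mf s0; pose F (n : nat) : set (lebT R) := [set x | I01 x /\ n%:R < `|f x|].
have FI n : F n `<=` I01 by move=> x [].
have F0 : \bigcap_n F n = set0.
  rewrite -subset0 => x /(_ (Num.truncn `|f x|).+1 I)[_].
  by rewrite ltNge => /negP; apply; apply: ltW; exact: truncnS_gt.
have [n /(_ n (leqnn n)) hn] : exists n, forall k, (n <= k)%N -> (leb (F k) < s%:E)%E.
  apply: (nonincr_cvg0 (@mI01 R) (@finI01 R) _ FI) => //.
  - by move=> n; exact: level_meas.
  - by move=> p q pq x [Ix h]; split => //; apply: le_lt_trans h; rewrite ler_nat.
  - by rewrite F0 measure0.
by exists n%:R => //; exact: ltW.
Qed.

(** The equivalence rests on right-continuity of the distribution function: the sets where
    [|f| > tau + 1/(n+1)] increase to the set where [|f| > tau]. *)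
Lemma decr_gt f (s tau : R) : Lmeasurable f -> 0 < s -> 0 <= tau ->
  (tau < decr f s) = (s%:E < df f tau)%E.
Proof.
move=> mf s0 tau0; rewrite /decr s0; set A := [set _ | _].
have A0 : A !=set0 by have [t t0 ht] := decr_exists mf s0; exists t.
have lA : has_lbound A by exists 0 => t [].
apply/idP/idP => [h|].
  rewrite ltNge; apply/negP => h'; move: h; rewrite ltNge => /negP; apply.
  by apply: ge_inf.
apply: contraTT; rewrite -!leNgt => h.
have An (n : nat) : (df f (tau + n.+1%:R^-1) <= s%:E)%E.
  have n0 : 0 < n.+1%:R^-1 :> R by rewrite invr_gt0.
  have [t [_ At] lt] := inf_adherent n0 (conj A0 lA).
  apply: le_trans At; apply: dist_le => //; apply: ltW; apply: (lt_le_trans lt).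
  by rewrite lerD2r.
pose F (n : nat) : set (lebT R) := [set x | I01 x /\ tau + n.+1%:R^-1 < `|f x|].
have UF : \bigcup_n F n = [set x | I01 x /\ tau < `|f x|].
  apply/seteqP; split => x.
    by move=> [n _ [Ix h']]; split => //; apply: lt_trans h'; rewrite ltrDl invr_gt0.
  move=> [Ix h']; have e0 : 0 < `|f x| - tau by rewrite subr_gt0.
  have [n _ /(_ n (leqnn n)) hn'] := near_infty_natSinv_lt (PosNum e0).
  by exists n => //; split => //; rewrite -ltrBrDl.
have mF n : measurable (F n) by exact: level_meas.
have cF : leb \o F @ \oo --> leb (\bigcup_n F n).
  apply: nondecreasing_cvg_mu => //; first exact: bigcup_measurable.
  move=> p q pq; apply/subsetPset => x [Ix h']; split => //; apply: le_lt_trans h'.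
  by rewrite lerD2l lef_pV2 ?posrE// ler_nat.
rewrite /distribution_fun -UF -(cvg_lim _ cF)//; apply: lime_le; first by apply/cvg_ex; eexists; exact: cF.
by apply: nearW => n; exact: An.
Qed.

Lemma decr_dist f (s : R) : Lmeasurable f -> 0 < s -> (df f (decr f s) <= s%:E)%E.
Proof. by move=> mf s0; rewrite leNgt -decr_gt ?decr_ge0// ltxx. Qed.

Lemma decr_nonincr f (s t : R) : Lmeasurable f -> 0 < s -> s <= t -> decr f t <= decr f s.
Proof.
move=> mf s0 st; rewrite leNgt; have t0 : 0 < t by exact: lt_le_trans st.
rewrite decr_gt ?decr_ge0// -leNgt; apply: (le_trans (decr_dist mf s0)).
by rewrite lee_fin.
Qed.

Lemma meas_fine_neg (G : R -> \bar R) : (forall x y, 0 <= x -> x <= y -> y <= 1 -> (G x <= G y)%E) ->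
  Lmeasurable (fun x => - fine (G x)).
Proof.
move=> h; have m := meas_fine (nd_measurable h).
exact: measurableT_comp.
Qed.

Lemma decr_meas f : Lmeasurable f -> Lmeasurable (decr f).
Proof.
move=> mf; pose G (s : R) : \bar R := if 0 < s then (- decr f s)%:E else -oo%E.
have -> : decr f = (fun s => - fine (G s)).
  apply/funext => s; rewrite /G /decr; case: ifP => s0 /=; last by rewrite oppr0.
  by rewrite opprK.
apply: meas_fine_neg => x y x0 xy y1; rewrite /G; case: ifPn => [xp|_]; last by rewrite leNye.
by rewrite (lt_le_trans xp xy) lee_fin lerN2 decr_nonincr.
Qed.

Lemma decr_rev_meas f : Lmeasurable f -> Lmeasurable (fun s => decr f (1 - s)).
Proof.
move=> mf; pose G (s : R) : \bar R := if s < 1 then (decr f (1 - s))%:E else +oo%E.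
have -> : (fun s => decr f (1 - s)) = (fun s => fine (G s)).
  apply/funext => s; rewrite /G; case: ifPn => // s1; rewrite /decr subr_gt0 (negbTE s1)//.
apply: meas_fine; apply: nd_measurable => x y x0 xy y1; rewrite /G.
case: (ltP y 1) => [yp|_]; last by rewrite leey.
rewrite (le_lt_trans xy yp) lee_fin decr_nonincr//; lra.
Qed.

End rearrangement.

(** * Dilations on X and the upper Boyd index *)

Section dilations.
Context (R : realType) (X : fspace R).
Hypothesis hX : ri_space X.
Local Notation leb := (@completed_lebesgue_measure R).
Local Notation I01 := (`[0, 1]%classic : set (lebT R)).
Local Notation df := distribution_fun.
Local Notation N := (fnorm X).
Implicit Types f g h : R -> R.
Let hB := ri_bfs hX.

Lemma dist_sub_itv g (b : bool) (u v : R) (tau : R) (M : \bar R) : Lmeasurable g -> u <= v ->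
  (forall x, I01 x -> tau < `|g x| -> u <= x <= v) -> ((v - u)%:E <= M)%E -> (df g tau <= M)%E.
Proof.
move=> mg uv h; apply: le_trans; rewrite -(@leb_itv R u v true false uv).
apply: le_measure; rewrite ?inE; [exact: level_meas|exact: itv_leb|].
by move=> x [Ix hx] /=; rewrite in_itv /=; exact: h.
Qed.

Lemma decr_X f : X f -> X (decr f) /\ N (decr f) <= N f.
Proof.
move=> Xf; have mf := Xmeas hB Xf; have md := decr_meas mf.
apply: ri_dist => // tau tau0; have d0 : 0 <= fine (df f tau) by rewrite fine_ge0.
apply: (@dist_sub_itv _ true 0 (fine (df f tau))) => //.
  move=> x; rewrite /= in_itv /= => /andP[x0 _]; rewrite ger0_norm ?decr_ge0// => h.
  have xp : 0 < x by move: h; rewrite /decr; case: ifP => // _; rewrite ltNge tau0.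
  by move: h; rewrite decr_gt// (dist_fin tau mf) lte_fin x0 => /ltW.
by rewrite subr0 -(dist_fin tau mf).
Qed.

(* [f^*] on the left half of [0,1] and its mirror image on the right half; its distribution function
   is [min(2 d_f, 1)]. *)
Lemma doubling f : X f -> exists F, [/\ X F, N F <= 2 * N f &
  forall tau : R, 0 <= tau -> (Order.min (2%:E * df f tau) 1%:E <= df F tau)%E].
Proof.
move=> Xf; have mf := Xmeas hB Xf.
pose L : set (lebT R) := `[0, 1/2]%classic; pose Q : set (lebT R) := `]1/2, 1]%classic.
pose F1 := decr f \* (\1_L : R -> R); pose F2 := (fun s => decr f (1 - s)) \* (\1_Q : R -> R).
have mF1 : Lmeasurable F1.
  by apply: measurable_funM; [exact: decr_meas|apply: indic_meas; exact: itv_leb].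
have mF2 : Lmeasurable F2.
  by apply: measurable_funM; [exact: decr_rev_meas|apply: indic_meas; exact: itv_leb].
have d0 tau : 0 <= fine (df f tau) by rewrite fine_ge0.
have d1 tau : fine (df f tau) <= 1 by rewrite -lee_fin -(dist_fin tau mf) dist_le1.
have zero tau s : 0 <= tau -> tau < decr f s -> 0 < s.
  by move=> t0; rewrite /decr; case: ifP => // _; rewrite ltNge t0.
have [X1 N1] : X F1 /\ N F1 <= N f.
  apply: ri_dist => // tau tau0.
  apply: (@dist_sub_itv _ true 0 (fine (df f tau))) => //; last by rewrite subr0 -(dist_fin tau mf).
  move=> x; rewrite /= in_itv /= => /andP[x0 _].
  rewrite /F1 /= indicE; case: (x \in L); rewrite ?mulr1 ?mulr0 ?normr0; last by rewrite ltNge tau0.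
  rewrite ger0_norm ?decr_ge0// => h; have xp := zero _ _ tau0 h.
  by move: h; rewrite decr_gt// (dist_fin tau mf) lte_fin x0 => /ltW.
have [X2 N2] : X F2 /\ N F2 <= N f.
  apply: ri_dist => // tau tau0.
  apply: (@dist_sub_itv _ true (1 - fine (df f tau)) 1) => //.
  - by have := d0 tau; lra.
  - move=> x; rewrite /= in_itv /= => /andP[x0 x1].
    rewrite /F2 /= indicE; case: (x \in Q); rewrite ?mulr1 ?mulr0 ?normr0; last by rewrite ltNge tau0.
    rewrite ger0_norm ?decr_ge0// => h; have xp := zero _ _ tau0 h.
    by move: h; rewrite decr_gt// (dist_fin tau mf) lte_fin x1 => h; apply/andP; split => //; lra.
  - by rewrite opprB addrC subrK -(dist_fin tau mf).
exists (F1 \+ F2); split; first exact: XD.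
  by apply: (le_trans (ND hB X1 X2)); lra.
(* The level set of [F1 + F2] contains []0, e[] and its mirror image, which are disjoint because
   [e <= 1/2]. *)
move=> tau tau0; set e := Num.min (fine (df f tau)) (1 / 2).
have e0 : 0 <= e by rewrite le_min d0; lra.
have e2 : e <= 1 / 2 by rewrite ge_min lexx orbT.
have ed : e <= fine (df f tau) by rewrite ge_min lexx.
pose A : set (lebT R) := `]0, e[%classic; pose B : set (lebT R) := `]1 - e, 1[%classic.
have mA : measurable A by exact: itv_leb.
have mB : measurable B by exact: itv_leb.
have AB : A `&` B = set0.
  rewrite -subset0 => x []; rewrite /A /B /= !in_itv /= => /andP[_ h1] /andP[h2 _].
  by exfalso; move: h1 h2; lra.
have lA : leb A = e%:E by rewrite /A leb_itv// subr0.
have lB : leb B = e%:E by rewrite /B leb_itv; [congr EFin; lra|lra].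
have lAB : leb (A `|` B) = (leb A + leb B)%E by exact: measureU.
apply: (@le_trans _ _ (leb (A `|` B))).
  rewrite lAB lA lB -EFinD (dist_fin tau mf) -EFinM -EFin_min lee_fin.
  rewrite /e; have := d0 tau; move: (fine _) => c c0.
  by case: (leP c (1 / 2)) => h; case: (leP (2 * c) 1) => h'; lra.
apply: le_measure; rewrite ?inE; [exact: measurableU|by apply: level_meas; exact: measurable_funD|].
move=> x []; rewrite /A /B /= in_itv /= => /andP[h1 h2].
  have xL : x \in L by rewrite inE /L /= in_itv /= (ltW h1) /=; lra.
  have xQ : (x \in Q) = false by apply/negbTE; rewrite notin_setE /Q /= in_itv /= => /andP[]; lra.
  split; first by rewrite in_itv /= (ltW h1) /=; lra.
  rewrite /F1 /F2 /= !indicE xL xQ mulr1 mulr0 addr0 ger0_norm ?decr_ge0//.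
  rewrite decr_gt// (dist_fin tau mf) lte_fin; exact: lt_le_trans ed.
have xL : (x \in L) = false by apply/negbTE; rewrite notin_setE /L /= in_itv /= => /andP[_]; lra.
have xQ : x \in Q by rewrite inE /Q /= in_itv /= (ltW h2) andbT; lra.
split; first by rewrite in_itv /= (ltW h2) andbT; lra.
rewrite /F1 /F2 /= !indicE xL xQ mulr1 mulr0 add0r ger0_norm ?decr_ge0//.
by rewrite decr_gt ?subr_gt0// (dist_fin tau mf) lte_fin; lra.
Qed.

(** Each doubling removes a factor 2 from the hypothesis. The cap at 1 in [doubling] is harmless
    because the distribution function of [h] never exceeds 1. *)
Lemma dist_le_pow k f h : X f -> Lmeasurable h ->
  (forall tau : R, 0 <= tau -> (df h tau <= (2 ^+ k)%:E * df f tau)%E) ->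
  X h /\ N h <= 2 ^+ k * N f.
Proof.
elim: k f => [|k IH] f Xf mh hd.
  rewrite expr0 mul1r; apply: ri_dist => // tau tau0.
  by have := hd tau tau0; rewrite expr0 mul1e.
have [F [XF NF dF]] := doubling Xf.
have [|Xh Nh] := IH F XF mh; last first.
  split => //; apply: (le_trans Nh); rewrite exprSr -mulrA ler_wpM2l//.
move=> tau tau0; have mf := Xmeas hB Xf; have mF := Xmeas hB XF.
have := dF tau tau0; have := hd tau tau0; have := dist_le1 tau mh.
rewrite (dist_fin tau mf) (dist_fin tau mF) (dist_fin tau mh) -!EFinM -EFin_min !lee_fin.
have k1 : 1 <= 2 ^+ k :> R by rewrite exprn_ege1//; lra.
have : 0 <= fine (df f tau) by rewrite fine_ge0.
rewrite exprSr; move: (fine _) (fine _) (fine _) (2 ^+ k) k1 => a b c p p1 a0 h1 h2.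
have p0 : 0 <= p by lra.
rewrite ge_min => /orP[] h3; have := ler_wpM2l p0 h3; lra.
Qed.

(** Dilation multiplies the distribution function by at most [t], and [t] is rounded up to a power
    of 2 not exceeding [2 t]. The crude factor 2 disappears in the logarithmic limit. *)
Lemma dilation_X (t : R) f : 1 <= t -> X f ->
  X (dilation t f) /\ N (dilation t f) <= 2 * t * N f.
Proof.
move=> t1 Xf; have mf := Xmeas hB Xf; have t0 : 0 < t by lra.
have I01t x : I01 x -> 0 <= x / t <= 1.
  rewrite /= in_itv /= => /andP[x0 x1]; rewrite divr_ge0 ?(ltW t0)//= ler_pdivrMr// mul1r.
  exact: le_trans t1.
have md : Lmeasurable (dilation t f).
  move=> _ Y mY; have mA := mf (@mI01 R) Y mY.
  have [mS _] := leb_scale t0 mA.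
  rewrite (_ : _ `&` _ = I01 `&` [set x | (I01 `&` f @^-1` Y) (x / t)]).
    by apply: measurableI => //; exact: mI01.
  apply/seteqP; split => x /= [Ix]; rewrite /dilation (I01t _ Ix) => h; split => //.
    by split => //; rewrite in_itv /=; exact: I01t.
  by case: h.
have dd tau : 0 <= tau -> (df (dilation t f) tau <= t%:E * df f tau)%E.
  move=> tau0; have [mS <-] := leb_scale t0 (level_meas tau mf).
  apply: le_measure; rewrite ?inE//; first exact: level_meas.
  move=> x /= [Ix]; rewrite /dilation (I01t _ Ix) => h; split => //.
  by rewrite in_itv /=; exact: I01t.
have [k k1 k2] : exists2 k, t <= 2 ^+ k & 2 ^+ k <= 2 * t :> R.
  have Pex : exists n, t <= 2 ^+ n.
    exists (Num.truncn t).+1; apply: ltW; apply: lt_trans (truncnS_gt t) _.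
    by rewrite -natrX ltr_nat ltn_expl.
  case: (ex_minnP Pex) => -[|k] kt kmin; first by exists 0%N; rewrite // expr0; lra.
  exists k.+1 => //; rewrite exprS ler_wpM2l//; apply: ltW; rewrite ltNge; apply/negP => /kmin.
  by rewrite ltnn.
have [|Xd Nd] := dist_le_pow (k := k) Xf md.
  move=> tau tau0; apply: (le_trans (dd tau tau0)).
  by apply: lee_wpmul2r; [exact: measure_ge0|rewrite lee_fin].
split => //; apply: (le_trans Nd); rewrite ler_wpM2r//; exact: (Nge0 hB).
Qed.

Local Notation hn t := (op_norm X X (dilation t)).

Lemma dilation_op_norm (t : R) : 1 <= t ->
  [/\ 0 <= hn t, hn t <= 2 * t & forall f, X f -> N (dilation t f) <= hn t * N f].
Proof.
move=> t1; set S := [set N (dilation t f) | f in unit_ball X].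
have S0 : S !=set0.
  exists (N (dilation t (cst 0))); exists (cst 0) => //; split; first exact: bfs_zero.
  by rewrite (N0 hB).
have ubS : ubound S (2 * t).
  move=> _ [f [Xf f1] <-]; have [_ le] := dilation_X t1 Xf.
  by apply: (le_trans le); rewrite ler_piMr//; lra.
have hS : has_sup S by split => //; exists (2 * t).
have le1 f : X f -> N f <= 1 -> N (dilation t f) <= hn t.
  by move=> Xf f1; apply: sup_upper_bound => //; exists f.
have h0 : 0 <= hn t.
  apply: le_trans (le1 (cst 0) (bfs_zero hB) _); last by rewrite (N0 hB).
  exact/(Nge0 hB)/(dilation_X t1 (bfs_zero hB)).1.
split => //; first by apply: ge_sup.
move=> f Xf; have [Xd le] := dilation_X t1 Xf.
have := Nge0 hB Xf; rewrite le_eqVlt => /orP[/eqP e|f0].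
  by move: le; rewrite -e !mulr0.
have Xi := XZ hB (N f)^-1 Xf.
have := le1 _ Xi; rewrite (NZ hB _ Xf) ger0_norm ?invr_ge0 ?(ltW f0)// mulVf ?gt_eqF// => /(_ (lexx _)).
rewrite (_ : dilation t ((N f)^-1 \*o f) = (N f)^-1 \*o dilation t f); last first.
  by apply/funext => x; rewrite /dilation /=; case: ifP => // _; rewrite mulr0.
rewrite (NZ hB _ Xd) ger0_norm ?invr_ge0 ?(ltW f0)//.
by rewrite mulrC ler_pdivrMr.
Qed.

(** If [||sigma_t|| >= t] for all [t > 1], then [t <= ||sigma_t|| <= 2 t] forces the quotient of
    logarithms to tend to 1. The limit is thus computed only in the case to be refuted. *)
Lemma boyd_index_lt1 : upper_boyd_index X < 1 -> exists2 t : R, 1 < t & hn t < t.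
Proof.
move=> bi; apply: contrapT => nt.
have ht t : 1 < t -> t <= hn t.
  by move=> t1; rewrite leNgt; apply/negP => h; apply: nt; exists t.
suff e : upper_boyd_index X = 1 by move: bi; rewrite e ltxx.
rewrite /upper_boyd_index.
apply/cvg_lim => //; apply/cvgrPdist_lt => e e0.
have ln2 : 0 <= ln (2 : R) by apply: ln_ge0; lra.
near=> t.
have t1 : 1 < t by near: t; apply: nbhs_pinfty_gt; exact: num_real.
(* The threshold beyond which [ln 2 < e ln t]. *)
have t2 : expR (ln 2 / e) < t by near: t; apply: nbhs_pinfty_gt; exact: num_real.
have t0 : 0 < t by lra.
have lt0 : 0 < ln t by exact: ln_gt0.
have [_ h2 _] := dilation_op_norm (ltW t1); have h1 := ht t t1.
have a1 : ln t <= ln (hn t) by rewrite ler_ln ?posrE//; exact: lt_le_trans h1.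
have a2 : ln (hn t) <= ln 2 + ln t.
  by rewrite -lnM ?posrE// ler_ln ?posrE ?mulr_gt0//; exact: lt_le_trans h1.
have a3 : ln 2 < e * ln t.
  rewrite mulrC -ltr_pdivrMr// -ltr_expR lnK ?posrE//.
rewrite distrC ger0_norm; last by rewrite subr_ge0 ler_pdivlMr// mul1r.
rewrite ltrBlDr ltr_pdivrMr// mulrDl mul1r; lra.
Unshelve. all: by end_near.
Qed.

End dilations.

(** * Boundedness of the Cesaro operator *)

Section cesaro_bounded.
Context (R : realType) (X : fspace R).
Hypothesis hX : ri_space X.
Local Notation leb := (@completed_lebesgue_measure R).
Local Notation I01 := (`[0, 1]%classic : set (lebT R)).
Local Notation L1 A f := (integrable leb (A : set (lebT R)) (EFin \o (f : lebT R -> R))).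
Local Notation df := distribution_fun.
Local Notation N := (fnorm X).
Local Notation E := (cesaro_space X).
Local Notation nE := (fnorm (cesaro_space X)).
Local Notation C := (@cesaro_op R).
Implicit Types f g h : R -> R.
Let hB := ri_bfs hX.

Lemma geometric_series_X (v : nat -> R -> R) (K q : R) : 0 <= q -> q < 1 -> 0 <= K ->
  (forall j, X (v j)) -> (forall j, N (v j) <= K * q ^+ j) ->
  exists g, [/\ X g, norm_cvg X (fun n x => \sum_(j < n) v j x) g & N g <= K / (1 - q)].
Proof.
move=> q0 q1 K0 Xv Nv; set S := fun n x => \sum_(j < n) v j x.
have Se n : S n.+1 = S n \+ v n by apply/funext => x; rewrite /S big_ord_recr.
have S0 : S 0%N = cst 0 by apply/funext => x; rewrite /S big_ord0.
have XS n : X (S n).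
  by elim: n => [|n IH]; [rewrite S0; exact: bfs_zero|rewrite Se; exact: XD].
pose B := K / (1 - q); have q10 : 0 < 1 - q by rewrite subr_gt0.
have B0 : 0 <= B by apply: divr_ge0 => //; exact: ltW.
have KB : K = B * (1 - q) by rewrite /B divfK// gt_eqF.
have Sd m n : (n <= m)%N -> N (S m \- S n) <= B * (q ^+ n - q ^+ m).
  elim: m => [|m IH]; first by rewrite leqn0 => /eqP ->; rewrite !subrr mulr0 (_ : S 0%N \- _ = cst 0) ?(N0 hB)//; apply/funext => x /=; rewrite subrr.
  rewrite leq_eqVlt => /orP[/eqP ->|nm].
    by rewrite subrr mulr0 (_ : _ \- _ = cst 0) ?(N0 hB)//; apply/funext => x /=; rewrite subrr.
  rewrite (_ : S m.+1 \- S n = (S m \- S n) \+ v m); last by rewrite Se; apply/funext => x /=; lra.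
  apply: (le_trans (ND hB (XB hB (XS m) (XS n)) (Xv m))).
  apply: (le_trans (lerD (IH nm) (Nv m))); rewrite {1}KB exprS; lra.
have qn0 n : 0 <= q ^+ n by exact: exprn_ge0.
have cS : norm_cauchy X S.
  move=> e e0; have : (fun n => B * q ^+ n) @ \oo --> (0 : R).
    by apply: cvg_geometric; rewrite ger0_norm.
  move=> /cvgrPdist_lt /(_ _ e0)[k _ hk]; exists k => m n km kn.
  have le n' : (k <= n')%N -> B * q ^+ n' < e.
    by move=> /hk /=; rewrite sub0r normrN; apply: le_lt_trans; exact: ler_norm.
  wlog mn : m n km kn / (n <= m)%N.
    by move=> H; case: (leqP n m) => [|/ltnW] h; [exact: H|rewrite X_norm_sub//; exact: H].
  apply: (le_lt_trans (Sd m n mn)); apply: le_lt_trans (le n kn).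
  by rewrite ler_wpM2l// gerBl.
have [g Xg cg] := bfs_complete hB XS cS; exists g; split => //.
apply/ler_addgt0Pr => e e0; have /cvgrPdist_lt /(_ e e0)[k _ hk] := cg.
have := hk k (leqnn k); rewrite /= sub0r normrN (ger0_norm (Nge0 hB (XB hB (XS k) Xg))) => hk'.
have h1 : N (S k) <= B.
  have := Sd k 0%N (leq0n k); rewrite S0 (_ : S k \- cst 0 = S k); last by apply/funext => x /=; rewrite subr0.
  by move/le_trans; apply; rewrite expr0 ler_piMr// gerBl.
rewrite (_ : g = (g \- S k) \+ S k); last by apply/funext => x /=; rewrite subrK.
apply: (le_trans (ND hB (XB hB Xg (XS k)) (XS k))).
by rewrite (X_norm_sub hB Xg (XS k)) addrC; apply: lerD => //; exact: ltW.
Qed.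

(* Slicing along the levels [f^*(t^-n x)] bounds [\int_0^x |f|] by [x \sum_j t^-j f^*(t^-(j+1) x)], a series
   of dilations of [f^*] which converges in [X] as soon as [||sigma_t|| < t]. *)
Lemma cesaro_bounded : upper_boyd_index X < 1 ->
  exists2 K : R, 0 <= K & forall f, X f -> E f /\ nE f <= K * N f.
Proof.
move=> bi; have [t t1 ht] := boyd_index_lt1 hX bi.
have t0 : 0 < t by lra.
have [h0 _ hN] := dilation_op_norm hX (ltW t1).
set h := op_norm X X (dilation t) in ht h0 hN.
pose q := h / t; have q0 : 0 <= q by rewrite divr_ge0// ltW.
have q1 : q < 1 by rewrite ltr_pdivrMr// mul1r.
have q10 : 0 < 1 - q by rewrite subr_gt0.
exists (h / (1 - q)); first by rewrite divr_ge0// ltW.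
move=> f Xf; have mf := Xmeas hB Xf; have [XD0 ND0] := decr_X hX Xf.
set D := decr f in XD0 ND0.
(* Iterates of one dilation, so that only the norm [h] at the chosen [t] enters, as [h^j]. *)
pose T j := iter j (dilation t) D.
have XT j : X (T j) /\ N (T j) <= h ^+ j * N f.
  elim: j => [|j [IH1 IH2]]; first by rewrite expr0 mul1r.
  have [Xd _] := dilation_X hX (ltW t1) IH1; split => //.
  by apply: (le_trans (hN _ IH1)); rewrite exprS -mulrA ler_wpM2l.
have ti : 0 < t^-1 by rewrite invr_gt0.
have ti1 : t^-1 < 1 by rewrite invf_lt1.
have TE j x : 0 <= x <= 1 -> T j x = D (t^-1 ^+ j * x).
  elim: j x => [|j IH] x x01; first by rewrite expr0 mul1r.
  have xt : 0 <= x / t <= 1.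
    case/andP: x01 => x0 x1; rewrite divr_ge0 ?(ltW t0)//= ler_pdivrMr// mul1r; lra.
  by rewrite (_ : T j.+1 = dilation t (T j))// /dilation xt IH// exprSr -mulrA [x / t]mulrC.
(* The index [j + 1] accounts for the factor [h] in front of [q^j], where [q = h / t < 1]. *)
pose v j := t^-1 ^+ j \*o T j.+1.
have Xv j : X (v j) by apply: XZ => //; exact: (XT _).1.
have Nv j : N (v j) <= (h * N f) * q ^+ j.
  have [X1 N1] := XT j.+1; rewrite (NZ hB _ X1) ger0_norm; last by rewrite exprn_ge0// ltW.
  apply: (@le_trans _ _ (t^-1 ^+ j * (h ^+ j.+1 * N f))).
    by rewrite ler_wpM2l// exprn_ge0// ltW.
  by rewrite /q exprMn exprS le_eqVlt; apply/orP; left; apply/eqP; ring.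
have hN0 : 0 <= h * N f by rewrite mulr_ge0//; exact: (Nge0 hB).
have [g [Xg cg Ng]] := geometric_series_X q0 q1 hN0 Xv Nv.
have XS n : X (fun x => \sum_(j < n) v j x).
  elim: n => [|n IH]; first by rewrite (_ : (fun x => _) = cst 0); [exact: bfs_zero|apply/funext => x; rewrite big_ord0].
  rewrite (_ : (fun x => _) = (fun x => \sum_(j < n) v j x) \+ v n); first exact: XD.
  by apply/funext => x; rewrite big_ord_recr.
have vE j x : 0 <= x <= 1 -> v j x = t^-1 ^+ j * D (t^-1 ^+ j.+1 * x).
  by move=> x01; rewrite -TE.
have v0 j x : 0 <= x <= 1 -> 0 <= v j x.
  by move=> x01; rewrite vE// mulr_ge0 ?decr_ge0// exprn_ge0// ltW.
have leg : @ae01 R (fun x => forall n, \sum_(j < n) v j x <= g x).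
  apply: ae01_all; apply: (incr_cvg_le hB XS Xg _ cg) => m n mn; apply: ae01W => x.
  rewrite /= in_itv /= => x01; rewrite -(subnKC mn) big_split_ord /= lerDl sumr_ge0// => j _.
  exact: v0.
have key x : 0 < x < 1 -> (forall n, \sum_(j < n) v j x <= g x) ->
    (\int[leb]_(s in (`[0%R, x]%classic : set (lebT R))) `|f s|%:E <= (x * g x)%:E)%E.
  move=> /andP[x0 x1] hx; have sub := sub0x (ltW x1).
  have p0 n : 0 < t^-1 ^+ n * x by rewrite mulr_gt0// exprn_gt0.
  have pn m n : (m <= n)%N -> t^-1 ^+ n * x <= t^-1 ^+ m * x.
    by move=> mn; rewrite ler_wpM2r// ?(ltW x0)// ler_wiXn2l// ltW.
  (* The height [decr f s] is exceeded by [|f|] on a set of measure at most [s]; with [s = t^-n x]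
     the slicing sum is [x] times a partial sum of the [v j]. *)
  apply: (@level_int_le _ _ _ leb _ (Num.norm \o f) (fun n => D (t^-1 ^+ n * x)) (fun n => t^-1 ^+ n * x)).
  - exact: itv_leb.
  - by apply: measurableT_comp => //; apply: Lmeas_sub => //; exact: itv_leb.
  - by move=> s /=.
  - by move=> n; exact: decr_ge0.
  - by move=> m n mn; apply: decr_nonincr => //; exact: pn.
  - move=> n; apply: le_trans (decr_dist mf (p0 n)); apply: le_measure; rewrite ?inE.
    + rewrite (_ : _ `&` _ = `[0, x]%classic `&` [set s | I01 s /\ D (t^-1 ^+ n * x) < `|f s|]).
        by apply: measurableI; [exact: itv_leb|exact: level_meas].
      by apply/seteqP; split => s /= [sx hs]; split => //; [split => //; exact: sub|case: hs].
    + exact: level_meas.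
    + by move=> s [sx hs]; split => //; exact: sub.
  - have e : (leb (`[0%R, x]%classic : set (lebT R)) <= x%:E)%E by rewrite leb_itv ?(ltW x0)// subr0.
    by rewrite expr0 mul1r; exact: e.
  - have : geometric x t^-1 @ \oo --> (0 : R) by apply: cvg_geometric; rewrite ger0_norm// ltW.
    by apply: cvg_trans; apply: near_eq_cvg; apply: nearW => n; rewrite /geometric /= mulrC.
  move=> n; rewrite (_ : \sum_(j < n.+1) _ = x * \sum_(j < n.+1) v j x); first by rewrite ler_wpM2l// ltW.
  rewrite mulr_sumr; apply: eq_bigr => j _; rewrite vE ?(ltW x0) ?(ltW x1)//.
  by rewrite mulrCA mulrA.
have xx P : (forall x, 0 < x < 1 -> (forall n, \sum_(j < n) v j x <= g x) -> P x) -> @ae01 R P.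
  move=> H; have := @ae01_lt1 R (fun x => 0 < x < 1) (fun _ k => k).
  by move/(ae01S2 (fun x _ k1 k2 => H x k1 k2)); apply.
have lf : locint f.
  split => //; apply/(ae_locint mf); apply: xx => x hx1 hx2.
  exact: le_lt_trans (key x hx1 hx2) (ltry _).
have Cg : @ae01 R (fun x => `|C (Num.norm \o f) x| <= `|g x|).
  apply: xx => x hx1 hx2; have /andP[x0 x1] := hx1.
  have FI : L1 `[0, x]%classic (Num.norm \o f) by apply: (locint_abs lf).2; rewrite ltW.
  have := key x hx1 hx2; rewrite -(fineK (integrable_fin_num (@itv_leb R _) FI)) lee_fin => hh.
  rewrite (cesaro_abs_norm f (ltW x0)); apply: le_trans (ler_norm _).
  by rewrite /cesaro_op ler_pdivrMl.
have [XC NC] := X_ideal hB Xg (cesaro_meas (locint_abs lf).1) Cg.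
split; first exact/EP.
by apply: (le_trans NC); apply: (le_trans Ng); rewrite mulrAC.
Qed.

End cesaro_bounded.

(** * Transfer to the Cesaro operator *)

Section transfer.
Context (R : realType) (X : fspace R).
Hypothesis hX : ri_space X.
Hypothesis hne : fcarrier X <> Linfty.
Hypothesis mc : monotone_cauchy X.
Hypothesis bi : upper_boyd_index X < 1.
Local Notation N := (fnorm X).
Local Notation E := (cesaro_space X).
Local Notation nE := (fnorm (cesaro_space X)).
Local Notation C := (@cesaro_op R).
Local Notation m := (@cesaro_measure R).
Implicit Types f g h : R -> R.
Let hB := ri_bfs hX.

(** Weak compactness is a statement about unit balls; scaling the weak space absorbs the norm of the
    embedding of [X] in the Cesaro space. *)
Definition weak_scale (k : R) (x : weak_space X) : weak_space X :=
  SigSub (mem_set (XZ hB k (set_mem (valP x)))).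

Lemma weak_scale_continuous (k : R) : continuous (weak_scale k).
Proof.
have c (phi : set_type (dual_space X)) : continuous (fun y : weak_space X => dual_eval (weak_scale k y) phi).
  have dphi := set_mem (valP phi).
  rewrite (_ : (fun y => _) = (fun y : weak_space X => k * set_val phi (set_val y))); last first.
    by apply/funext => y; apply: (dualZ hX) => //; exact: set_mem (valP y).
  by move=> x; exact: (cvgM (cvg_cst k) (@weak_eval_continuous R X phi x)).
apply: continuous_comp_initial => x; apply/cvg_sup; first exact/fmap_filter/nbhs_filter.
move=> phi; move: x.
apply/(@continuousP _ (initial_topology (@^~ phi))) => A [U oU <-].
exact: (open_comp (fun y _ => c phi y) oU).
Qed.

(** For [f] in the unit ball of [X], [f / k] lies in the unit ball of [L^1(m)], so a compact set [K]
    for [I_m] gives the compact set [k K] for [C]. *)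
Lemma weakly_compact_cesaro : weakly_compact (vm_L1 X m) X (integration_operator X m) ->
  weakly_compact X X C.
Proof.
move=> [_ [K PK [cK clK]]]; have [B B0 hB'] := cesaro_bounded hX bi.
have Cmap f : X f -> X (C f) by move=> /hB'[Ef _]; exact: (E_C hX Ef).1.
split => //; pose k := B + 1; have k0 : 0 < k by rewrite /k; lra.
exists (weak_scale k^-1 @^-1` K); last split.
- move=> x [f [Xf f1] fx] /=; rewrite /preimage /=.
  have Xg := XZ hB k^-1 Xf; have [Eg leg] := hB' _ Xg.
  have [vg ng XI NI Iphi] := scalarly_integrable_vm hX (E_scalarly_integrable hX hne mc Eg).
  pose p : weak_space X := SigSub (mem_set XI).
  (* The hypothesis puts [I_m (f / k)] into [K]; [C f / k] may be another representative of the same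
     class, and closedness of [K] carries membership over. *)
  apply: (weak_closed_sat (p := p) clK).
    move=> phi dphi; rewrite [LHS](Iphi phi dphi) [set_val (weak_scale _ _)](_ : _ = k^-1 \*o C f); last by rewrite fx.
    apply: (dual_ae hX dphi (Cmap _ Xg) (XZ hB k^-1 (Cmap _ Xf))).
    have lf := E_locint (hB' f Xf).1; have l0 := E_locint (E_zero hX).
    apply: ae01_lt1 => y hy; have := cesaroL k^-1 lf l0 hy; rewrite cesaro0 addr0 => e.
    transitivity (C (k^-1 \*o f \+ cst 0) y); last exact: e.
    by congr (C _ y); apply/funext => z /=; rewrite addr0.
  apply: PK; exists (k^-1 \*o f) => //; split => //.
  apply: (le_trans ng); apply: (le_trans leg); rewrite (NZ hB _ Xf) ger0_norm; last by rewrite invr_ge0 ltW.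
  rewrite mulrCA mulrC ler_pdivrMr// mul1r; apply: (@le_trans _ _ (B * 1)); first by rewrite ler_wpM2l.
  by rewrite /k; lra.
- rewrite (_ : _ @^-1` K = weak_scale k @` K); last first.
    apply/seteqP; split => x /=.
      move=> Kx; exists (weak_scale k^-1 x) => //; apply: val_inj; apply/funext => y /=.
      by rewrite mulrA mulfV ?mul1r// gt_eqF.
    move=> [y Ky <-]; rewrite /preimage /= (_ : weak_scale k^-1 _ = y)//; apply: val_inj; apply/funext => z /=.
    by rewrite mulrA mulVf ?mul1r// gt_eqF.
  apply: continuous_compact => //; apply: continuous_subspaceT; exact: weak_scale_continuous.
- apply: preimage_closed => // x _; exact: weak_scale_continuous.
Qed.

(** Functionals on [L^1(m)] restrict to functionals on [X] through the bounded embedding, so weak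
    convergence in [X] implies weak convergence in [L^1(m)]. *)
Lemma completely_continuous_cesaro : completely_continuous (vm_L1 X m) X (integration_operator X m) ->
  completely_continuous X X C.
Proof.
move=> [_ cc]; have [B B0 hB'] := cesaro_bounded hX bi.
have Cmap f : X f -> X (C f) by move=> /hB'[Ef _]; exact: (E_C hX Ef).1.
have vm f : X f -> [/\ vm_L1 X m f, fnorm (vm_L1 X m) f <= nE f, 0 <= fnorm (vm_L1 X m) f,
    X (integration_operator X m f) & N (integration_operator X m f \- C f) = 0].
  move=> Xf; have si := E_scalarly_integrable hX hne mc (hB' f Xf).1.
  by have [h1 h2 h3 h4 _] := scalarly_integrable_vm hX si; split; [exact: h1|exact: h2|exact: (vm_norm_ge0 hX si)|exact: h3|exact: h4].
split => // u f Xu Xf uf.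
have [|||g Xg cg] := cc u f.
- by move=> n; have [] := vm _ (Xu n).
- by have [] := vm _ Xf.
- move=> theta [tl [M hM]]; apply: uf; split.
    by move=> a p q Xp Xq; apply: tl; [have [] := vm _ Xp|have [] := vm _ Xq].
  exists (`|M| * B) => p Xp; have [v1 v2 v3 _ _] := vm _ Xp.
  apply: (le_trans (hM _ v1)); apply: (@le_trans _ _ (`|M| * fnorm (vm_L1 X m) p)).
    by rewrite ler_wpM2r ?ler_norm.
  by rewrite -mulrA ler_wpM2l//; apply: (le_trans v2); exact: (hB' p Xp).2.
exists g => //; apply/cvgrPdist_lt => e e0; have /cvgrPdist_lt /(_ e e0)[k _ hk] := cg.
exists k => // n /= kn; have := hk n kn; rewrite /= !sub0r !normrN.
have [_ _ _ XI NI] := vm _ (Xu n); have XCu := Cmap _ (Xu n).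
rewrite (ger0_norm (Nge0 hB (XB hB XI Xg))) (ger0_norm (Nge0 hB (XB hB XCu Xg))).
apply: le_lt_trans; apply: (le_trans (NB hB XCu XI Xg)).
by rewrite (X_norm_sub hB XCu XI) NI add0r.
Qed.

End transfer.

Theorem proposition5p2 (R : realType) (X : fspace R)
    (hX : ri_space X) (hXinf : fcarrier X <> Linfty) :
  let m := @cesaro_measure R in
  let I_m := integration_operator X m in
  (weakly_compact (vm_L1 X m) X I_m ->
     weakly_sequentially_complete (cesaro_space X) /\
     (upper_boyd_index X < 1 -> weakly_compact X X cesaro_op)) /\
  (completely_continuous (vm_L1 X m) X I_m ->
     weakly_sequentially_complete (cesaro_space X) /\
     (upper_boyd_index X < 1 -> completely_continuous X X cesaro_op)).
Proof.
move=> m I_m; split => h.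
  have mc := weakly_compact_monotone_cauchy hX hXinf h.
  by split; [exact: cesaro_space_wsc|move=> bi; exact: weakly_compact_cesaro].
have mc := completely_continuous_monotone_cauchy hX hXinf h.
by split; [exact: cesaro_space_wsc|move=> bi; exact: completely_continuous_cesaro].
Qed.
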